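(* Let $(\Omega,\mathscr H,\hat{\mathbb E})$ be a sub-linear expectation space with a non-decreasing family of subspaces $\{\mathscr H_t;t\ge0\}$ of $\mathscr H$ and conditional expectation operators $\hat{\mathbb E}_t=\hat{\mathbb E}[\,\cdot\,|\mathscr H_t]$ satisfying properties (i) and (ii) of the context. Let $(M_t)_{t\ge0}$ be a random process in $(\Omega,\mathscr H,\mathscr H_t,\hat{\mathbb E})$ with $M_0=0$ such that for all $p>0$ and $t\ge0$, $$C_{\mathbb V}(|M_t|^p)<\infty\ \Longrightarrow\ \hat{\mathbb E}[|M_t|^p]<\infty .$$ Suppose that $M_t$ satisfies (I) both $M_t$ and $-M_t$ are martingales; (II) for a constant $\overline\sigma^2>0$, $M_t^2-\overline\sigma^2t$ is a martingale; (III) for a constant $0<\underline\sigma^2\le\overline\sigma^2$, $-(M_t^2-\underline\sigma^2t)$ is a martingale; (IV) for any $T>0$, $\lim_{\delta\to0}W_T(M,\delta)=0$. Then $M_1\sim N(0,[\underline\sigma^2,\overline\sigma^2])$ and $M$ has the $G$-Brownian motion property: for each $0\le t_1\le\dots\le t_d\le t\le s$ and each $\varphi\in C_{l,Lip}(\mathbb R^{d+1})$, $$\hat{\mathbb E}\big[\varphi(M_{t_1},\dots,M_{t_d},M_s-M_t)\big]=\hat{\mathbb E}\Big[\widetilde{\mathbb E}\big[\varphi(x_1,\dots,x_d,\sqrt{s-t}\,\xi)\big]\Big|_{x_1=M_{t_1},\dots,x_d=M_{t_d}}\Big],$$ where $\xi\sim N(0,[\underline\sigma^2,\overline\sigma^2])$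 under $\widetilde{\mathbb E}$.
   Context: Sub-linear expectation space: Let $(\Omega,\mathcal F)$ be a measurable space and $\mathscr H$ a linear space of real functions on $(\Omega,\mathcal F)$ (called random variables) such that $X_1,\dots,X_n\in\mathscr H$ implies $\varphi(X_1,\dots,X_n)\in\mathscr H$ for each $\varphi\in C_{l,Lip}(\mathbb R^n)$. Here $C_{l,Lip}(\mathbb R^n)$ is the space of functions satisfying $|\varphi(x)-\varphi(y)|\le C(1+|x|^m+|y|^m)|x-y|$ for all $x,y\in\mathbb R^n$, for some $C>0$, $m\in\mathbb N$ depending on $\varphi$. A sub-linear expectation is a function $\hat{\mathbb E}:\mathscr H\to[-\infty,\infty]$ such that for all $X,Y\in\mathscr H$: (1) $X\ge Y$ implies $\hat{\mathbb E}[X]\ge\hat{\mathbb E}[Y]$; (2) $\hat{\mathbb E}[c]=c$ for constants $c$; (3) $\hat{\mathbb E}[X+Y]\le\hat{\mathbb E}[X]+\hat{\mathbb E}[Y]$ whenever the right side is not of the form $+\infty-\infty$ or $-\infty+\infty$; (4) $\hat{\mathbb E}[\lambda X]=\lambda\hat{\mathbb E}[X]$ for $\lambda\ge0$. If a function $X$ on $\Omega$ is not in $\mathscr H$, $\hat{\mathbb E}[X]$ denotes $\inf\{\hat{\mathbb E}[Y]:X\le Y\in\mathscr H\}$. The capacity is $\mathbb V(A)=\inf\{\hat{\mathbb E}[\xi]:I_A\le\xi,\ \xi\in\mathscr H\}$, $A\in\mathcal F$, and the Choquet integral is $C_{\mathbb V}(X)=\int_0^\infty\mathbb V(X\ge t)\,dt+\int_{-\infty}^0[\mathbb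 V(X\ge t)-1]\,dt$. Notation: $x^+=\max(x,0)$, $x^-=\max(-x,0)$. Conditional expectations: write $X\le Y$ in $L_1$ if $\hat{\mathbb E}[(X-Y)^+]=0$, and $X=Y$ in $L_1$ if both $X\le Y$ and $Y\le X$ in $L_1$. Each $\mathscr H_t$ contains the constants and satisfies: $X_1,\dots,X_d\in\mathscr H_t$ implies $\varphi(X_1,\dots,X_d)\in\mathscr H_t$ for all $\varphi\in C_{l,Lip}(\mathbb R^d)$; $\mathscr H_s\subset\mathscr H_t$ for $s\le t$. Put $\mathscr L(\mathscr H)=\{X\in\mathscr H:\hat{\mathbb E}[|X|]<\infty\}$ and similarly $\mathscr L(\mathscr H_t)$. The operators are maps $\hat{\mathbb E}_t:\mathscr L(\mathscr H)\to\mathscr L(\mathscr H_t)$, written $\hat{\mathbb E}[X|\mathscr H_t]=\hat{\mathbb E}_t[X]$. Properties, for all $X,Y\in\mathscr L(\mathscr H)$: (i) $\hat{\mathbb E}_t[X+Y]=X+\hat{\mathbb E}_t[Y]$ in $L_1$ if $X\in\mathscr H_t$; and $\hat{\mathbb E}_t[XY]=X^+\hat{\mathbb E}_t[Y]+X^-\hat{\mathbb E}_t[-Y]$ in $L_1$ if $X\in\mathscr H_t$ and $XY\in\mathscr L(\mathscr H)$; (ii) $\hat{\mathbb E}[\hat{\mathbb E}_t[X]]=\hat{\mathbb E}[X]$. Martingale: a process $M_t$ is a martingale if $M_t\in\mathscr L(\mathscr H)$, $M_t\in\mathscr H_t$ and $\hat{\mathbb E}[M_t|\mathscr H_s]=M_s$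 (in $L_1$) for $s\le t$. Modulus: $W_T(M,\delta)=\sup_{t_i}\hat{\mathbb E}\big[\max_{1\le i\le n}|M(t_i)-M(t_{i-1})|\wedge1\big]$, the supremum being over all $\{t_i\}$ with $0=t_0<t_1<\dots<t_n=T$, $\delta/2<t_i-t_{i-1}<\delta$, $i=1,\dots,n$. G-normal distribution: for $0\le\underline\sigma^2\le\overline\sigma^2<\infty$, a random variable $\xi$ in a sub-linear expectation space $(\widetilde\Omega,\widetilde{\mathscr H},\widetilde{\mathbb E})$ is $N(0,[\underline\sigma^2,\overline\sigma^2])$ distributed (written $\xi\sim N(0,[\underline\sigma^2,\overline\sigma^2])$) if for every $\varphi\in C_{l,Lip}(\mathbb R)$ the function $u(t,x)=\widetilde{\mathbb E}[\varphi(x+\sqrt t\,\xi)]$, $t\ge0$, $x\in\mathbb R$, is the unique viscosity solution of $\partial_tu-G(\partial_{xx}^2u)=0$, $u(0,x)=\varphi(x)$, where $G(\alpha)=\frac12(\overline\sigma^2\alpha^+-\underline\sigma^2\alpha^-)$. *)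

(* Defs.v *)
From HB Require Import structures.
From mathcomp Require Import all_boot all_order all_algebra.
From mathcomp Require Import all_classical all_reals all_analysis.
Set Implicit Arguments.
Unset Strict Implicit.
Unset Printing Implicit Defensive.
Import Order.TTheory GRing.Theory Num.Theory.
Import numFieldNormedType.Exports.
Local Open Scope classical_set_scope.
Local Open Scope ring_scope.

(* C_{l,Lip}(V), used with V = R and with V = 'rV[R]_n.  On 'rV[R]_n the norm
   is the sup norm; all norms of R^n give the same class. *)
Definition ClLip (R : realType) (V : normedZmodType R) (phi : V -> R) : Prop :=
  exists (C : R) (m : nat), 0 < C /\
    forall x y : V,
      `|phi x - phi y| <= C * (1 + `|x| ^+ m + `|y| ^+ m) * `|x - y|.

Definition linear_space (R : realType) (Omega : Type)
    (S : set (Omega -> R)) : Prop :=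
  [/\ S (cst 0),
      forall X Y, S X -> S Y -> S (fun w => X w + Y w)
    & forall (a : R) X, S X -> S (fun w => a * X w)].

Definition ClLip_stable (R : realType) (Omega : Type)
    (S : set (Omega -> R)) : Prop :=
  forall (n : nat) (phi : 'rV[R]_n -> R) (X : 'I_n -> Omega -> R),
    ClLip phi -> (forall i, S (X i)) -> S (fun w => phi (\row_i X i w)).

(* [raw_E] is meaningful on [rv] only; see [Ehat] below.  The sigma-algebra of
   [Omega] plays no role in the axioms: no measurability is imposed on [rv].
   [x +? y] says that [x + y] is not of the form +oo - oo or -oo + oo. *)
Record sublinear_expectation (R : realType) d (Omega : measurableType d) := {
  rv : set (Omega -> R) ;
  raw_E : (Omega -> R) -> \bar R ;
  rv_linear : linear_space rv ;
  rv_ClLip : ClLip_stable rv ;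
  sle_monotone : forall X Y, rv X -> rv Y ->
    (forall w, Y w <= X w) -> (raw_E Y <= raw_E X)%E ;
  sle_cst : forall c : R, raw_E (cst c) = c%:E ;
  sle_subadd : forall X Y, rv X -> rv Y -> (raw_E X +? raw_E Y)%E ->
    (raw_E (fun w => (X w + Y w)%R) <= raw_E X + raw_E Y)%E ;
  sle_homog : forall (a : R) X, rv X -> 0 <= a ->
    raw_E (fun w => (a * X w)%R) = (a%:E * raw_E X)%E
}.

Definition Ehat (R : realType) d (Omega : measurableType d)
    (E : sublinear_expectation R Omega) (X : Omega -> R) : \bar R :=
  if `[< rv E X >] then raw_E E X
  else ereal_inf [set raw_E E Y | Y in [set Y | rv E Y /\ forall w, X w <= Y w]].

(* The same formula is used for every [A : set Omega], measurable or not. *)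
Definition capacity (R : realType) d (Omega : measurableType d)
    (E : sublinear_expectation R Omega) (A : set Omega) : \bar R :=
  ereal_inf [set Ehat E Y | Y in [set Y | rv E Y /\ forall w, \1_A w <= Y w]].

Definition choquet (R : realType) d (Omega : measurableType d)
    (E : sublinear_expectation R Omega) (X : Omega -> R) : \bar R :=
  (\int[lebesgue_measure]_(t in `[0%R, +oo[) capacity E [set w | (t <= X w)%R]
   + \int[lebesgue_measure]_(t in `]-oo, 0%R])
        (capacity E [set w | (t <= X w)%R] - 1))%E.

Definition leL1 (R : realType) d (Omega : measurableType d)
    (E : sublinear_expectation R Omega) (X Y : Omega -> R) : Prop :=
  Ehat E (fun w => Num.max (X w - Y w) 0) = 0%E.

Definition eqL1 (R : realType) d (Omega : measurableType d)
    (E : sublinear_expectation R Omega) (X Y : Omega -> R) : Prop :=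
  leL1 E X Y /\ leL1 E Y X.

Definition L1 (R : realType) d (Omega : measurableType d)
    (E : sublinear_expectation R Omega) (S : set (Omega -> R)) :
    set (Omega -> R) :=
  [set X | S X /\ (Ehat E (fun w => `|X w|%R) < +oo)%E].

(* Families indexed by [R] are only constrained (and only used) at times
   [0 <= t]. *)
Definition filtration (R : realType) d (Omega : measurableType d)
    (E : sublinear_expectation R Omega) (H : R -> set (Omega -> R)) : Prop :=
  (forall t, 0 <= t ->
     [/\ H t `<=` rv E, linear_space (H t),
         forall c : R, H t (cst c) & ClLip_stable (H t)]) /\
  (forall s t, 0 <= s -> s <= t -> H s `<=` H t).

Definition conditional_expectation (R : realType) d (Omega : measurableType d)
    (E : sublinear_expectation R Omega) (H : R -> set (Omega -> R))
    (Et : R -> (Omega -> R) -> Omega -> R) : Prop :=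
  forall t, 0 <= t ->
  [/\ forall X, L1 E (rv E) X -> L1 E (H t) (Et t X),
      forall X Y, L1 E (rv E) X -> L1 E (rv E) Y -> H t X ->
        eqL1 E (Et t (fun w => X w + Y w)) (fun w => X w + Et t Y w),
      forall X Y, L1 E (rv E) X -> L1 E (rv E) Y -> H t X ->
        L1 E (rv E) (fun w => X w * Y w) ->
        eqL1 E (Et t (fun w => X w * Y w))
          (fun w => Num.max (X w) 0 * Et t Y w
                    + Num.max (- X w) 0 * Et t (fun w' => - Y w') w)
    & forall X, L1 E (rv E) X -> Ehat E (Et t X) = Ehat E X].

Definition martingale (R : realType) d (Omega : measurableType d)
    (E : sublinear_expectation R Omega) (H : R -> set (Omega -> R))
    (Et : R -> (Omega -> R) -> Omega -> R) (M : R -> Omega -> R) : Prop :=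
  (forall t, 0 <= t -> L1 E (rv E) (M t) /\ H t (M t)) /\
  (forall s t, 0 <= s -> s <= t -> eqL1 E (Et s (M t)) (M s)).

Definition mesh_partition (R : realType) (T delta : R) (n : nat)
    (t : nat -> R) : Prop :=
  [/\ t 0%N = 0, t n = T
    & forall i, (i < n)%N ->
        t i < t i.+1 /\ delta / 2 < t i.+1 - t i < delta].

Definition modulusW (R : realType) d (Omega : measurableType d)
    (E : sublinear_expectation R Omega) (M : R -> Omega -> R)
    (T delta : R) : \bar R :=
  ereal_sup [set x | exists (n : nat) (t : nat -> R),
    mesh_partition T delta n t /\
    x = Ehat E (fun w =>
          Num.min (\big[Num.max/0]_(i < n) `|M (t i.+1) w - M (t i) w|) 1)].

(* The arguments [lo] and [up] stand for the variances, i.e. for the squares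
   of the lower and upper sigma. *)
Definition Gfun (R : realType) (lo up a : R) : R :=
  2^-1 * (up * Num.max a 0 - lo * Num.max (- a) 0).

Definition dt (R : realType) (u : R -> R -> R) (t x : R) : R :=
  derive1 (u^~ x) t.
Definition dx (R : realType) (u : R -> R -> R) (t x : R) : R :=
  derive1 (u t) x.
Definition dxx (R : realType) (u : R -> R -> R) (t x : R) : R :=
  derive1 (derive1 (u t)) x.

(* Test functions: class C^{1,2} on ]0, +oo[ x R. *)
Definition C12 (R : realType) (psi : R -> R -> R) : Prop :=
  forall t x : R, 0 < t ->
  [/\ derivable (psi^~ x) t 1, derivable (psi t) x 1
    & derivable (derive1 (psi t)) x 1] /\
  [/\ {for (t, x), continuous (fun p : R * R => dt psi p.1 p.2)},
      {for (t, x), continuous (fun p : R * R => dx psi p.1 p.2)}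
    & {for (t, x), continuous (fun p : R * R => dxx psi p.1 p.2)}].

Definition viscosity_subsolution (R : realType) (lo up : R)
    (u : R -> R -> R) : Prop :=
  forall psi, C12 psi -> forall t x : R, 0 < t ->
    (\forall p \near ((t, x) : R * R),
       u p.1 p.2 - psi p.1 p.2 <= u t x - psi t x) ->
    dt psi t x - Gfun lo up (dxx psi t x) <= 0.

Definition viscosity_supersolution (R : realType) (lo up : R)
    (u : R -> R -> R) : Prop :=
  forall psi, C12 psi -> forall t x : R, 0 < t ->
    (\forall p \near ((t, x) : R * R),
       u t x - psi t x <= u p.1 p.2 - psi p.1 p.2) ->
    0 <= dt psi t x - Gfun lo up (dxx psi t x).

(* Continuous viscosity solutions on [0, +oo[ x R of
   du/dt - G(d2u/dx2) = 0, u(0, .) = phi, of at most polynomial growth in x,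
   locally uniformly in t.  Without a growth condition the Cauchy problem does
   not have a unique solution, already for the linear heat equation. *)
Definition viscosity_solution (R : realType) (lo up : R) (phi : R -> R)
    (u : R -> R -> R) : Prop :=
  [/\ {within [set p : R * R | 0 <= p.1],
         continuous (fun p : R * R => u p.1 p.2)},
      forall T : R, exists (C : R) (m : nat), forall t x : R,
        0 <= t <= T -> `|u t x| <= C * (1 + `|x| ^+ m),
      forall x, u 0 x = phi x,
      viscosity_subsolution lo up u
    & viscosity_supersolution lo up u].

Definition unique_viscosity_solution (R : realType) (lo up : R)
    (phi : R -> R) (u : R -> R -> R) : Prop :=
  viscosity_solution lo up phi u /\
  forall v, viscosity_solution lo up phi v ->
    forall t x, 0 <= t -> v t x = u t x.

(* xi ~ N(0, [lo, up]).  The function [u] is E[phi(x + sqrt t xi)], which is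
   thereby required to be finite. *)
Definition Gnormal (R : realType) d (Omega : measurableType d)
    (E : sublinear_expectation R Omega) (xi : Omega -> R) (lo up : R) : Prop :=
  rv E xi /\
  forall phi : R -> R, ClLip phi ->
  exists u : R -> R -> R,
    (forall t x, 0 <= t ->
       Ehat E (fun w => phi (x + Num.sqrt t * xi w)) = (u t x)%:E) /\
    unique_viscosity_solution lo up phi u.

(* Main.v *)
(* Conditioning on H_t and the martingale properties of M, -M, M^2 - up t and
   -(M^2 - lo t) give, for bounded A, B, C in H_t and Y = M_s - M_t,
     E[A + B Y + C Y^2 / 2] = E[A + G(C) (s - t)].
   Applied to the logistic function along a fine partition, with cutoffs that
   the modulus condition (IV) makes harmless, this bounds exponential tails of
   M; the Choquet integrals of |M_t|^p are then finite, so all moments of M are,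
   and E|M_s - M_t|^3 = O((s - t)^(3/2)).

   Instead of the regularity theory of the G-heat equation, the explicit monotone
   scheme w' = w + h G(D^2 w / k^2) is started from a triple moving average of the
   initial datum.  An energy estimate makes the increments of its speed uniformly
   small, so a quadratic (in time) and cubic (in space) B-spline interpolation W
   of the scheme satisfies |W_t - G(W_xx)| <= eps.  W is a finite sum of products
   c(omega) a(t) b(x): the data, hence the coefficients c, may depend on M_(t_1),
   ..., M_(t_d).

   Second-order expansion along a partition of [t, s] shows that
   E[W(0, x + M_s - M_t)] and E[W(s - t, x)] differ by at most (s - t) eps, so the
   law of the increments is a limit of almost solutions.  A comparison principle
   between viscosity solutions and smooth almost solutions, together with the
   stability of viscosity solutions, identifies the limit with the unique solution
   of the G-heat equation; the same comparison applies to xi. *)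
Require Import Defs.
From HB Require Import structures.
From mathcomp Require Import all_boot all_order all_algebra.
From mathcomp Require Import all_classical all_reals all_analysis.
From mathcomp Require Import zify ring lra.
Set Implicit Arguments.
Unset Strict Implicit.
Unset Printing Implicit Defensive.
Import Order.TTheory GRing.Theory Num.Theory.
Import numFieldNormedType.Exports.
Local Open Scope classical_set_scope.
Local Open Scope ring_scope.

(** * Sublinear expectations *)

(** The obstacle at the start is circular. Expanding Y^2 leaves the cross term C M_t Y, whose mean
    is seen to vanish when C M_t is bounded or when M has moments, while the moments are to come
    from the identity that contains this term. Hence a bounded test function: the second-order
    remainder of the logistic function is a multiple of the function itself, so one step multiplies
    the expectation by 1 + O(s - t), and e^a logistic(-a) <= 1 makes the bound survive the removal
    of the truncation at a.

    The form of the scheme is dictated by adaptedness. Conditioning accepts coefficients from H_t,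
    which is closed under linear operations and under C_{l,Lip} functions of finitely many elements.
    An explicit scheme performs finitely many such operations on its data, so the coefficients of
    the interpolation stay in H_t and may be random in the second-order expansion. The averages have
    a fixed physical width while the mesh is m times finer: squared increments of the speed are
    O(m^-2) at O(m) nodes, so that their sum still tends to 0. *)

Lemma mx_coord_le (R : realType) n (v : 'rV[R]_n) j : `|v 0 j| <= `|v|.
Proof.
rewrite [leRHS]mx_normrE.
exact: (le_bigmax _ (fun ij : 'I_1 * 'I_n => `|v ij.1 ij.2|) (0, j)).
Qed.

Lemma mx_norm_le (R : realType) n (v : 'rV[R]_n) c : 0 <= c ->
  (forall j, `|v 0 j| <= c) -> `|v| <= c.
Proof.
move=> c0 vc; rewrite [leLHS]mx_normrE; apply: bigmax_le => // -[i j] _ /=.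
by rewrite ord1.
Qed.

(** * Sets of random variables closed under locally Lipschitz functions *)

Section stable_sets.
Context (R : realType) (Omega : Type) (S : set (Omega -> R)).
Hypotheses (S_lin : linear_space S) (S_stable : ClLip_stable S).
Implicit Types X Y : Omega -> R.

(** The case [n = 0] of the stability: a constant is a function of the empty family. *)
Lemma stable_cst (c : R) : S (fun=> c).
Proof.
apply: (@S_stable 0 (fun=> c) (fun _ => cst 0)) => [|[]//].
exists 1, 0%N; split => // x y.
by rewrite subrr normr0 mulr_ge0 // mul1r.
Qed.

Lemma stableD X Y : S X -> S Y -> S (fun w => X w + Y w).
Proof. by case: S_lin => _ + _; apply. Qed.

Lemma stableZ (a : R) X : S X -> S (fun w => a * X w).
Proof. by case: S_lin => _ _; apply. Qed.

Lemma stableN X : S X -> S (fun w => - X w).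
Proof.
move=> /(stableZ (-1)); congr S; apply/funext => w.
by rewrite mulN1r.
Qed.

Lemma stableB X Y : S X -> S Y -> S (fun w => X w - Y w).
Proof. by move=> SX SY; apply: stableD => //; exact: stableN. Qed.

Lemma stable_sum (I : Type) (r : seq I) (X : I -> Omega -> R) :
  (forall i, S (X i)) -> S (fun w => \sum_(i <- r) X i w).
Proof.
move=> SX; elim: r => [|i r IH].
  have := stable_cst 0; congr S; apply/funext => w; by rewrite big_nil.
have := stableD (SX i) IH; congr S; apply/funext => w; by rewrite big_cons.
Qed.

Lemma stable_comp (f : R -> R) X : ClLip f -> S X -> S (fun w => f (X w)).
Proof.
move=> [C [m [C0 hf]]] SX.
suff: S (fun w => f ((\row_(i < 1) X w) 0 0)).
  by congr S; apply/funext => w; rewrite mxE.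
apply: (@S_stable 1 (fun v => f (v 0 0)) (fun _ => X)) => //.
exists C, m; split => // x y.
have nE (v : 'rV[R]_1) : `|v| = `|v 0 0|.
  apply/eqP; rewrite eq_le mx_coord_le andbT; apply: mx_norm_le => // j.
  by rewrite ord1.
by rewrite !nE !mxE; apply: hf.
Qed.

(** The product is in C_{l,Lip}(R^2) with [m = 1]; through it all polynomial expressions enter
    [S]. *)
Lemma stableM X Y : S X -> S Y -> S (fun w => X w * Y w).
Proof.
move=> SX SY.
pose XY (i : 'I_2) := if i == 0 then X else Y.
suff: S (fun w => (\row_(i < 2) XY i w) 0 0 * (\row_(i < 2) XY i w) 0 1).
  by congr S; apply/funext => w; rewrite !mxE.
apply: (@S_stable 2 (fun v => v 0 0 * v 0 1) XY); last first.
  by move=> i; rewrite /XY; case: ifP.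
exists 1, 1%N; split => // x y.
have h0 := mx_coord_le (x - y) 0; have h1 := mx_coord_le (x - y) 1.
rewrite !mxE in h0 h1.
have -> : x 0 0 * x 0 1 - y 0 0 * y 0 1 =
  x 0 0 * (x 0 1 - y 0 1) + (x 0 0 - y 0 0) * y 0 1 by ring.
rewrite (le_trans (ler_normD _ _)) // !normrM !expr1 mul1r.
have := ler_pM (normr_ge0 _) (normr_ge0 _) (mx_coord_le x 0) h1.
have := ler_pM (normr_ge0 _) (normr_ge0 _) h0 (mx_coord_le y 1).
have := normr_ge0 (x - y); lra.
Qed.

Lemma stable_norm X : S X -> S (fun w => `|X w|).
Proof.
apply: stable_comp; exists 1, 0%N; split=> // x y.
rewrite !expr0 mul1r (le_trans (ler_dist_dist _ _)) // ler_peMl //; lra.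
Qed.

Lemma stable_max X Y : S X -> S Y -> S (fun w => Num.max (X w) (Y w)).
Proof.
move=> SX SY.
have := stableZ (2^-1) (stableD (stableD SX SY) (stable_norm (stableB SX SY))).
congr S; apply/funext => w; rewrite maxr_absE; lra.
Qed.

Lemma stableX X n : S X -> S (fun w => X w ^+ n).
Proof.
move=> SX; elim: n => [|n IH].
  by have := stable_cst 1; congr S; apply/funext => w; rewrite expr0.
by have := stableM SX IH; congr S; apply/funext => w; rewrite exprS.
Qed.

End stable_sets.

Lemma Lipschitz_ClLip (R : realType) (f : R -> R) (K : R) :
  (forall x y, `|f x - f y| <= K * `|x - y|) -> ClLip f.
Proof.
move=> hf; exists (`|K| + 1), 0%N; split => [|x y]; first by rewrite ltr_wpDl.
rewrite (le_trans (hf x y)) // ler_wpM2r // !expr0.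
have := ler_norm K; have := normr_ge0 K; lra.
Qed.

(** * Expectations of integrable random variables *)

Section sublinear.
Context (R : realType) (d : measure_display) (Omega : measurableType d).
Context (E : sublinear_expectation R Omega).
Implicit Types X Y Z : Omega -> R.

Definition ex X : R := fine (Ehat E X).
Definition Lone := L1 E (rv E).

Let rvD := stableD (rv_linear E).
Let rvZ := stableZ (rv_linear E).
Let rvN := stableN (rv_linear E).
Let rv_norm := stable_norm (@rv_ClLip _ _ _ E).
Let rv_cst := stable_cst (@rv_ClLip _ _ _ E).

Lemma EhatE X : rv E X -> Ehat E X = raw_E E X.
Proof. by move=> rX; rewrite /Ehat asboolT. Qed.

(** On [rv] the infimum is attained at [X] itself by monotonicity, so one formula serves on and off
    [rv], and [Ehat] is monotone on arbitrary functions. This matters at the very end, where a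
    function that is not known to be in [rv] has to be enclosed. *)
Lemma Ehat_inf X : Ehat E X =
  ereal_inf [set raw_E E Y | Y in [set Y | rv E Y /\ forall w, X w <= Y w]].
Proof.
rewrite /Ehat; case: asboolP => // rX; apply/eqP; rewrite eq_le.
apply/andP; split.
  by apply: le_ereal_inf_tmp => _ [Y [rY XY] <-]; exact: sle_monotone.
by apply: ereal_inf_lbound; exists X.
Qed.

Lemma Ehat_le X Y : (forall w, X w <= Y w) -> (Ehat E X <= Ehat E Y)%E.
Proof.
move=> XY; rewrite !Ehat_inf; apply: ereal_inf_le_tmp => _ [Z [rZ YZ] <-].
by exists Z => //; split => // w; exact: le_trans (XY w) (YZ w).
Qed.

Lemma Ehat_cst c : Ehat E (fun=> c) = c%:E.
Proof. by rewrite EhatE ?sle_cst//; exact: rv_cst. Qed.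

Lemma EhatZ a X : rv E X -> 0 <= a ->
  Ehat E (fun w => a * X w) = (a%:E * Ehat E X)%E.
Proof. by move=> rX a0; rewrite !EhatE ?sle_homog //; exact: rvZ. Qed.

Lemma EhatD X Y : rv E X -> rv E Y -> (Ehat E X +? Ehat E Y)%E ->
  (Ehat E (fun w => X w + Y w)%R <= Ehat E X + Ehat E Y)%E.
Proof.
move=> rX rY; rewrite (EhatE rX) (EhatE rY) EhatE; last exact: rvD.
exact: sle_subadd.
Qed.

Lemma Lone_rv X : Lone X -> rv E X. Proof. by case. Qed.

Lemma Lone_le X Y : rv E X -> Lone Y -> (forall w, `|X w| <= Y w) -> Lone X.
Proof.
move=> rX [rY Yoo] XY; split => //; apply: le_lt_trans Yoo.
by apply: Ehat_le => w; exact: le_trans (XY w) (ler_norm _).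
Qed.

Lemma Ehat_ge0 X : (forall w, 0 <= X w) -> (0 <= Ehat E X)%E.
Proof. by move=> X0; have := Ehat_le X0; rewrite Ehat_cst. Qed.

Lemma Lone_norm X : Lone X -> Lone (fun w => `|X w|).
Proof.
move=> [rX Xoo]; split; first exact: rv_norm.
by apply: le_lt_trans Xoo; apply: Ehat_le => w; rewrite normr_id.
Qed.

Lemma LoneD X Y : Lone X -> Lone Y -> Lone (fun w => X w + Y w).
Proof.
move=> [rX Xoo] [rY Yoo]; split; first exact: rvD.
have X0 : (0 <= Ehat E (fun w => `|X w|)%R)%E by exact: Ehat_ge0.
have Y0 : (0 <= Ehat E (fun w => `|Y w|)%R)%E by exact: Ehat_ge0.
apply: (@le_lt_trans _ _ (Ehat E (fun w => (`|X w| + `|Y w|)%R))).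
  by apply: Ehat_le => w; exact: ler_normD.
apply: (@le_lt_trans _ _ (Ehat E (fun w => `|X w|)%R + Ehat E (fun w => `|Y w|)%R)%E).
  by apply: EhatD; [exact: rv_norm|exact: rv_norm|exact: ge0_adde_def].
by rewrite lte_add_pinfty.
Qed.

Lemma Lone_cst c : Lone (fun=> c).
Proof. by split; [exact: rv_cst|rewrite (Ehat_cst `|c|) ltry]. Qed.

Lemma LoneZ a X : Lone X -> Lone (fun w => a * X w).
Proof.
move=> [rX Xoo]; split; first exact: rvZ.
have -> : (fun w => `|a * X w|) = (fun w => `|a| * `|X w|).
  by apply/funext => w; rewrite normrM.
rewrite EhatZ //; last exact: rv_norm.
by case: (Ehat E (fun w => `|X w|)%R) Xoo (Ehat_ge0 (fun w => normr_ge0 (X w))) => // r _ _; rewrite -EFinM ltry.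
Qed.

Lemma LoneN X : Lone X -> Lone (fun w => - X w).
Proof.
by move=> /(LoneZ (-1)); congr Lone; apply/funext => w; rewrite mulN1r.
Qed.

Lemma LoneB X Y : Lone X -> Lone Y -> Lone (fun w => X w - Y w).
Proof. by move=> LX LY; apply: LoneD => //; exact: LoneN. Qed.

Lemma Lone_sum (I : Type) (r : seq I) (X : I -> Omega -> R) :
  (forall i, Lone (X i)) -> Lone (fun w => \sum_(i <- r) X i w).
Proof.
move=> SX; elim: r => [|i r IH].
  have := Lone_cst 0; congr Lone; apply/funext => w; by rewrite big_nil.
have := LoneD (SX i) IH; congr Lone; apply/funext => w; by rewrite big_cons.
Qed.

(** The value [-oo] is excluded by [0 = E[X - X] <= E[X] + E[- X]] with [E[- X] < +oo]. *)
Lemma Ehat_fin X : Lone X -> Ehat E X = (ex X)%:E.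
Proof.
move=> LX; have [rX Xoo] := LX; rewrite /ex fineK //.
have hlt Z : Lone Z -> (Ehat E Z < +oo)%E.
  move=> [_]; apply: le_lt_trans; apply: Ehat_le => w; exact: ler_norm.
have := hlt _ LX; have := hlt _ (LoneN LX); rewrite fin_numE => h1 h2.
apply/andP; split; last by rewrite lt_eqF.
apply/negP => /eqP h.
have := EhatD rX (rvN rX); rewrite h.
have -> : (fun w => X w - X w) = (fun=> 0) by apply/funext => w; rewrite subrr.
rewrite Ehat_cst.
by case: (Ehat E (fun w => - X w)) h1 => [r| |] // _ /(_ isT).
Qed.

Lemma ex_le X Y : Lone X -> Lone Y -> (forall w, X w <= Y w) -> ex X <= ex Y.
Proof. by move=> LX LY XY; rewrite -lee_fin -!Ehat_fin //; exact: Ehat_le. Qed.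

Lemma ex_cst c : ex (fun=> c) = c.
Proof. by rewrite /ex Ehat_cst. Qed.

Lemma ex_ge0 X : (forall w, 0 <= X w) -> 0 <= ex X.
Proof. by move=> X0; rewrite /ex fine_ge0 // Ehat_ge0. Qed.

Lemma exZ a X : Lone X -> 0 <= a -> ex (fun w => a * X w) = a * ex X.
Proof.
move=> LX a0; have := EhatZ (Lone_rv LX) a0.
by rewrite !Ehat_fin //; [move=> [->]|exact: LoneZ].
Qed.

Lemma exD X Y : Lone X -> Lone Y -> ex (fun w => X w + Y w) <= ex X + ex Y.
Proof.
move=> LX LY; have := EhatD (Lone_rv LX) (Lone_rv LY).
by rewrite !Ehat_fin //; [apply|exact: LoneD].
Qed.

Lemma exB_le X Y : Lone X -> Lone Y -> ex X - ex Y <= ex (fun w => X w - Y w).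
Proof.
move=> LX LY; rewrite lerBlDr; have := exD (LoneB LX LY) LY.
suff -> : (fun w => X w - Y w + Y w) = X by [].
by apply/funext => w; rewrite subrK.
Qed.

Lemma ex_dist X Y : Lone X -> Lone Y ->
  `|ex X - ex Y| <= ex (fun w => `|X w - Y w|).
Proof.
move=> LX LY; rewrite ler_norml lerNl opprB; apply/andP; split.
  apply: le_trans (exB_le LY LX) _; apply: ex_le => [||w]; first exact: LoneB.
    by apply/Lone_norm/LoneB.
  by rewrite distrC ler_norm.
apply: le_trans (exB_le LX LY) _; apply: ex_le => [||w]; first exact: LoneB.
  by apply/Lone_norm/LoneB.
by rewrite ler_norm.
Qed.

Lemma ex_dist_le X Y Z : Lone X -> Lone Y -> Lone Z ->
  (forall w, `|X w - Y w| <= Z w) -> `|ex X - ex Y| <= ex Z.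
Proof.
move=> LX LY LZ h; apply: le_trans (ex_dist LX LY) _.
by apply: ex_le => //; apply/Lone_norm/LoneB.
Qed.

Lemma ex_sum_le (I : Type) (r : seq I) (X : I -> Omega -> R) :
  (forall i, Lone (X i)) ->
  ex (fun w => \sum_(i <- r) X i w) <= \sum_(i <- r) ex (X i).
Proof.
move=> LX; elim: r => [|i r IH].
  by under [X in ex X]eq_fun do rewrite big_nil; rewrite big_nil ex_cst.
rewrite big_cons; apply: le_trans (lerD (lexx _) IH).
apply: le_trans (exD (LX i) (Lone_sum _ LX)).
by under [X in ex X]eq_fun do rewrite big_cons.
Qed.

(** Equality in L_1 only says that both positive parts have zero expectation. Subadditivity and
    [X <= Y + (X - Y)^+] let it be used inside an expectation, next to a further term [Z]. *)
Lemma ex_eqL1 X Y Z : Lone X -> Lone Y -> Lone Z -> eqL1 E X Y ->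
  ex (fun w => Z w + X w) = ex (fun w => Z w + Y w).
Proof.
have aux X' Y' : Lone X' -> Lone Y' -> Lone Z -> leL1 E X' Y' ->
    ex (fun w => Z w + X' w) <= ex (fun w => Z w + Y' w).
  move=> LX LY LZ h.
  have LM : Lone (fun w => Num.max (X' w - Y' w) 0).
    apply: (Lone_le _ (Lone_norm (LoneB LX LY))) => [|w].
      apply: (stable_max (rv_linear E) (@rv_ClLip _ _ _ E)) => //.
      by apply/Lone_rv/LoneB.
    rewrite ger0_norm ?le_max ?lexx ?orbT // ge_max ler_norm //=.
  have := exD (LoneD LZ LY) LM; rewrite {3}/ex h addr0; apply: le_trans.
  apply: ex_le => [||w]; first exact: LoneD.
    by apply: LoneD => //; exact: LoneD.
  have : X' w - Y' w <= Num.max (X' w - Y' w) 0 by rewrite le_max lexx.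
  lra.
move=> LX LY LZ [h1 h2]; apply/eqP; rewrite eq_le.
by rewrite (aux X Y) // (aux Y X).
Qed.

(** A term without mean uncertainty is invisible: subadditivity gives one inequality from [Z] and
    the other from [- Z]. *)
Lemma ex_drop X Z : Lone X -> Lone Z -> ex Z = 0 -> ex (fun w => - Z w) = 0 ->
  ex (fun w => X w + Z w) = ex X.
Proof.
move=> LX LZ h1 h2; apply/eqP; rewrite eq_le; apply/andP; split.
  by have := exD LX LZ; rewrite h1 addr0.
have := exD (LoneD LX LZ) (LoneN LZ); rewrite h2 addr0.
by apply: le_trans; apply: ex_le => // [|w]; [apply: LoneB => //; exact: LoneD|rewrite addrK].
Qed.

End sublinear.

Section eqL1_lemmas.
Context (R : realType) (d : measure_display) (Omega : measurableType d).
Context (E : sublinear_expectation R Omega).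
Implicit Types X Y Z : Omega -> R.

Let rv_max X Y : rv E X -> rv E Y -> rv E (fun w => Num.max (X w) (Y w)).
Proof. exact: stable_max (rv_linear E) (@rv_ClLip _ _ _ E) X Y. Qed.

Lemma eqL1_dist X Y : Lone E X -> Lone E Y -> eqL1 E X Y ->
  ex E (fun w => `|X w - Y w|) = 0.
Proof.
move=> LX LY [h1 h2].
have LM X' Y' : Lone E X' -> Lone E Y' -> Lone E (fun w => Num.max (X' w - Y' w) 0).
  move=> LX' LY'; apply: (Lone_le _ (Lone_norm (LoneB LX' LY'))) => [|w].
    apply: rv_max; first by apply/Lone_rv/LoneB.
    exact/Lone_rv/Lone_cst.
  by rewrite ger0_norm ?le_max ?lexx ?orbT // ge_max ler_norm /=.
have := exD (LM _ _ LX LY) (LM _ _ LY LX).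
rewrite /ex h1 h2 addr0 => h; apply/eqP; rewrite eq_le; apply/andP; split.
  apply: le_trans h; apply: ex_le => [||w]; first exact/Lone_norm/LoneB.
    by apply: LoneD; exact: LM.
  by case: (lerP (X w - Y w) 0) => h1'; case: (lerP (Y w - X w) 0) => h2';
    rewrite ler_norml; lra.
by apply: ex_ge0.
Qed.

Lemma dist0_trans X Y Z : Lone E X -> Lone E Y -> Lone E Z ->
  ex E (fun w => `|X w - Y w|) = 0 -> ex E (fun w => `|Y w - Z w|) = 0 ->
  ex E (fun w => `|X w - Z w|) = 0.
Proof.
move=> LX LY LZ h1 h2; apply/eqP; rewrite eq_le ex_ge0 // andbT.
have := exD (Lone_norm (LoneB LX LY)) (Lone_norm (LoneB LY LZ)).
rewrite h1 h2 addr0; apply: le_trans; apply: ex_le => [||w].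
- exact/Lone_norm/LoneB.
- by apply: LoneD; exact/Lone_norm/LoneB.
- exact: ler_distD.
Qed.

Lemma ex_dist0 X Y : Lone E X -> Lone E Y -> ex E (fun w => `|X w - Y w|) = 0 ->
  ex E X = ex E Y.
Proof.
move=> LX LY h; apply/eqP; rewrite -subr_eq0 -normr_le0 -h.
exact: ex_dist.
Qed.

End eqL1_lemmas.

Definition bounded_fct (R : realType) (T : Type) (X : T -> R) : Prop :=
  exists c, forall w, `|X w| <= c.

Section bounded_fct_lemmas.
Context (R : realType) (T : Type).
Implicit Types X Y : T -> R.

Lemma bfct_ge0 X : bounded_fct X -> exists2 c, 0 <= c & forall w, `|X w| <= c.
Proof. by move=> [c hc]; exists `|c| => // w; apply: le_trans (hc w) (ler_norm _). Qed.

Lemma bfct_cst (c : R) : bounded_fct (fun _ : T => c). Proof. by exists `|c|. Qed.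

Lemma bfctD X Y : bounded_fct X -> bounded_fct Y -> bounded_fct (fun w => X w + Y w).
Proof.
move=> [a ha] [b hb]; exists (a + b) => w.
by apply: le_trans (ler_normD _ _) _; exact: lerD.
Qed.

Lemma bfctM X Y : bounded_fct X -> bounded_fct Y -> bounded_fct (fun w => X w * Y w).
Proof.
move=> [a ha] [b hb]; exists (a * b) => w.
by rewrite normrM; apply: ler_pM.
Qed.

Lemma bfctN X : bounded_fct X -> bounded_fct (fun w => - X w).
Proof. by move=> [a ha]; exists a => w; rewrite normrN. Qed.

End bounded_fct_lemmas.

Lemma maxr_sub (R : realType) (c : R) : Num.max c 0 - Num.max (- c) 0 = c.
Proof. by case: (lerP c 0) => h; case: (lerP (- c) 0) => h'; lra. Qed.

Lemma max0_pM (R : realType) (a c : R) : 0 <= a ->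
  Num.max (a * c) 0 = a * Num.max c 0.
Proof. by move=> a0; rewrite maxr_pMr // mulr0. Qed.

(** * Conditioning and the second-order identity *)

Section conditional.
Context (R : realType) (dOmega : measure_display) (Omega : measurableType dOmega).
Context (E : sublinear_expectation R Omega).
Context (H : R -> set (Omega -> R)) (Et : R -> (Omega -> R) -> Omega -> R).
Hypotheses (H_filtration : filtration E H) (Et_cond : conditional_expectation E H Et).

Lemma H_rv t X : 0 <= t -> H t X -> rv E X.
Proof. by case: H_filtration => h _ /h[+ _ _ _]; apply. Qed.

Lemma H_linear t : 0 <= t -> linear_space (H t).
Proof. by case: H_filtration => h _ /h[]. Qed.

Lemma H_stable t : 0 <= t -> ClLip_stable (H t).
Proof. by case: H_filtration => h _ /h[]. Qed.

Lemma H_mono s t X : 0 <= s -> s <= t -> H s X -> H t X.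
Proof. by case: H_filtration => _ h ? ?; apply: h. Qed.

Lemma bounded_Lone X : rv E X -> bounded_fct X -> Lone E X.
Proof. by move=> rX [c hc]; apply: Lone_le rX (Lone_cst E c) hc. Qed.

Lemma bounded_LoneM C X : rv E C -> bounded_fct C -> Lone E X ->
  Lone E (fun w => C w * X w).
Proof.
move=> rC [c hc] LX.
apply: (Lone_le _ (LoneZ c (Lone_norm LX))) => [|w].
  exact: stableM (@rv_ClLip _ _ _ E) _ _ rC (Lone_rv LX).
by rewrite normrM ler_wpM2r.
Qed.

(** [E[A + C X] = E[Et[A + C X]]], and property (i) takes out [A] and then the factor [C]. Versions
    [X1] of [Et[X]] and [X2] of [Et[- X]] are substituted at the end; the boundedness of [C]
    transfers the zero distances to the products. *)
Lemma ex_condM t A C X X1 X2 : 0 <= t -> H t A -> Lone E A ->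
  H t C -> bounded_fct C -> Lone E X -> Lone E X1 -> Lone E X2 ->
  ex E (fun w => `|Et t X w - X1 w|) = 0 ->
  ex E (fun w => `|Et t (fun w' => - X w') w - X2 w|) = 0 ->
  ex E (fun w => A w + C w * X w) =
  ex E (fun w => A w + (Num.max (C w) 0 * X1 w + Num.max (- C w) 0 * X2 w)).
Proof.
move=> t0 HA LA HC bC LX LX1 LX2 h1 h2.
have [P1 P2 P3 P4] := Et_cond t0.
have rC := H_rv t0 HC.
have LC := bounded_Lone rC bC.
have LCX := bounded_LoneM rC bC LX.
have LEt Z : Lone E Z -> Lone E (Et t Z).
  move=> /P1[HZ Zoo]; split => //; exact: H_rv HZ.
have [c c0 hc] := bfct_ge0 bC.
have rmax X' : rv E X' -> rv E (fun w => Num.max (X' w) 0).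
  move=> rX; apply: (stable_max (rv_linear E) (@rv_ClLip _ _ _ E)) => //.
  exact/Lone_rv/Lone_cst.
have bmax (C' : Omega -> R) : (forall w, `|C' w| <= c) -> forall w, `|Num.max (C' w) 0| <= c.
  move=> h w; rewrite ger0_norm ?le_max ?lexx ?orbT //.
  by rewrite ge_max c0 (le_trans (ler_norm _) (h w)).
have rNC := stableN (rv_linear E) rC.
have hNc w : `|- C w| <= c by rewrite normrN.
have L1' Z : Lone E Z -> Lone E (fun w => Num.max (C w) 0 * Z w).
  by move=> LZ; apply: bounded_LoneM => //; [exact: rmax|exists c; exact: bmax].
have L2' Z : Lone E Z -> Lone E (fun w => Num.max (- C w) 0 * Z w).
  by move=> LZ; apply: bounded_LoneM => //; [exact: rmax|exists c; exact: bmax].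
have LNX := LoneN LX.
have LQ : Lone E (fun w => Num.max (C w) 0 * Et t X w
              + Num.max (- C w) 0 * Et t (fun w' => - X w') w).
  by apply: LoneD; [apply: L1'|apply: L2']; exact: LEt.
transitivity (ex E (Et t (fun w => A w + C w * X w))).
  by rewrite /ex P4 //; exact: LoneD.
transitivity (ex E (fun w => A w + Et t (fun w' => C w' * X w') w)).
  apply: ex_dist0; [by apply/LEt/LoneD|by apply: LoneD => //; apply: LEt|].
  apply: eqL1_dist; [by apply/LEt/LoneD|by apply: LoneD => //; apply: LEt|].
  exact: P2.
transitivity (ex E (fun w => A w + (Num.max (C w) 0 * Et t X w
              + Num.max (- C w) 0 * Et t (fun w' => - X w') w))).
  exact: ex_eqL1 (LEt _ LCX) LQ LA (P3 _ _ LC LX HC LCX).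
apply: ex_dist0.
- exact: LoneD.
- by apply: LoneD => //; apply: LoneD; [exact: L1'|exact: L2'].
apply/eqP; rewrite eq_le ex_ge0 // andbT.
have LD1 := Lone_norm (LoneB (LEt _ LX) LX1).
have LD2 := Lone_norm (LoneB (LEt _ LNX) LX2).
apply: (@le_trans _ _ (ex E (fun w => c * `|Et t X w - X1 w| +
    c * `|Et t (fun w' => - X w') w - X2 w|))).
  apply: ex_le => [||w].
  - apply/Lone_norm/LoneB; first exact: LoneD.
    by apply: LoneD => //; apply: LoneD; [exact: L1'|exact: L2'].
  - by apply: LoneD; exact: LoneZ.
  set p := Num.max (C w) 0; set q := Num.max (- C w) 0.
  have -> : A w + (p * Et t X w + q * Et t (fun w' => - X w') w) -
      (A w + (p * X1 w + q * X2 w)) = p * (Et t X w - X1 w) +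
      q * (Et t (fun w' => - X w') w - X2 w) by ring.
  apply: le_trans (ler_normD _ _) _; rewrite !normrM.
  apply: lerD; apply: ler_wpM2r => //; first exact: (bmax C hc w).
  exact: (bmax (fun w => - C w) hNc w).
apply: le_trans (exD (LoneZ c LD1) (LoneZ c LD2)) _.
by rewrite !exZ // h1 h2 !mulr0 addr0.
Qed.

Lemma martingale_dist M s t : martingale E H Et M -> 0 <= s -> s <= t ->
  ex E (fun w => `|Et s (M t) w - M s w|) = 0.
Proof.
move=> [hM1 hM2] s0 st; have t0 := le_trans s0 st.
have [P1 _ _ _] := Et_cond s0.
apply: eqL1_dist; last exact: hM2.
  have [LM _] := hM1 _ t0.
  by have [HX Xoo] := P1 _ LM; split => //; exact: H_rv HX.
by have [] := hM1 _ s0.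
Qed.

Context (M : R -> Omega -> R) (lo up : R).
Hypotheses (hI : martingale E H Et M /\ martingale E H Et (fun t w => - M t w)).
Hypothesis hII : martingale E H Et (fun t w => M t w ^+ 2 - up * t).
Hypothesis hIII : martingale E H Et (fun t w => - (M t w ^+ 2 - lo * t)).

Lemma M_H t : 0 <= t -> H t (M t).
Proof. by case: hI => -[h _] _ /h[]. Qed.

Lemma M_Lone t : 0 <= t -> Lone E (M t).
Proof. by case: hI => -[h _] _ /h[]. Qed.

Lemma M2_Lone t : 0 <= t -> Lone E (fun w => M t w ^+ 2).
Proof.
case: hII => h _ /h[LX _]; have := LoneD LX (Lone_cst E (up * t)).
by congr Lone; apply/funext => w; rewrite subrK.
Qed.

Lemma shift_dist t c X Y Z : 0 <= t -> Lone E X -> Lone E Y -> Lone E Z ->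
  (forall w, Z w = c + X w) ->
  ex E (fun w => `|Et t X w - Y w|) = 0 ->
  ex E (fun w => `|Et t Z w - (c + Y w)|) = 0.
Proof.
move=> t0 LX LY LZ ZX h; have [P1 P2 _ _] := Et_cond t0.
have LEt Z' : Lone E Z' -> Lone E (Et t Z').
  move=> /P1[HZ Zoo]; split => //; exact: H_rv HZ.
have Lc := Lone_cst E c.
apply: (@dist0_trans _ _ _ _ _ (fun w => c + Et t X w)).
- exact: LEt.
- by apply: LoneD => //; exact: LEt.
- exact: LoneD.
- have -> : Z = (fun w => c + X w) by apply/funext.
  apply: eqL1_dist.
  + by apply/LEt/LoneD.
  + by apply: LoneD => //; exact: LEt.
  + apply: P2 => //; have := stable_cst (H_stable t0) c; exact.
- by rewrite -h; congr ex; apply/funext => w; congr (`| _ |); ring.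
Qed.

(** With [A = - D M_t] in [ex_condM], the martingale properties of [M] and [- M] produce
    [D^+ M_t - D^- M_t = D M_t], which cancels [A]. *)
Lemma ex_symmetric s t D : 0 <= t -> t <= s -> H t D -> bounded_fct D ->
  ex E (fun w => D w * (M s w - M t w)) = 0.
Proof.
move=> t0 ts HD bD; have s0 := le_trans t0 ts.
have rD := H_rv t0 HD.
have HP : H t (fun w => - (D w * M t w)).
  apply: stableN (H_linear t0) _ _.
  exact: stableM (H_stable t0) _ _ HD (M_H t0).
have LP : Lone E (fun w => - (D w * M t w)).
  by apply/LoneN/bounded_LoneM => //; exact: M_Lone.
have := ex_condM t0 HP LP HD bD (M_Lone s0) (M_Lone t0) (LoneN (M_Lone t0))
  (martingale_dist hI.1 t0 ts) (martingale_dist hI.2 t0 ts).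
have -> : (fun w => - (D w * M t w) + D w * M s w) = (fun w => D w * (M s w - M t w)).
  by apply/funext => w; ring.
move=> ->; rewrite -[RHS](ex_cst E 0); congr ex; apply/funext => w.
rewrite -[X in - (X * _)]maxr_sub; ring.
Qed.

(** [C Y^2 / 2 = (C / 2) M_s^2 - (C / 2) M_t^2 - C M_t Y] separates a part to which (II) and (III)
    apply from terms without mean uncertainty. What concerns [C M_t Y] is left as a hypothesis
    because [C M_t] may be unbounded: it is met by a cutoff in the tail estimate and by moments
    afterwards. *)
Lemma ex_quadratic s t A B C : 0 <= t -> t <= s ->
  H t A -> bounded_fct A -> H t B -> bounded_fct B -> H t C -> bounded_fct C ->
  Lone E (fun w => C w * M t w * (M s w - M t w)) ->
  ex E (fun w => C w * M t w * (M s w - M t w)) = 0 ->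
  ex E (fun w => - (C w * M t w * (M s w - M t w))) = 0 ->
  ex E (fun w => A w + B w * (M s w - M t w) + C w / 2 * (M s w - M t w) ^+ 2) =
  ex E (fun w => A w + Gfun lo up (C w) * (s - t)).
Proof.
move=> t0 ts HA bA HB bB HC bC LD hD hDN; have s0 := le_trans t0 ts.
have rA := H_rv t0 HA; have rB := H_rv t0 HB; have rC := H_rv t0 HC.
have LA := bounded_Lone rA bA.
pose C2 w := 2^-1 * C w.
have HC2 : H t C2 by exact: stableZ (H_linear t0) _ _ HC.
have rC2 := H_rv t0 HC2.
have bC2 : bounded_fct C2 by apply: bfctM => //; exact: bfct_cst.
have L1 : Lone E (fun w => B w * (M s w - M t w)).
  by apply: bounded_LoneM => //; apply: LoneB; exact: M_Lone.
have LP : Lone E (fun w => A w - C2 w * M t w ^+ 2).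
  by apply: LoneB => //; apply: bounded_LoneM => //; exact: M2_Lone.
have HP : H t (fun w => A w - C2 w * M t w ^+ 2).
  apply: stableB (H_linear t0) _ _ HA _.
  apply: stableM (H_stable t0) _ _ HC2 _.
  exact: stableX (H_stable t0) _ _ (M_H t0).
have LQ : Lone E (fun w => A w - C2 w * M t w ^+ 2 + C2 w * M s w ^+ 2).
  by apply: LoneD => //; apply: bounded_LoneM => //; exact: M2_Lone.
transitivity (ex E (fun w => (A w - C2 w * M t w ^+ 2 + C2 w * M s w ^+ 2) +
    B w * (M s w - M t w) - C w * M t w * (M s w - M t w))).
  by congr ex; apply/funext => w; rewrite /C2; field.
rewrite ex_drop; last 1 [idtac] || idtac.
- rewrite ex_drop //.
  + rewrite (ex_condM t0 HP LP HC2 bC2 (M2_Lone s0) (X1 := fun w => up * s + (M t w ^+ 2 - up * t))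
      (X2 := fun w => - (lo * s) + - (M t w ^+ 2 - lo * t))).
    * congr ex; apply/funext => w; rewrite /Gfun /C2.
      rewrite -[- (2^-1 * C w)]mulrN !max0_pM ?invr_ge0 ?ler0n //.
      rewrite -[X in _ - 2^-1 * X * _]maxr_sub; ring.
    * apply: LoneD; first exact: Lone_cst.
      by apply: LoneB; [exact: M2_Lone|exact: Lone_cst].
    * apply: LoneD; first exact: Lone_cst.
      by apply/LoneN/LoneB; [exact: M2_Lone|exact: Lone_cst].
    * apply: (@shift_dist _ _ (fun w => M s w ^+ 2 - up * s)) => //.
      - by have [] := hII.1 _ s0.
      - by have [] := hII.1 _ t0.
      - exact: M2_Lone.
      - by move=> w; ring.
      - exact: martingale_dist hII t0 ts.
    * apply: (@shift_dist _ _ (fun w => - (M s w ^+ 2 - lo * s))) => //.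
      - by have [] := hIII.1 _ s0.
      - by have [] := hIII.1 _ t0.
      - by apply: LoneN; exact: M2_Lone.
      - by move=> w; ring.
      - exact: martingale_dist hIII t0 ts.
  + exact: ex_symmetric.
  + rewrite -(@ex_symmetric s t (fun w => - B w)) //.
    * by congr ex; apply/funext => w; ring.
    * exact: stableN (H_linear t0) _ HB.
    * exact: bfctN.
- exact: LoneD.
- exact: LoneN.
- exact: hDN.
- by rewrite -hD; congr ex; apply/funext => w; rewrite opprK.
Qed.

End conditional.

(** * Exponential moments *)

Section logistic.
Context (R : realType).
Implicit Types x y : R.

Definition logistic x := expR x / (1 + expR x).

Lemma logistic_ge0 x : 0 <= logistic x.
Proof. by rewrite divr_ge0 ?expR_ge0 // addr_ge0 ?expR_ge0. Qed.

Lemma logistic_le1 x : logistic x <= 1.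
Proof. by have h := expR_gt0 x; rewrite ler_pdivrMr ?mul1r; lra. Qed.

Lemma logistic_le_expR x : logistic x <= expR x.
Proof.
have h := expR_gt0 x.
by rewrite ler_pdivrMr ?ler_peMr ?expR_ge0; lra.
Qed.

Lemma logisticD_sub x y : logistic (x + y) - logistic x =
  expR x * (expR y - 1) / ((1 + expR x * expR y) * (1 + expR x)).
Proof.
have hx := expR_gt0 x; have hy := expR_gt0 y; have hxy := mulr_gt0 hx hy.
rewrite /logistic expRD; field.
by apply/andP; split; apply: lt0r_neq0; lra.
Qed.

Lemma logistic_mono : {homo logistic : x y / x <= y}.
Proof.
move=> x y xy; rewrite -subr_ge0 -(subrKC x y) logisticD_sub.
have := expR_ge1Dx (y - x); have := expR_gt0 x; have := expR_gt0 (y - x) => h1 h2 h3.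
rewrite divr_ge0 // ?mulr_ge0 //; try lra.
Qed.

(** [e^y <= 1 / (1 - y) <= 1 + y + 2 y^2] for [y <= 1/2], combined with [L(x + y) - L(x) <= L(x) (1
    - L(x)) (e^y - 1)]. The remainder is proportional to [logistic x], as the Gronwall argument to
    come demands. *)
Lemma logistic_step x y : y <= 2^-1 ->
  logistic (x + y) <=
  logistic x + logistic x * (1 - logistic x) * y + 2 * logistic x * y ^+ 2.
Proof.
move=> y2; set u := expR x; set v := expR y.
have u0 : 0 < u by exact: expR_gt0.
have v0 : 0 < v by exact: expR_gt0.
have hv : v <= 1 + y + 2 * y ^+ 2.
  have h := expR_ge1Dx (- y); rewrite expRN -/v in h.
  have y1 : 0 < 1 - y by lra.
  have : v * (1 - y) <= 1.
    by rewrite -[leRHS](mulfV (lt0r_neq0 v0)) ler_wpM2l // ltW.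
  have : 0 <= y ^+ 2 * (1 - 2 * y) by rewrite mulr_ge0 ?sqr_ge0 //; lra.
  move=> h1 h2.
  rewrite -(ler_pM2r y1); apply: le_trans h2 _; lra.
have : logistic (x + y) - logistic x <= logistic x * ((v - 1) / (1 + u)).
  rewrite logisticD_sub -/u -/v /logistic -/u.
  have uv := mulr_gt0 u0 v0.
  have -> : u / (1 + u) * ((v - 1) / (1 + u)) = u * (v - 1) / ((1 + u * v) * (1 + u)) +
     u ^+ 2 * (v - 1) ^+ 2 / ((1 + u * v) * (1 + u) ^+ 2).
    by field; rewrite !lt0r_neq0 // addr_gt0.
  have uv1 : 0 <= 1 + u * v by rewrite addr_ge0 // ltW.
  by rewrite lerDl; apply: divr_ge0; apply: mulr_ge0; rewrite ?sqr_ge0.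
have hL : 1 - logistic x = (1 + u)^-1.
  by rewrite /logistic -/u; field; rewrite lt0r_neq0 // addr_gt0.
have i0 : 0 <= (1 + u)^-1 by rewrite invr_ge0; lra.
have i1 : (1 + u)^-1 <= 1 by rewrite invf_le1; lra.
have : (v - 1) / (1 + u) <= y * (1 + u)^-1 + 2 * y ^+ 2.
  have := ler_wpM2r i0 hv; have := sqr_ge0 y => h0 h1.
  have := ler_wpM2r h0 i1; lra.
move=> /(ler_wpM2l (logistic_ge0 x)) h1 h2; rewrite hL.
lra.
Qed.

Lemma logistic_lip x y : `|logistic x - logistic y| <= `|x - y|.
Proof.
wlog xy : x y / y <= x.
  move=> h; case: (leP y x) => [/h//|/ltW /h].
  by rewrite distrC [`|x - y|]distrC.
rewrite !ger0_norm ?subr_ge0 //; last exact: logistic_mono.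
rewrite -{1}(subrKC y x) logisticD_sub; set z := x - y.
have h1 := expR_gt0 y; have h2 := expR_gt0 z; have h3 := mulr_gt0 h1 h2.
have h := expR_ge1Dx (- z); rewrite expRN in h.
have z0 : 0 <= z by rewrite subr_ge0.
have h4 := expR_ge1Dx z.
rewrite ler_pdivrMr ?mulr_gt0 //; try lra.
have h5 : expR z - 1 <= z * expR z.
  have := ler_wpM2r (ltW h2) h; rewrite mulVf ?gt_eqF //; lra.
have := ler_wpM2l (ltW h1) h5.
have : 0 <= z * (1 + expR y + expR y * expR z * expR y) by rewrite mulr_ge0 //; nra.
lra.
Qed.

Definition cutoff (K x : R) := Num.max 0 (Num.min 1 (2 - `|x| / K)).

Lemma cutoff_ge0 K x : 0 <= cutoff K x.
Proof. by rewrite le_max lexx. Qed.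

Lemma cutoff_le1 K x : cutoff K x <= 1.
Proof. by rewrite ge_max ler01 ge_min lexx. Qed.

Lemma cutoff_out K x : 0 < K -> 2 * K <= `|x| -> cutoff K x = 0.
Proof.
move=> K0 h; apply/eqP; rewrite eq_le cutoff_ge0 andbT ge_max lexx /=.
by rewrite ge_min subr_le0 ler_pdivlMr ?h ?orbT.
Qed.

Lemma cutoff_in K x : 0 < K -> `|x| <= K -> cutoff K x = 1.
Proof.
move=> K0 h; apply/eqP; rewrite eq_le cutoff_le1 /= le_max le_min lexx /=.
have -> : 1 <= 2 - `|x| / K by rewrite lerBrDr -lerBrDl ler_pdivrMr //; lra.
by rewrite orbT.
Qed.

Lemma cutoff_sub_le K x : 0 < K -> 1 - cutoff K x <= `|x| / K.
Proof.
move=> K0; case: (leP `|x| K) => h.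
  by rewrite cutoff_in // subrr divr_ge0 // ltW.
apply: (@le_trans _ _ 1); first by have := cutoff_ge0 K x; lra.
by rewrite ler_pdivlMr // mul1r ltW.
Qed.

Lemma clamp_lip (a b : R) :
  `|Num.max 0 (Num.min 1 a) - Num.max 0 (Num.min 1 b)| <= `|a - b|.
Proof.
have clampE (c : R) : Num.max 0 (Num.min 1 c) =
    if 1 <= c then 1 else if 0 <= c then c else 0.
  by case: (lerP 1 c) => h1; case: (lerP 0 _) => h2 //; lra.
rewrite !clampE; case: (ler0P (a - b)) => hab;
  case: (leP 1 a) => ?; case: (leP 1 b) => ?;
  case: (leP 0 a) => ?; case: (leP 0 b) => ?; rewrite ler_norml; lra.
Qed.

Lemma cutoff_lip K x y : 0 < K -> `|cutoff K x - cutoff K y| <= K^-1 * `|x - y|.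
Proof.
move=> K0; apply: le_trans (clamp_lip _ _) _.
have -> : 2 - `|x| / K - (2 - `|y| / K) = K^-1 * (`|y| - `|x|) by ring.
rewrite normrM gtr0_norm ?invr_gt0 // ler_wpM2l ?invr_ge0 ?(ltW K0) //.
by rewrite distrC ler_dist_dist.
Qed.

Lemma cutoff_supp K x : 0 < K -> `|cutoff K x * x| <= 2 * K.
Proof.
move=> K0; case: (leP `|x| (2 * K)) => h; last first.
  by rewrite cutoff_out ?(ltW h) // mul0r normr0 mulr_ge0 // ltW.
rewrite normrM ger0_norm ?cutoff_ge0 // -[leRHS]mul1r ler_pM //.
  exact: cutoff_ge0.
exact: cutoff_le1.
Qed.

End logistic.

(** The cutoff at level 1/4 vanishes for [|y| >= 1/2], which removes the restriction on [y]: for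
    [y > 1/2] the left side is 0 and the right side is nonnegative. *)
Lemma logistic_cut (R : realType) (x y : R) :
  cutoff 4^-1 y * logistic (x + y) <=
  logistic x + logistic x * (1 - logistic x) * y + 2 * logistic x * y ^+ 2.
Proof.
have l0 := logistic_ge0 x; have l1 := logistic_le1 x.
case: (leP y 2^-1) => hy.
  apply: le_trans (logistic_step x hy).
  by rewrite ler_piMl ?cutoff_le1 ?logistic_ge0.
rewrite cutoff_out; [|lra|by rewrite gtr0_norm; lra].
rewrite mul0r !addr_ge0 // !mulr_ge0 ?sqr_ge0 //; lra.
Qed.

Lemma Gfun_ge0 (R : realType) (lo up c : R) : 0 <= c -> Gfun lo up c = up / 2 * c.
Proof.
by move=> c0; rewrite /Gfun max_l // max_r ?oppr_le0 //; ring.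
Qed.

(** * Exponential tails along a partition *)

Section exponential_tail.
Context (R : realType) (dOmega : measure_display) (Omega : measurableType dOmega).
Context (E : sublinear_expectation R Omega).
Context (H : R -> set (Omega -> R)) (Et : R -> (Omega -> R) -> Omega -> R).
Hypotheses (H_filtration : filtration E H) (Et_cond : conditional_expectation E H Et).
Context (M : R -> Omega -> R) (lo up : R).
Hypotheses (hI : martingale E H Et M /\ martingale E H Et (fun t w => - M t w)).
Hypothesis hII : martingale E H Et (fun t w => M t w ^+ 2 - up * t).
Hypothesis hIII : martingale E H Et (fun t w => - (M t w ^+ 2 - lo * t)).

Section partition.
Variables (sigma : nat -> R) (lam a : R).
Hypotheses (sigma0 : 0 <= sigma 0%N) (sigma_mono : forall i, sigma i <= sigma i.+1).
Hypothesis up_ge0 : 0 <= up.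

Let Y i w := M (sigma i.+1) w - M (sigma i) w.
Let L i w := logistic (lam * (M (sigma i) w - M (sigma 0%N) w) - a).
Let chi i w := cutoff 4^-1 (lam * Y i w).
(** Two cutoffs per step: [chi j] acts on the increment, as [logistic_cut] requires, and [cutoff K]
    acts on the position, which makes [C M_t] bounded. The first is paid for by (IV); the second
    disappears as [K] tends to infinity on a fixed partition. *)
Let c K i w := \prod_(j < i) (chi j w * cutoff K (M (sigma j) w)).

Let sigma_ge0 i : 0 <= sigma i.
Proof. by elim: i => // i IH; apply: le_trans (sigma_mono i). Qed.

Let sigma0_le i : sigma 0 <= sigma i.
Proof. by elim: i => // i IH; apply: le_trans (sigma_mono i). Qed.

Let quarter_gt0 : 0 < 4^-1 :> R. Proof. by rewrite invr_gt0. Qed.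

Lemma ClLip_cutoff K : 0 < K -> ClLip (@cutoff R K).
Proof. by move=> K0; apply: (@Lipschitz_ClLip _ _ K^-1) => x y; exact: cutoff_lip. Qed.

Lemma ClLip_logistic : ClLip (@logistic R).
Proof.
by apply: (@Lipschitz_ClLip _ _ 1) => x y; rewrite mul1r; exact: logistic_lip.
Qed.

Let HM s t : 0 <= s -> s <= t -> H t (M s).
Proof. by move=> s0 st; apply: (H_mono H_filtration s0 st); exact: (M_H hI s0). Qed.

Let HL i : H (sigma i) (L i).
Proof.
have Hlin := H_linear H_filtration (sigma_ge0 i).
have Hst := H_stable H_filtration (sigma_ge0 i).
apply: (stable_comp Hst ClLip_logistic).
apply: (stableB Hlin _ (stable_cst Hst a)); apply: (stableZ Hlin).
by apply: (stableB Hlin); apply: HM.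
Qed.

Let Hchi i t : sigma i.+1 <= t -> H t (chi i).
Proof.
move=> it; have t0 := le_trans (sigma_ge0 i.+1) it.
have Hlin := H_linear H_filtration t0; have Hst := H_stable H_filtration t0.
apply: (stable_comp Hst (ClLip_cutoff quarter_gt0)); apply: (stableZ Hlin).
by apply: (stableB Hlin); apply: HM => //; apply: le_trans it.
Qed.

Let HcutM K i t : 0 < K -> sigma i <= t -> H t (fun w => cutoff K (M (sigma i) w)).
Proof.
move=> K0 it; have t0 := le_trans (sigma_ge0 i) it.
have Hst := H_stable H_filtration t0.
by apply: (stable_comp Hst (ClLip_cutoff K0)); exact: HM.
Qed.

Let Hc K i : 0 < K -> H (sigma i) (c K i).
Proof.
move=> K0; elim: i => [|i IH].
  have := stable_cst (H_stable H_filtration sigma0) 1.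
  by congr (H _ _); apply/funext => w; rewrite /c big_ord0.
have := H_mono H_filtration (sigma_ge0 i) (sigma_mono i) IH => IH'.
have Hst := H_stable H_filtration (sigma_ge0 i.+1).
have := stableM Hst IH' (stableM Hst (Hchi (lexx _)) (HcutM K0 (sigma_mono i))).
by congr (H _ _); apply/funext => w; rewrite /c big_ord_recr.
Qed.

Let chi01 i w : 0 <= chi i w <= 1.
Proof. by rewrite cutoff_ge0 cutoff_le1. Qed.

Let fac01 K i w : 0 <= chi i w * cutoff K (M (sigma i) w) <= 1.
Proof.
have /andP[h1 h2] := chi01 i w.
by rewrite mulr_ge0 ?cutoff_ge0 // mulr_ile1 // ?cutoff_ge0 ?cutoff_le1.
Qed.

Let c01 K i w : 0 <= c K i w <= 1.
Proof.
rewrite /c prodr_ge0 => [|j _]; last by have /andP[] := fac01 K j w.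
rewrite prodr_ile1 // => j _; exact: fac01.
Qed.

Let L01 i w : 0 <= L i w <= 1.
Proof. by rewrite logistic_ge0 logistic_le1. Qed.

Let bounded01 (X : Omega -> R) : (forall w, 0 <= X w <= 1) -> bounded_fct X.
Proof. by move=> h; exists 1 => w; have /andP[h1 h2] := h w; rewrite ger0_norm. Qed.

(** By induction: [logistic_cut] bounds one step by [E[A + B Y + C Y^2 / 2]], which the second-order
    identity turns into [(1 + g) E[A]] with [g = 2 up lam^2 (s - t)], and [1 + g <= e^g]. *)
Lemma ex_cut_logistic K i : 0 < K ->
  ex E (fun w => c K i w * L i w) <=
  expR (2 * up * lam ^+ 2 * (sigma i - sigma 0%N)) * logistic (- a).
Proof.
move=> K0; elim: i => [|i IH].
  rewrite subrr mulr0 expR0 mul1r.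
  have -> : (fun w => c K 0 w * L 0 w) = (fun=> logistic (- a)).
    by apply/funext => w; rewrite /c big_ord0 mul1r /L subrr mulr0 add0r.
  by rewrite ex_cst.
set t := sigma i; set s := sigma i.+1.
have t0 : 0 <= t by exact: sigma_ge0.
have ts : t <= s by exact: sigma_mono.
have s0 := le_trans t0 ts.
have Hlin := H_linear H_filtration t0; have Hst := H_stable H_filtration t0.
(* The position cutoff of time [t] is included, but not [chi i], which depends on the coming
   increment. *)
pose cp w := c K i w * cutoff K (M t w).
have cp01 w : 0 <= cp w <= 1.
  have /andP[h1 h2] := c01 K i w.
  by rewrite mulr_ge0 ?cutoff_ge0 // mulr_ile1 // ?cutoff_ge0 ?cutoff_le1.
pose A w := cp w * L i w.
pose B w := lam * (A w * (1 - L i w)).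
(* [C / 2 * Y^2] is the remainder [2 L (lam Y)^2] of [logistic_cut], weighted by [cp]. *)
pose C w := 4 * lam ^+ 2 * A w.
have Hcp : H t cp by exact: (stableM Hst (Hc i K0) (HcutM K0 (lexx _))).
have HA : H t A by exact: (stableM Hst Hcp (HL i)).
have HB : H t B.
  apply: (stableZ Hlin); apply: (stableM Hst HA).
  by apply: (stableB Hlin) (HL i); exact: stable_cst.
have HC : H t C by exact: stableZ.
have A01 w : 0 <= A w <= 1.
  have /andP[h1 h2] := cp01 w; have /andP[h3 h4] := L01 i w.
  by rewrite mulr_ge0 // mulr_ile1.
have bA : bounded_fct A by exact: bounded01.
have bB : bounded_fct B.
  apply: (bfctM (bfct_cst Omega lam)).
  apply: (bfctM bA); apply: (bfctD (bfct_cst Omega 1)).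
  by apply/bfctN/bounded01.
have bC : bounded_fct C by apply: (bfctM (bfct_cst Omega (4 * lam ^+ 2)) bA).
pose D w := C w * M t w.
have bD : bounded_fct D.
  exists (4 * lam ^+ 2 * (2 * K)) => w; rewrite /D /C normrM.
  have -> : `|4 * lam ^+ 2 * A w| = 4 * lam ^+ 2 * A w.
    have /andP[A0 _] := A01 w.
    by rewrite ger0_norm // (mulr_ge0 (mulr_ge0 _ (sqr_ge0 lam)) A0).
  rewrite -[leLHS]mulrA ler_wpM2l //; first exact: mulr_ge0 _ (sqr_ge0 lam).
  have /andP[c0 c1] := c01 K i w; have /andP[l0 l1] := L01 i w.
  have hK := cutoff_supp (M t w) K0.
  have -> : A w * `|M t w| = (c K i w * L i w) * `|cutoff K (M t w) * M t w|.
    by rewrite normrM (ger0_norm (cutoff_ge0 _ _)) /A /cp; ring.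
  rewrite -[leRHS]mul1r; apply: ler_pM => //; first exact: mulr_ge0.
  by rewrite mulr_ile1.
have HD : H t D by exact: (stableM Hst HC (M_H hI t0)).
have LY : Lone E (fun w => M s w - M t w).
  by apply: LoneB; exact: (M_Lone hI).
have LD : Lone E (fun w => C w * M t w * (M s w - M t w)).
  by apply: bounded_LoneM => //; exact: (H_rv H_filtration t0).
have LA : Lone E A by apply: bounded_Lone => //; exact: (H_rv H_filtration t0 HA).
have key : ex E (fun w => A w + B w * (M s w - M t w) +
    C w / 2 * (M s w - M t w) ^+ 2) = ex E (fun w => A w + Gfun lo up (C w) * (s - t)).
  apply: (ex_quadratic H_filtration Et_cond hI hII hIII) => //.
    exact: (ex_symmetric H_filtration Et_cond hI t0 ts HD bD).
  have := ex_symmetric H_filtration Et_cond hI t0 ts (stableN Hlin HD) (bfctN bD).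
  by move=> h; rewrite -[RHS]h; congr ex; apply/funext => w; rewrite mulNr.
have LZ : Lone E (fun w => c K i.+1 w * L i.+1 w).
  apply: bounded_Lone.
    apply: (H_rv H_filtration s0).
    by apply: (stableM (H_stable H_filtration s0)); [exact: Hc|exact: HL].
  by apply: bfctM; apply: bounded01.
have LQ : Lone E (fun w => A w + B w * (M s w - M t w) +
    C w / 2 * (M s w - M t w) ^+ 2).
  apply: LoneD.
    apply: LoneD => //; apply: bounded_LoneM => //.
    exact: (H_rv H_filtration t0 HB).
  have -> : (fun w => C w / 2 * (M s w - M t w) ^+ 2) =
    (fun w => C w / 2 * M s w ^+ 2 - C w / 2 * M t w ^+ 2 -
       C w * M t w * (M s w - M t w)).
    by apply/funext => w; field.
  have rC2 : rv E (fun w => C w / 2).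
    have := stableZ (rv_linear E) (2^-1) (H_rv H_filtration t0 HC).
    by congr rv; apply/funext => w; rewrite mulrC.
  have bC2 : bounded_fct (fun w => C w / 2) by exact: (bfctM bC (bfct_cst Omega 2^-1)).
  apply: LoneB => //.
  by apply: LoneB; apply: bounded_LoneM => //; exact: (M2_Lone hII).
have LA0 : Lone E (fun w => c K i w * L i w).
  apply: bounded_Lone.
    apply: (H_rv H_filtration t0).
    by apply: (stableM (H_stable H_filtration t0)); [exact: Hc|exact: HL].
  by apply: bfctM; apply: bounded01.
apply: (@le_trans _ _ (ex E (fun w => A w + B w * (M s w - M t w) +
    C w / 2 * (M s w - M t w) ^+ 2))).
  apply: ex_le => // w.
  rewrite /c big_ord_recr /= -/(c K i w).
  have := logistic_cut (lam * (M t w - M (sigma 0) w) - a) (lam * Y i w).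
  have -> : lam * (M t w - M (sigma 0) w) - a + lam * Y i w =
    lam * (M (sigma i.+1) w - M (sigma 0) w) - a by rewrite /Y -/t; ring.
  rewrite -/(L i w) -/(L i.+1 w) -/(chi i w) => h.
  have /andP[cp0 _] := cp01 w.
  have := ler_wpM2l cp0 h; rewrite /B /C /A /cp /Y -/t -/s; lra.
rewrite key.
set g := 2 * up * lam ^+ 2 * (s - t).
have g0 : 0 <= g.
  by apply: mulr_ge0; [apply: (mulr_ge0 _ (sqr_ge0 lam)); exact: mulr_ge0|rewrite subr_ge0].
have -> : (fun w => A w + Gfun lo up (C w) * (s - t)) = (fun w => (1 + g) * A w).
  apply/funext => w; rewrite Gfun_ge0; first by rewrite /C /g; field.
  have /andP[A0 _] := A01 w.
  exact: (mulr_ge0 (mulr_ge0 _ (sqr_ge0 lam)) A0).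
rewrite exZ //; last lra.
apply: (@le_trans _ _ ((1 + g) * (expR (2 * up * lam ^+ 2 * (t - sigma 0)) * logistic (- a)))).
  apply: ler_wpM2l; first lra.
  apply: le_trans IH; apply: ex_le => // w.
  have /andP[c0 c1] := c01 K i w; have /andP[l0 l1] := L01 i w.
  rewrite /A /cp mulrAC ler_piMr ?cutoff_le1 // mulr_ge0 //.
rewrite mulrA ler_wpM2r ?logistic_ge0 //.
have -> : 2 * up * lam ^+ 2 * (s - sigma 0) = g + 2 * up * lam ^+ 2 * (t - sigma 0).
  by rewrite /g; ring.
by rewrite expRD ler_wpM2r ?expR_ge0 // expR_ge1Dx.
Qed.

(** A union bound for the [y i] only. The product of the [x i] is kept whole because (IV) controls
    the largest increment of a partition, not the sum over its increments. *)
Lemma subr1_prod_le (I : Type) (r : seq I) (x y : I -> R) :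
  (forall i, 0 <= x i <= 1) -> (forall i, 0 <= y i <= 1) ->
  1 - \prod_(i <- r) (x i * y i) <= (1 - \prod_(i <- r) x i) + \sum_(i <- r) (1 - y i).
Proof.
move=> hx hy; elim: r => [|i r IH]; first by rewrite !big_nil; lra.
rewrite !big_cons.
have P1 : 0 <= \prod_(j <- r) x j <= 1.
  rewrite prodr_ge0 => [|j _]; last by have /andP[] := hx j.
  by rewrite prodr_ile1.
have P2 : 0 <= \prod_(j <- r) (x j * y j) <= 1.
  rewrite prodr_ge0 => [|j _].
    rewrite prodr_ile1 // => j _.
    have /andP[? ?] := hx j; have /andP[? ?] := hy j.
    by rewrite mulr_ge0 // mulr_ile1.
  by have /andP[? ?] := hx j; have /andP[? ?] := hy j; rewrite mulr_ge0.
move: IH P1 P2 (hx i) (hy i).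
set P := \prod_(j <- r) x j; set Q := \prod_(j <- r) (x j * y j).
set S := \sum_(j <- r) _ => IH /andP[P0 P1] /andP[Q0 Q1] /andP[x0 x1] /andP[y0 y1].
have h1 : x i * P - x i * y i * Q <= P - Q + (1 - y i).
  have : 0 <= (1 - x i) * (1 - y i) by rewrite mulr_ge0 //; lra.
  have : 0 <= x i * (1 - P) by rewrite mulr_ge0 //; lra.
  have QP : Q <= P.
    rewrite /Q /P ler_prod // => j _.
    have /andP[? ?] := hx j; have /andP[? ?] := hy j.
    by rewrite mulr_ge0 // ler_piMr.
  have : 0 <= (1 - x i) * (P - Q) by rewrite mulr_ge0 //; lra.
  have : 0 <= x i * (1 - y i) * (1 - Q) by rewrite !mulr_ge0 //; lra.
  lra.
lra.
Qed.

Lemma Lone_cut_prod n : Lone E (fun w => 1 - \prod_(j < n) chi j w).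
Proof.
apply: LoneB; first exact: Lone_cst.
apply: bounded_Lone.
  apply: (H_rv H_filtration (sigma_ge0 n)); elim: n => [|i IH].
    have := stable_cst (H_stable H_filtration sigma0) 1.
    by congr (H _ _); apply/funext => w; rewrite big_ord0.
  have := H_mono H_filtration (sigma_ge0 i) (sigma_mono i) IH => IH'.
  have Hst := H_stable H_filtration (sigma_ge0 i.+1).
  have := stableM Hst IH' (Hchi (lexx _)).
  by congr (H _ _); apply/funext => w; rewrite big_ord_recr.
apply: bounded01 => w; rewrite prodr_ge0 => [|j _]; last by have /andP[] := chi01 j w.
by rewrite prodr_ile1.
Qed.

Lemma ex_logistic_partition n :
  ex E (fun w => L n w) <=
  expR (2 * up * lam ^+ 2 * (sigma n - sigma 0%N)) * logistic (- a)
  + ex E (fun w => 1 - \prod_(j < n) chi j w).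
Proof.
have Lchi := Lone_cut_prod n.
rewrite -lerBlDr; apply/ler_addgt0Pr => eps eps0.
pose S := \sum_(j < n) ex E (fun w => `|M (sigma j) w|).
have S0 : 0 <= S by apply: sumr_ge0 => j _; exact: ex_ge0.
(* [E[1 - cutoff K (M_j)] <= E|M_j| / K], so the position cutoffs cost at most [S / K <= eps]. *)
pose K := (S + 1) / eps.
have K0 : 0 < K by rewrite divr_gt0 //; lra.
have LM j : Lone E (fun w => `|M (sigma j) w|) by exact/Lone_norm/(M_Lone hI).
have LKM j : Lone E (fun w => K^-1 * `|M (sigma j) w|) by exact: LoneZ.
have LZ : Lone E (fun w => c K n w * L n w).
  apply: bounded_Lone.
    apply: (H_rv H_filtration (sigma_ge0 n)).
    by apply: (stableM (H_stable H_filtration (sigma_ge0 n))); [exact: Hc|exact: HL].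
  by apply: bfctM; apply: bounded01.
have LL : Lone E (L n).
  apply: bounded_Lone; last exact: bounded01.
  exact: (H_rv H_filtration (sigma_ge0 n)).
have LS : Lone E (fun w => \sum_(j < n) K^-1 * `|M (sigma j) w|) by exact: Lone_sum.
have h1 : ex E (L n) <= ex E (fun w => c K n w * L n w +
    ((1 - \prod_(j < n) chi j w) + \sum_(j < n) K^-1 * `|M (sigma j) w|)).
  apply: ex_le => // [|w]; first by apply: LoneD => //; exact: LoneD.
  have /andP[l0 l1] := L01 n w; have /andP[c0 c1] := c01 K n w.
  apply: (@le_trans _ _ (c K n w * L n w + (1 - c K n w))).
    have : 0 <= (1 - c K n w) * (1 - L n w) by rewrite mulr_ge0 //; lra.
    lra.
  rewrite lerD2l; apply: le_trans (subr1_prod_le _ _ _) _ => [j|j|].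
  - exact: chi01.
  - by rewrite cutoff_ge0 cutoff_le1.
  - by rewrite lerD2l; apply: ler_sum => j _; rewrite mulrC; exact: cutoff_sub_le.
have h2 := exD LZ (LoneD Lchi LS).
have h3 := exD Lchi LS.
have h4 := ex_sum_le (index_enum 'I_n) (fun j : 'I_n => LKM j).
have h5 : \sum_(j < n) ex E (fun w => K^-1 * `|M (sigma j) w|) <= eps.
  under eq_bigr do rewrite exZ ?invr_ge0 ?(ltW K0) //.
  rewrite -mulr_sumr -/S /K invf_div mulrAC ler_pdivrMr; last lra.
  by rewrite ler_pM2l //; lra.
have h6 := ex_cut_logistic n K0.
rewrite /ex in h1 h2 h3 h4 h5 h6 *; lra.
Qed.

End partition.
End exponential_tail.

Lemma exists_nat_gt (R : realType) (x : R) : exists n : nat, x < n%:R.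
Proof. by exists (Num.trunc x).+1; exact: truncnS_gt. Qed.

(** (IV) speaks of partitions of [[0, T]] with steps between [delta / 2] and [delta], whereas the
    estimate runs over [[t, s]]; hence a partition of [[0, s]] that has [t] among its points. The
    two pieces have constant steps [eta1] and [eta] with [3/4 eta < eta1 <= eta], and
    [delta = 3/2 eta]. *)
Lemma mesh_partition_through (R : realType) (t s r : R) :
  0 <= t -> t < s -> 0 < r ->
  exists (delta : R) (n1 n : nat) (tau : nat -> R),
  [/\ 0 < delta < r, mesh_partition s delta (n1 + n) tau, tau n1 = t &
    forall i, tau i <= tau i.+1].
Proof.
move=> t0 ts r0; have st : 0 < s - t by rewrite subr_gt0.
have [n0 hn0] := exists_nat_gt (3 / 2 * (s - t) / r).
(* Makes [t / eta] at least 4, so that rounding up the number of steps on [[0, t]] shortens them by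
   less than a quarter. For [t = 0] the quotient is 0 by convention and the first piece is empty. *)
have [n2 hn2] := exists_nat_gt (4 * (s - t) / t).
pose n := (maxn n0 n2).+1.
have n_gt0 : 0 < n%:R :> R by rewrite ltr0n.
pose eta := (s - t) / n%:R.
have eta0 : 0 < eta by rewrite divr_gt0.
have etan : eta * n%:R = s - t by rewrite /eta mulfVK // gt_eqF.
have hr : 3 / 2 * eta < r.
  rewrite /eta mulrA ltr_pdivrMr // [ltRHS]mulrC -ltr_pdivrMr //.
  by apply: lt_le_trans hn0 _; rewrite ler_nat /n ltnW // ltnS leq_maxl.
have [n1 [eta1 [h1 h2 h3]]] : exists (n1 : nat) (eta1 : R),
    [/\ n1%:R * eta1 = t, 3 / 4 * eta < eta1 & eta1 <= eta].
  move: t0; rewrite le_eqVlt => /orP[/eqP <-|t0].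
    by exists 0%N, eta; rewrite mul0r; split => //; lra.
  have x0 : 0 <= t / eta by rewrite divr_ge0 // ltW.
  have /andP[] := truncn_itv x0; set m := Num.trunc _.
  rewrite ler_pdivlMr // ltr_pdivrMr // => hm1 hm2.
  have m1_gt0 : 0 < m.+1%:R :> R by rewrite ltr0n.
  exists m.+1, (t / m.+1%:R); split.
  - by rewrite mulrC mulfVK // gt_eqF.
  - rewrite ltr_pdivlMr //; have hm : (4 <= m)%N.
      rewrite leqNgt truncn_lt_nat // -leNgt.
      rewrite ler_pdivlMr // /eta mulrA ler_pdivrMr //.
      move: hn2; rewrite ltr_pdivrMr // => hn2; apply: le_trans (ltW hn2) _.
      by rewrite mulrC ler_pM2l // ler_nat /n ltnW // ltnS leq_maxr.
    have : 4 <= m%:R :> R by rewrite ler_nat.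
    rewrite -natr1 in hm2 *; nra.
  - by rewrite ler_pdivrMr // mulrC ltW.
pose tau i := if (i <= n1)%N then i%:R * eta1 else t + (i - n1)%:R * eta.
have eta1_gt0 : 0 < eta1 by lra.
have tauS i : tau i.+1 - tau i = if (i < n1)%N then eta1 else eta.
  rewrite /tau; case: ltngtP => // hi.
  - by rewrite -natr1; ring.
  - by rewrite subSn ?(ltnW hi) // -natr1; ring.
  - by rewrite hi subSnn h1; ring.
exists (3 / 2 * eta), n1, n, tau; rewrite /mesh_partition {2}/tau; split.
- by rewrite hr mulr_gt0 //; lra.
- split.
  + by rewrite /tau leq0n mul0r.
  + have -> : (n1 + n <= n1)%N = false by rewrite -{2}[n1]addn0 leq_add2l.
    by rewrite addnC addnK mulrC etan; ring.
  + by move=> i _; rewrite -subr_gt0 tauS; case: ifP => _; split; lra.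
- by rewrite /tau leqnn.
- by move=> i; rewrite -subr_ge0 tauS; case: ifP => _; lra.
Qed.

(** * Removal of the increment cutoffs by the modulus condition *)

Section moments.
Context (R : realType) (dOmega : measure_display) (Omega : measurableType dOmega).
Context (E : sublinear_expectation R Omega).
Context (H : R -> set (Omega -> R)) (Et : R -> (Omega -> R) -> Omega -> R).
Hypotheses (H_filtration : filtration E H) (Et_cond : conditional_expectation E H Et).
Context (M : R -> Omega -> R) (lo up : R).
Hypotheses (hI : martingale E H Et M /\ martingale E H Et (fun t w => - M t w)).
Hypothesis hII : martingale E H Et (fun t w => M t w ^+ 2 - up * t).
Hypothesis hIII : martingale E H Et (fun t w => - (M t w ^+ 2 - lo * t)).
Hypothesis up_ge0 : 0 <= up.
Hypothesis hIV : forall T : R, 0 < T -> modulusW E M T delta @[delta --> 0^'+] --> 0%E.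

Lemma ex_logistic_le t s lam a : 0 <= t -> t <= s ->
  ex E (fun w => logistic (lam * (M s w - M t w) - a)) <=
  expR (2 * up * lam ^+ 2 * (s - t)) * logistic (- a).
Proof.
move=> t0; rewrite le_eqVlt => /orP[/eqP <-|ts].
  rewrite subrr mulr0 expR0 mul1r.
  by under eq_fun do rewrite subrr mulr0 add0r; rewrite ex_cst.
have s0 : 0 < s by exact: le_lt_trans ts.
apply/ler_addgt0Pr => eps eps0.
(* If all increments are at most [1 / c], then [|lam Y| <= 1/4] and every [chi j] is 1; otherwise
   [1 <= c min(max increment, 1)]. In both cases [1 - prod chi <= c min(max increment, 1)], which
   (IV) makes small. *)
pose c := 4 * `|lam| + 1.
have c0 : 0 < c by rewrite ltr_wpDl // mulr_ge0.
have : \forall delta \near 0^'+, (modulusW E M s delta < (eps / c)%:E)%E.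
  have hnb : nbhs 0%E [set y : \bar R | (y < (eps / c)%:E)%E].
    by apply: open_ereal_lt'; rewrite lte_fin divr_gt0.
  exact: hIV s0 _ hnb.
move=> /nbhs_ballP[r /= r0 hr].
have [delta [n1 [n [tau [/andP[d0 dr] hmesh tau1 tau_mono]]]]] :=
  mesh_partition_through t0 ts r0.
pose sigma i := tau (n1 + i)%N.
have sm i : sigma i <= sigma i.+1 by rewrite /sigma addnS.
have s00 : 0 <= sigma 0%N by rewrite /sigma addn0 tau1.
have := ex_logistic_partition H_filtration Et_cond hI hII hIII lam a s00 sm up_ge0 n.
have [_ taun _] := hmesh.
have e0 : sigma 0%N = t by rewrite /sigma addn0.
have en : sigma n = s by [].
rewrite e0 en => h; apply: le_trans h _.
rewrite lerD2l.
set P := fun w => _.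
pose mx w := Num.min (\big[Num.max/0]_(i < n1 + n) `|M (tau i.+1) w - M (tau i) w|) 1.
have PW w : c^-1 * P w <= mx w.
  rewrite mulrC ler_pdivrMr //.
  have mx0 : 0 <= \big[Num.max/0]_(i < n1 + n) `|M (tau i.+1) w - M (tau i) w|.
    by apply: bigmax_ge_id.
  have hP : P w <= 1.
    rewrite /P gerBl prodr_ge0 // => j _; exact: cutoff_ge0.
  case: (leP (\big[Num.max/0]_(i < n1 + n) `|M (tau i.+1) w - M (tau i) w|) c^-1) => hm.
    have -> : P w = 0.
      rewrite /P big1 ?subrr // => j _; apply: cutoff_in; first by rewrite invr_gt0.
      rewrite normrM.
      have hj : `|M (sigma j.+1) w - M (sigma j) w| <= c^-1.
        apply: le_trans hm.
        have jn : (n1 + j < n1 + n)%N by rewrite ltn_add2l.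
        rewrite /sigma addnS.
        exact: (le_bigmax _ (fun i : 'I_(n1 + n) => `|M (tau i.+1) w - M (tau i) w|) (Ordinal jn)).
      apply: le_trans (ler_wpM2l (normr_ge0 lam) hj) _.
      rewrite ler_pdivrMr // /c; lra.
    by rewrite mulr_ge0 ?(ltW c0) // le_min mx0 ler01.
  apply: le_trans hP _.
  have c1 : 1 <= c by rewrite lerDr mulr_ge0.
  rewrite /mx minr_pMl ?(ltW c0) // le_min mul1r c1 andbT.
  by rewrite -ler_pdivrMr // mul1r ltW.
have LP : Lone E P by exact: (Lone_cut_prod H_filtration hI lam s00 sm n).
have hE : (Ehat E (fun w => (c^-1 * P w)%R) <= modulusW E M s delta)%E.
  apply: le_trans (Ehat_le E PW) _; apply: ereal_sup_ubound.
  by exists (n1 + n)%N, tau.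
have {}hr : (modulusW E M s delta < (eps / c)%:E)%E.
  by apply: hr => //; rewrite /ball /= sub0r normrN gtr0_norm.
have := le_lt_trans hE hr.
rewrite Ehat_fin ?lte_fin; last exact: LoneZ.
rewrite exZ ?invr_ge0 ?(ltW c0) // mulrC ltr_pM2r ?invr_gt0 //.
exact: ltW.
Qed.

End moments.

(** * From exponential tails to moments *)

Section truncated_exponential.
Context (R : realType).
Implicit Types a z : R.

(* A bounded substitute for the exponential: it equals [expR z] up to a factor
   2 for [z <= a]. *)
Definition texp a z := expR a * logistic (z - a).

Lemma texp_ge0 a z : 0 <= texp a z.
Proof. by rewrite mulr_ge0 ?expR_ge0 ?logistic_ge0. Qed.

Lemma expn_le_expR z n : 0 <= z -> (0 < n)%N -> z ^+ n <= n%:R ^+ n * expR z.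
Proof.
move=> z0 n0; have n0' : 0 < n%:R :> R by rewrite ltr0n.
have -> : z = n%:R * (z / n%:R) by rewrite mulrC mulfVK // gt_eqF.
rewrite expRM_natl exprMn ler_wpM2l ?exprn_ge0 ?(ltW n0') //.
rewrite lerXn2r ?nnegrE ?expR_ge0 ?divr_ge0 ?(ltW n0') //.
by apply: le_trans (expR_ge1Dx _); rewrite lerDr.
Qed.

Lemma texp_ge_expR a z : z <= a -> expR z <= 2 * texp a z.
Proof.
move=> za; rewrite /texp /logistic.
have h1 : expR (z - a) <= 1 by rewrite -expR0 ler_expR subr_le0.
have h0 := expR_gt0 (z - a).
have -> : expR z = expR a * expR (z - a) by rewrite -expRD subrKC.
rewrite mulrCA ler_wpM2l ?expR_ge0 // mulrA ler_pdivlMr; last lra.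
nra.
Qed.

Lemma texp_mono a : {homo texp a : x y / x <= y}.
Proof.
move=> x y xy; rewrite ler_wpM2l ?expR_ge0 //; apply: logistic_mono.
by rewrite lerD2r.
Qed.

Lemma expn_le_texp a z n : 0 <= z -> z <= a -> (0 < n)%N ->
  z ^+ n <= 2 * n%:R ^+ n * texp a z.
Proof.
move=> z0 za n0; apply: le_trans (expn_le_expR z0 n0) _.
by rewrite -mulrA mulrCA ler_wpM2l ?exprn_ge0 // texp_ge_expR.
Qed.

(** [54 = 2 * 3^3] comes from [expn_le_texp] for [|z| <= a]. Beyond the truncation level the fourth
    power pays, with a weight [1 / a] that will be sent to 0. *)
Lemma cube_le_texp a z : 0 < a ->
  `|z| ^+ 3 <= 54 * (texp a z + texp a (- z)) + z ^+ 4 / a.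
Proof.
move=> a0.
have h4 : 0 <= z ^+ 4 / a by rewrite divr_ge0 ?(ltW a0) // exprn_even_ge0.
have t1 := texp_ge0 a z; have t2 := texp_ge0 a (- z).
have hT : texp a `|z| <= texp a z + texp a (- z) by case: (ler0P z) => _; lra.
case: (leP `|z| a) => h.
  have := expn_le_texp (normr_ge0 z) h (isT : (0 < 3)%N).
  have -> : 2 * 3%:R ^+ 3 = 54 :> R by ring.
  lra.
have : `|z| ^+ 3 <= z ^+ 4 / a.
  rewrite ler_pdivlMr //.
  have -> : z ^+ 4 = `|z| ^+ 3 * `|z|.
    by rewrite -exprSr -normrX ger0_norm // exprn_even_ge0.
  by rewrite ler_wpM2l ?exprn_ge0 // ltW.
lra.
Qed.

End truncated_exponential.

Section capacity_lemmas.
Context (R : realType) (d : measure_display) (Omega : measurableType d).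
Context (E : sublinear_expectation R Omega).

Lemma capacity_le A Y : Lone E Y -> (forall w, \1_A w <= Y w) ->
  (capacity E A <= (ex E Y)%:E)%E.
Proof.
move=> LY AY; rewrite -Ehat_fin //; apply: ereal_inf_lbound.
by exists Y => //; split=> //; exact: Lone_rv.
Qed.

Lemma capacity_ge0 A : (0 <= capacity E A)%E.
Proof.
apply: le_ereal_inf_tmp => _ [Y [rY hY] <-]; apply: Ehat_ge0 => w.
by apply: le_trans (hY w); rewrite indicE; case: (_ \in _).
Qed.

Lemma capacity_le1 A : (capacity E A <= 1)%E.
Proof.
rewrite -[1%E]/(1%R%:E) -(ex_cst E 1); apply: capacity_le (Lone_cst E 1) _ => w.
by rewrite indicE; case: (_ \in _).
Qed.

Lemma capacityT : capacity E setT = 1%E.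
Proof.
apply/eqP; rewrite eq_le capacity_le1 /=.
apply: le_ereal_inf_tmp => _ [Y [rY hY] <-].
rewrite -[1%E]/(1%R%:E) -(Ehat_cst E 1); apply: Ehat_le => w.
by apply: le_trans (hY w); rewrite indicT.
Qed.

Lemma capacity_mono A B : A `<=` B -> (capacity E A <= capacity E B)%E.
Proof.
move=> AB; apply: ereal_inf_le_tmp => _ [Y [rY hY] <-].
exists Y => //; split => // w; apply: le_trans (hY w).
rewrite !indicE; case: (boolP (w \in A)) => // /set_mem /AB hB.
by rewrite mem_set.
Qed.

(** The negative half of the integral vanishes because the capacity is 1 at levels [t <= 0]. On the
    positive half the capacity is nonincreasing in the level, hence measurable, and lies below
    [(2 C + 2) / (1 + t^2)], whose integral comes from the arctangent. *)
Lemma choquet_fin (X : Omega -> R) (C : R) : (forall w, 0 <= X w) -> 0 <= C ->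
  (forall t, 1 <= t -> (capacity E [set w | (t <= X w)%R] <= (C / t ^+ 2)%:E)%E) ->
  (choquet E X < +oo)%E.
Proof.
move=> X0 C0 hC; pose f t := capacity E [set w | t <= X w].
have f_fin t : f t \is a fin_num.
  rewrite fin_numE -ltNye -ltey (lt_le_trans _ (capacity_ge0 _)) ?ltNy0 //=.
  by apply: le_lt_trans (capacity_le1 _) _; exact: ltry.
pose g t := fine (f t).
have fg t : f t = (g t)%:E by rewrite /g fineK.
have g_mono : {homo g : m n /~ n <= m}.
  move=> m n nm; rewrite -lee_fin -!fg; apply: capacity_mono => w /=.
  exact: le_trans.
have g1 t : g t <= 1 by rewrite -lee_fin -fg; exact: capacity_le1.
rewrite /choquet.
rewrite [X in (_ + X)%E]integral0_eq ?adde0; last first.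
  move=> t /=; rewrite in_itv /= => t0.
  have -> : [set w | t <= X w] = setT.
    by apply/seteqP; split => // w _ /=; apply: le_trans (X0 w).
  by rewrite capacityT -EFinB subrr.
pose K := 2 * C + 2.
have K0 : 0 <= K by rewrite /K; lra.
apply: (@le_lt_trans _ _ (K * (pi / 2))%:E); last exact: ltry.
rewrite EFinM -integral0y_oneDsqr -ge0_integralZl //; last first.
  apply/measurable_realfun.measurable_EFinP.
  apply: measurable_funTS; apply: measurable_realfun.continuous_measurable_fun.
  exact: continuous_oneDsqrV.
apply: ge0_le_integral => //.
- by move=> t _; exact: capacity_ge0.
- have fE : f = EFin \o g by apply/funext => t; rewrite /= -fg.
  rewrite -/f fE; apply/measurable_realfun.measurable_EFinP.
  exact: measurable_realfun.nonincreasing_measurable.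
- apply/measurable_realfun.measurable_EFinP.
  apply: measurable_realfun.measurable_funM => //.
  apply: measurable_funTS; apply: measurable_realfun.continuous_measurable_fun.
  exact: continuous_oneDsqrV.
move=> t /=; rewrite in_itv /= andbT => t0.
rewrite -/(f t) fg -EFinM lee_fin /oneDsqr.
have q0 : 0 < 1 + t ^+ 2 by have := sqr_ge0 t; lra.
rewrite ler_pdivlMr //.
case: (leP t 1) => t1.
  have : t ^+ 2 <= 1 by rewrite expr_le1.
  have := ler_wpM2r (ltW q0) (g1 t); rewrite /K; lra.
have t2 : 0 < t ^+ 2 by rewrite exprn_gt0 //; lra.
have : g t <= C / t ^+ 2 by rewrite -lee_fin -fg; apply: hC; exact: ltW.
rewrite ler_pdivlMr // => h.
have t12 : 1 <= t ^+ 2 by rewrite expr_ge1 // ltW.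
have := g1 t; rewrite /K; lra.
Qed.

End capacity_lemmas.

Section moments.
Context (R : realType) (dOmega : measure_display) (Omega : measurableType dOmega).
Context (E : sublinear_expectation R Omega).
Context (H : R -> set (Omega -> R)) (Et : R -> (Omega -> R) -> Omega -> R).
Hypotheses (H_filtration : filtration E H) (Et_cond : conditional_expectation E H Et).
Context (M : R -> Omega -> R) (lo up : R).
Hypothesis M0 : forall w, M 0 w = 0.
Hypothesis M_moments : forall p t : R, 0 < p -> 0 <= t ->
  (choquet E (fun w => (`|M t w| `^ p)%R) < +oo)%E ->
  (Ehat E (fun w => (`|M t w| `^ p)%R) < +oo)%E.
Hypotheses (hI : martingale E H Et M /\ martingale E H Et (fun t w => - M t w)).
Hypothesis hII : martingale E H Et (fun t w => M t w ^+ 2 - up * t).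
Hypothesis hIII : martingale E H Et (fun t w => - (M t w ^+ 2 - lo * t)).
Hypothesis up_ge0 : 0 <= up.
Hypothesis hIV : forall T : R, 0 < T -> modulusW E M T delta @[delta --> 0^'+] --> 0%E.

Lemma texp_Lone a lam t s : 0 <= t -> t <= s ->
  Lone E (fun w => texp a (lam * (M s w - M t w))).
Proof.
move=> t0 ts; apply: LoneZ; apply: bounded_Lone; last first.
  by exists 1 => w; rewrite ger0_norm ?logistic_ge0 ?logistic_le1.
apply: (stable_comp (@rv_ClLip _ _ _ E) (@ClLip_logistic R)).
apply/Lone_rv/LoneB; last exact: Lone_cst.
by apply/LoneZ/LoneB; apply: (M_Lone hI) => //; exact: le_trans ts.
Qed.

(** The bound is uniform in [a]: the factor [e^a logistic(- a)] left over from [ex_logistic_le] is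
    at most 1. *)
Lemma ex_texp_le a lam t s : 0 <= t -> t <= s ->
  ex E (fun w => texp a (lam * (M s w - M t w))) <=
  expR (2 * up * lam ^+ 2 * (s - t)).
Proof.
move=> t0 ts.
have hL : Lone E (fun w => logistic (lam * (M s w - M t w) - a)).
  have := LoneZ (expR a)^-1 (texp_Lone a lam t0 ts).
  by congr Lone; apply/funext => w; rewrite /texp mulKf // gt_eqF // expR_gt0.
rewrite exZ ?expR_ge0 //.
have := ex_logistic_le H_filtration Et_cond hI hII hIII up_ge0 hIV lam a t0 ts.
move=> /(ler_wpM2l (expR_ge0 a)); move=> h; apply: le_trans h _.
rewrite mulrCA ler_piMr ?expR_ge0 //.
apply: le_trans (ler_wpM2l (expR_ge0 a) (logistic_le_expR (- a))) _.
by rewrite -expRD subrr expR0.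
Qed.

(** The capacity of [|M_t|^(n+1) >= tau] is estimated by Chebyshev's inequality with [texp tau],
    truncated at the same level: [z = min(|M_t|, tau)] satisfies [tau^2 <= z^N <= b texp tau z] with
    [N = 2 (n + 1)]. The resulting decay [tau^-2] makes the Choquet integral finite, and [M_moments]
    turns this into a moment. *)
Lemma M_moment n t : 0 <= t -> Lone E (fun w => `|M t w| ^+ n).
Proof.
move=> t0; case: n => [|n].
  by under eq_fun do rewrite expr0; exact: Lone_cst.
have rM : rv E (fun w => `|M t w| ^+ n.+1).
  apply: (stableX (@rv_ClLip _ _ _ E)); apply: (stable_norm (@rv_ClLip _ _ _ E)).
  exact/Lone_rv/(M_Lone hI).
have powE : (fun w => `|M t w| `^ n.+1%:R) = (fun w => `|M t w| ^+ n.+1).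
  by apply/funext => w; rewrite powR_mulrn.
split => //.
have -> : (fun w => `| `|M t w| ^+ n.+1 |) = (fun w => `|M t w| `^ n.+1%:R).
  by rewrite powE; apply/funext => w; rewrite ger0_norm // exprn_ge0.
apply: M_moments => //; rewrite powE.
pose N := (2 * n.+1)%N.
pose b := 2 * N%:R ^+ N : R.
have b0 : 0 <= b by rewrite mulr_ge0 // exprn_ge0.
pose K := expR (2 * up * 1 ^+ 2 * (t - 0)) + expR (2 * up * (-1) ^+ 2 * (t - 0)).
apply: (@choquet_fin _ _ _ _ _ (b * K)) => [w||tau tau1]; first exact: exprn_ge0.
  by rewrite mulr_ge0 // addr_ge0 ?expR_ge0.
have tau2 : 0 < tau ^+ 2 by rewrite exprn_gt0 //; lra.
pose Y w := (b / tau ^+ 2) * (texp tau (1 * (M t w - M 0 w)) +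
                              texp tau (-1 * (M t w - M 0 w))).
have L1 := texp_Lone tau 1 (lexx 0) t0.
have L2 := texp_Lone tau (-1) (lexx 0) t0.
have LY : Lone E Y by apply: LoneZ; exact: LoneD.
apply: le_trans (capacity_le LY _) _.
  move=> w; have Y0 : 0 <= Y w.
    by apply: mulr_ge0; [rewrite divr_ge0 // ltW|rewrite addr_ge0 ?texp_ge0].
  rewrite indicE; case: (boolP (w \in _)) => // /set_mem /= hw.
  rewrite /Y mulrAC ler_pdivlMr // mul1r M0 subr0 mul1r mulN1r.
  pose z := Num.min `|M t w| tau.
  have z0 : 0 <= z by rewrite le_min normr_ge0 /=; lra.
  have zt : z <= tau by rewrite ge_min lexx orbT.
  have hz : tau <= z ^+ n.+1.
    rewrite /z; case: (leP `|M t w| tau) => // _.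
    by rewrite -{1}(expr1 tau) ler_weXn2l.
  apply: (@le_trans _ _ (z ^+ N)).
    by rewrite /N mulnC exprM lerXn2r ?nnegrE ?exprn_ge0 //; lra.
  apply: le_trans (expn_le_texp z0 zt _) _ => //.
  rewrite -/b ler_wpM2l //.
  apply: (@le_trans _ _ (texp tau `|M t w|)).
    by apply: texp_mono; rewrite ge_min lexx.
  have t1 := texp_ge0 tau (M t w); have t2 := texp_ge0 tau (- M t w).
  by case: (ler0P (M t w)) => _; lra.
rewrite lee_fin /Y exZ; [|exact: LoneD|by rewrite divr_ge0 // ltW].
rewrite mulrAC ler_wpM2r ?invr_ge0 ?(ltW tau2) // ler_wpM2l //.
apply: le_trans (exD L1 L2) _.
by apply: lerD; exact: ex_texp_le.
Qed.

Lemma incr_moment n t s : 0 <= t -> t <= s ->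
  Lone E (fun w => `|M s w - M t w| ^+ n).
Proof.
move=> t0 ts; have s0 := le_trans t0 ts.
have rY : rv E (fun w => `|M s w - M t w| ^+ n).
  apply: (stableX (@rv_ClLip _ _ _ E)); apply: (stable_norm (@rv_ClLip _ _ _ E)).
  by apply/Lone_rv/LoneB; exact: (M_Lone hI).
apply: (Lone_le rY (LoneZ (2 ^+ n) (LoneD (M_moment n s0) (M_moment n t0)))) => w.
rewrite ger0_norm ?exprn_ge0 //.
have h := ler_normB (M s w) (M t w).
apply: (@le_trans _ _ ((2 * Num.max `|M s w| `|M t w|) ^+ n)).
  rewrite lerXn2r ?nnegrE ?mulr_ge0 ?le_max ?normr_ge0 //.
  by apply: le_trans h _; case: (leP `|M s w| `|M t w|) => ?; lra.
rewrite exprMn ler_wpM2l ?exprn_ge0 //.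
have h1 : 0 <= `|M s w| ^+ n by rewrite exprn_ge0.
have h2 : 0 <= `|M t w| ^+ n by rewrite exprn_ge0.
by case: (leP `|M s w| `|M t w|) => _; lra.
Qed.

(** Brownian scaling: for [Z = Y / rho] the parameter [lam = 1 / rho] makes the exponent
    [2 up lam^2 (s - t)] equal to [2 up]. The fourth moment of [Z] enters only through its
    finiteness, since it is divided by [a], which may be taken arbitrarily large. *)
Lemma ex_incr_cube t s rho : 0 <= t -> t <= s -> 0 <= rho -> s - t = rho ^+ 2 ->
  ex E (fun w => `|M s w - M t w| ^+ 3) <= 108 * expR (2 * up) * rho ^+ 3.
Proof.
move=> t0 ts; rewrite le_eqVlt => /orP[/eqP <-|rho0] st.
  have -> : s = t by apply/eqP; rewrite -subr_eq0 st expr0n.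
  by under eq_fun do rewrite subrr normr0 expr0n; rewrite ex_cst expr0n mulr0.
have rho3 : 0 < rho ^+ 3 by rewrite exprn_gt0.
pose Z w := rho^-1 * (M s w - M t w).
have LY3 := incr_moment 3 t0 ts.
have cubeE : (fun w => `|Z w| ^+ 3) = (fun w => rho^-1 ^+ 3 * `|M s w - M t w| ^+ 3).
  by apply/funext => w; rewrite /Z normrM gtr0_norm ?invr_gt0 // exprMn.
have fourE : (fun w => Z w ^+ 4) = (fun w => rho^-1 ^+ 4 * `|M s w - M t w| ^+ 4).
  apply/funext => w; rewrite /Z exprMn -[X in _ * X](@ger0_norm _ (_ ^+ 4)) ?normrX //.
  by rewrite exprn_even_ge0.
have LZ4 : Lone E (fun w => Z w ^+ 4).
  by rewrite fourE; apply: LoneZ; exact: incr_moment.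
have LZ3 : Lone E (fun w => `|Z w| ^+ 3) by rewrite cubeE; exact: LoneZ.
suff h : ex E (fun w => `|Z w| ^+ 3) <= 108 * expR (2 * up).
  move: h; rewrite cubeE exZ ?exprn_ge0 ?invr_ge0 ?(ltW rho0) //.
  by rewrite exprVn mulrC ler_pdivrMr.
apply/ler_addgt0Pr => eps eps0.
pose q := ex E (fun w => Z w ^+ 4).
have q0 : 0 <= q by apply: ex_ge0 => w; rewrite exprn_even_ge0.
pose a := (q + 1) / eps.
have a0 : 0 < a by rewrite divr_gt0 //; lra.
have L1 := texp_Lone a rho^-1 t0 ts.
have L2 := texp_Lone a (- rho^-1) t0 ts.
have LZa : Lone E (fun w => a^-1 * Z w ^+ 4) by exact: LoneZ.
apply: (@le_trans _ _ (ex E (fun w => 54 * (texp a (rho^-1 * (M s w - M t w)) +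
   texp a (- rho^-1 * (M s w - M t w))) + a^-1 * Z w ^+ 4))).
  apply: ex_le => // [|w]; first by apply: LoneD => //; apply: LoneZ; exact: LoneD.
  by rewrite mulNr [a^-1 * _]mulrC; exact: cube_le_texp.
apply: le_trans (exD (LoneZ 54 (LoneD L1 L2)) LZa) _.
rewrite !exZ ?invr_ge0 ?(ltW a0) //; last exact: LoneD.
have e1 : 2 * up * rho^-1 ^+ 2 * (s - t) = 2 * up.
  by rewrite st -mulrA -exprMn mulVf ?gt_eqF // expr1n mulr1.
have := exD L1 L2.
have := ex_texp_le a rho^-1 t0 ts; have := ex_texp_le a (- rho^-1) t0 ts.
rewrite sqrrN e1.
have : a^-1 * q <= eps.
  rewrite mulrC ler_pdivrMr // /a mulrCA mulfV ?gt_eqF // mulr1; lra.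
rewrite /q; lra.
Qed.

End moments.

(** * The second-order identity with bounded coefficients *)

Section second_order.
Context (R : realType) (dOmega : measure_display) (Omega : measurableType dOmega).
Context (E : sublinear_expectation R Omega).
Context (H : R -> set (Omega -> R)) (Et : R -> (Omega -> R) -> Omega -> R).
Hypotheses (H_filtration : filtration E H) (Et_cond : conditional_expectation E H Et).
Context (M : R -> Omega -> R) (lo up : R).
Hypothesis M0 : forall w, M 0 w = 0.
Hypothesis M_moments : forall p t : R, 0 < p -> 0 <= t ->
  (choquet E (fun w => (`|M t w| `^ p)%R) < +oo)%E ->
  (Ehat E (fun w => (`|M t w| `^ p)%R) < +oo)%E.
Hypotheses (hI : martingale E H Et M /\ martingale E H Et (fun t w => - M t w)).
Hypothesis hII : martingale E H Et (fun t w => M t w ^+ 2 - up * t).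
Hypothesis hIII : martingale E H Et (fun t w => - (M t w ^+ 2 - lo * t)).
Hypothesis up_ge0 : 0 <= up.
Hypothesis hIV : forall T : R, 0 < T -> modulusW E M T delta @[delta --> 0^'+] --> 0%E.

Let momM := M_moment H_filtration Et_cond M0 M_moments hI hII hIII up_ge0 hIV.
Let momY := incr_moment H_filtration Et_cond M0 M_moments hI hII hIII up_ge0 hIV.

Lemma CMY_Lone s t C : 0 <= t -> t <= s -> rv E C -> bounded_fct C ->
  Lone E (fun w => C w * M t w * (M s w - M t w)).
Proof.
move=> t0 ts rC bC; have s0 := le_trans t0 ts.
have -> : (fun w => C w * M t w * (M s w - M t w)) =
  (fun w => C w * (M t w * (M s w - M t w))) by apply/funext => w; ring.
apply: bounded_LoneM => //.
apply: (Lone_le _ (LoneD (momM 2 t0) (momY 2 t0 ts))) => [|w].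
  apply: (stableM (@rv_ClLip _ _ _ E)); first exact: (Lone_rv (M_Lone hI t0)).
  by apply/Lone_rv/LoneB; exact: (M_Lone hI).
rewrite normrM; have := sqr_ge0 (`|M t w| - `|M s w - M t w|).
have := sqr_ge0 (`|M t w| + `|M s w - M t w|); lra.
Qed.

(** [M_t] is replaced by its product with a cutoff at level [K], where [ex_symmetric] applies. The
    error is at most [(c / K) E[x^2 y]] with [x = |M_t|] and [y = |Y|], and [x^2 y <= x^3 + y^3]. *)
Lemma ex_CMY s t C : 0 <= t -> t <= s -> H t C -> bounded_fct C ->
  ex E (fun w => C w * M t w * (M s w - M t w)) = 0.
Proof.
move=> t0 ts HC bC; have s0 := le_trans t0 ts.
have Hst := H_stable H_filtration t0.
have rC := H_rv H_filtration t0 HC.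
have LX := CMY_Lone t0 ts rC bC.
have [c c0 hc] := bfct_ge0 bC.
have L3 := LoneD (momM 3 t0) (momY 3 t0 ts).
set Z := fun w => `|M t w| ^+ 3 + `|M s w - M t w| ^+ 3 in L3.
have Z0 : 0 <= ex E Z by apply: ex_ge0 => w; rewrite addr_ge0 // exprn_ge0.
apply/eqP; rewrite -normr_le0; apply/ler_addgt0Pr => eps eps0; rewrite add0r.
pose K := (c * ex E Z + 1) / eps.
have cz : 0 <= c * ex E Z by exact: mulr_ge0.
have K0 : 0 < K by rewrite divr_gt0 //; lra.
pose D w := C w * (cutoff K (M t w) * M t w).
have HD : H t D.
  apply: (stableM Hst HC); apply: (stableM Hst) (M_H hI t0).
  exact: (stable_comp Hst (ClLip_cutoff K0) (M_H hI t0)).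
have bD : bounded_fct D.
  by apply: (bfctM bC); exists (2 * K) => w; exact: cutoff_supp.
have D0 := ex_symmetric H_filtration Et_cond hI t0 ts HD bD.
have LD : Lone E (fun w => D w * (M s w - M t w)).
  apply: bounded_LoneM => //; first exact: (H_rv H_filtration t0 HD).
  by apply: LoneB; exact: (M_Lone hI).
rewrite -[X in `|X|]subr0 -D0.
apply: le_trans (ex_dist_le LX LD (LoneZ (c / K) L3) _) _.
  move=> w; rewrite /D.
  have -> : C w * M t w * (M s w - M t w) -
      C w * (cutoff K (M t w) * M t w) * (M s w - M t w) =
      C w * ((1 - cutoff K (M t w)) * (M t w * (M s w - M t w))) by ring.
  rewrite normrM -mulrA ler_pM //.
  have cut1 := cutoff_le1 K (M t w).
  rewrite normrM ger0_norm ?subr_ge0 // mulrC [leRHS]mulrC ler_pdivlMr //.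
  rewrite -mulrA.
  have : (1 - cutoff K (M t w)) * K <= `|M t w|.
    by rewrite -ler_pdivlMr //; exact: cutoff_sub_le.
  move=> /(ler_wpM2l (normr_ge0 (M t w * (M s w - M t w)))) h.
  apply: le_trans h _; rewrite normrM /Z.
  move: (normr_ge0 (M t w)) (normr_ge0 (M s w - M t w)).
  move: `|M t w| `|M s w - M t w| => x y x0 y0.
  have -> : x * y * x = x ^+ 2 * y by ring.
  have x3 : 0 <= x ^+ 3 by exact: exprn_ge0.
  have y3 : 0 <= y ^+ 3 by exact: exprn_ge0.
  case: (leP y x) => xy.
    have : x ^+ 2 * y <= x ^+ 2 * x by rewrite ler_wpM2l ?sqr_ge0.
    by rewrite -exprSr; lra.
  have : x ^+ 2 * y <= y ^+ 2 * y.
    by rewrite ler_wpM2r // lerXn2r ?nnegrE // ltW.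
  by rewrite -exprSr; lra.
rewrite exZ //; last by rewrite divr_ge0 // ltW.
rewrite mulrAC ler_pdivrMr // /K mulrCA mulfV ?gt_eqF // mulr1; lra.
Qed.

Lemma ex_second_order s t A B C : 0 <= t -> t <= s ->
  H t A -> bounded_fct A -> H t B -> bounded_fct B -> H t C -> bounded_fct C ->
  ex E (fun w => A w + B w * (M s w - M t w) + C w / 2 * (M s w - M t w) ^+ 2) =
  ex E (fun w => A w + Gfun lo up (C w) * (s - t)).
Proof.
move=> t0 ts HA bA HB bB HC bC; have Hlin := H_linear H_filtration t0.
apply: (ex_quadratic H_filtration Et_cond hI hII hIII) => //.
- by apply: CMY_Lone => //; exact: (H_rv H_filtration t0 HC).
- exact: ex_CMY.
- have := ex_CMY t0 ts (stableN Hlin HC) (bfctN bC).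
  by move=> h; rewrite -[RHS]h; congr ex; apply/funext => w; ring.
Qed.

End second_order.

(** * A monotone scheme with smooth interpolation *)

Section int_sums.
Context (R : realFieldType).
Implicit Types f : int -> R.

Fixpoint sumZ (S : nat) f : R :=
  if S is S'.+1 then sumZ S' f + (f S%:Z + f (- S%:Z)) else f 0.

Lemma sumZ_telescope S f : sumZ S (fun j => f (j + 1) - f j) = f (S%:Z + 1) - f (- S%:Z).
Proof.
elim: S => [|S IH] /=; first by rewrite oppr0 add0r.
rewrite IH; have -> : S.+1%:Z = S%:Z + 1 by lia.
have -> : - (S%:Z + 1) + 1 = - S%:Z by lia.
ring.
Qed.

Lemma sumZ_le S f g : (forall j, f j <= g j) -> sumZ S f <= sumZ S g.
Proof. by move=> fg; elim: S => [|S IH] //=; rewrite !lerD. Qed.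

Lemma sumZD S f g : sumZ S (fun j => f j + g j) = sumZ S f + sumZ S g.
Proof. by elim: S => [|S IH] //=; rewrite IH; ring. Qed.

Lemma sumZ_term S f j : (forall j, 0 <= f j) -> (`|j| <= S)%N -> f j <= sumZ S f.
Proof.
move=> f0; elim: S => [|S IH] /=.
  by rewrite leqn0 absz_eq0 => /eqP ->.
rewrite leq_eqVlt => /orP[/eqP e|/IH h]; last first.
  by have := f0 S.+1; have := f0 (- S.+1%:Z); lra.
have s0 : 0 <= sumZ S f by elim: (S) => [|S' IH'] //=; rewrite !addr_ge0.
have [->|->] : j = S.+1 \/ j = - S.+1%:Z by lia.
- by have := f0 (- S.+1%:Z); lra.
- by have := f0 S.+1; lra.
Qed.

Lemma sumZ_support S A f c : (A <= S)%N -> (forall j, (A < `|j|)%N -> f j = 0) ->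
  (forall j, f j <= c) -> sumZ S f <= (2 * A + 1)%:R * c.
Proof.
move=> AS f0 fc.
have -> : sumZ S f = sumZ A f.
  rewrite -(subnK AS); elim: (S - A)%N => [|i IH] //=.
  by rewrite IH !f0 ?addr0 //; lia.
elim: (A) => [|i IH] /=; first by rewrite mul1r.
have := fc i.+1; have := fc (- i.+1%:Z).
have -> : (2 * i.+1 + 1)%:R = (2 * i + 1)%:R + 1 + 1 :> R.
  by rewrite !natr1; congr (_%:R); lia.
lra.
Qed.

End int_sums.

(** * The explicit scheme and its energy estimate *)

Section scheme.
Context (R : realFieldType).
Variables (G : R -> R) (Lam k : R).
Hypotheses (Lam_gt0 : 0 < Lam) (k_gt0 : 0 < k) (G0 : G 0 = 0).
(** A slope between any two points expresses monotonicity and the Lipschitz bound at once, and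
    serves as a derivative for the nonsmooth [G]. *)
Hypothesis G_slope : forall a b, exists2 c, 0 <= c <= Lam / 2 & G a - G b = c * (a - b).

Definition diff2 (w : int -> R) (j : int) : R := w (j + 1) - 2 * w j + w (j - 1).
(** The stability (CFL) ratio: with slopes of [G] at most [Lam / 2] it gives coefficients
    [kap <= 1/2] in [speed_step], which is what makes the terms [kap (1 - 2 kap)] of the energy
    identity nonnegative. *)
Definition tstep : R := k ^+ 2 / Lam.
Definition speed (w : int -> R) (j : int) : R := G (diff2 w j / k ^+ 2).
Definition euler_step (w : int -> R) (j : int) : R := w j + tstep * speed w j.
Definition euler (w0 : int -> R) (n : nat) : int -> R := iter n euler_step w0.
Definition dspeed (w : int -> R) (j : int) : R := speed w (j + 1) - speed w j.

Let k2_gt0 : 0 < k ^+ 2. Proof. by rewrite exprn_gt0. Qed.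

Lemma G_lip a b : `|G a - G b| <= Lam / 2 * `|a - b|.
Proof.
have [c /andP[c0 c1] ->] := G_slope a b.
by rewrite normrM ger0_norm // ler_wpM2r.
Qed.

(** The speed solves a linear discrete heat equation with variable coefficients: by [G_slope], the
    change of [G] is a slope times the second difference of the speed itself. *)
Lemma speed_step w : exists2 kap : int -> R, (forall j, 0 <= kap j <= 2^-1) &
  forall j, speed (euler_step w) j =
            speed w j + kap j * (dspeed w j - dspeed w (j - 1)).
Proof.
have h j : exists c, 0 <= c <= 2^-1 /\ speed (euler_step w) j =
            speed w j + c * (dspeed w j - dspeed w (j - 1)).
  have [c /andP[c0 c1] hc] :=
    G_slope (diff2 (euler_step w) j / k ^+ 2) (diff2 w j / k ^+ 2).
  exists (c / Lam); split.
    rewrite divr_ge0 ?(ltW Lam_gt0) //= ler_pdivrMr //; lra.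
  rewrite /speed in hc *.
  rewrite -[LHS](subrK (G (diff2 w j / k ^+ 2))) hc addrC; congr (_ + _).
  rewrite /dspeed /diff2 /euler_step /tstep (subrK 1 j).
  field.
  by rewrite !gt_eqF.
by have [f hf] := choice h; exists f => j; have [] := hf j.
Qed.

(* Up to a telescoping flux [F], one step of the scheme decreases the squares of
   the increments of the speed. *)
Lemma dspeed_energy w : exists F : int -> R,
  (forall j, dspeed w j = 0 -> dspeed w (j - 1) = 0 -> F j = 0) /\
  forall j, dspeed (euler_step w) j ^+ 2 <= dspeed w j ^+ 2 + (F (j + 1) - F j).
Proof.
have [kap hkap hq] := speed_step w.
exists (fun j => kap j * (dspeed w j - dspeed w (j - 1)) * (dspeed w j + dspeed w (j - 1))).
split => [j -> ->|j]; first by rewrite addr0 mulr0.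
have -> : dspeed (euler_step w) j = dspeed w j +
    kap (j + 1) * (dspeed w (j + 1) - dspeed w j) -
    kap j * (dspeed w j - dspeed w (j - 1)).
  have e : speed w (j + 1) = speed w j + dspeed w j by rewrite /dspeed; ring.
  by rewrite {1}/dspeed !hq (addrK 1 j) e; ring.
rewrite (addrK 1 j).
move: (hkap (j + 1)) (hkap j) => /andP[a0 a1] /andP[b0 b1].
move: (kap (j + 1)) (kap j) (dspeed w (j + 1)) (dspeed w j) (dspeed w (j - 1))
  a0 a1 b0 b1 => a b r2 r1 r0 a0 a1 b0 b1.
rewrite -subr_ge0.
have -> : r1 ^+ 2 + (a * (r2 - r1) * (r2 + r1) - b * (r1 - r0) * (r1 + r0)) -
   (r1 + a * (r2 - r1) - b * (r1 - r0)) ^+ 2 =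
   a * (1 - 2 * a) * (r2 - r1) ^+ 2 + b * (1 - 2 * b) * (r1 - r0) ^+ 2 +
   (a * (r2 - r1) + b * (r1 - r0)) ^+ 2 by ring.
have ha : 0 <= a * (1 - 2 * a) by rewrite mulr_ge0 // subr_ge0; lra.
have hb : 0 <= b * (1 - 2 * b) by rewrite mulr_ge0 // subr_ge0; lra.
apply: addr_ge0 (sqr_ge0 _); apply: addr_ge0; apply: mulr_ge0 => //; exact: sqr_ge0.
Qed.

Definition suppZ (A : nat) (w : int -> R) := forall j, (A < `|j|)%N -> w j = 0.

Lemma suppZ_speed A w : suppZ A w -> suppZ A.+1 (speed w).
Proof.
move=> hw j hj; rewrite /speed /diff2 !hw ?mulr0 ?subr0 ?addr0 ?mul0r //; lia.
Qed.

Lemma suppZ_dspeed A w : suppZ A w -> suppZ A.+2 (dspeed w).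
Proof.
by move=> /suppZ_speed hw j hj; rewrite /dspeed !hw ?subr0 //; lia.
Qed.

Lemma suppZ_euler A w0 n : suppZ A w0 -> suppZ (A + n) (euler w0 n).
Proof.
move=> hw; elim: n => [|n IH]; first by rewrite addn0.
move=> j hj; rewrite /= /euler_step (IH j) ?(suppZ_speed IH) ?mulr0 ?addr0 //; lia.
Qed.

(** The sum of squares does not increase, since the fluxes vanish outside the support. A single term
    is at most the sum, and the initial sum has at most [2 (A + 2) + 1] nonzero terms. *)
Lemma dspeed_euler_sqr_le A w0 c : suppZ A w0 -> (forall j, `|dspeed w0 j| <= c) ->
  forall n j, dspeed (euler w0 n) j ^+ 2 <= (2 * A.+2 + 1)%:R * c ^+ 2.
Proof.
move=> hw hc n j.
have c0 : 0 <= c by exact: le_trans (normr_ge0 _) (hc 0).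
have hn m : suppZ (A + m).+2 (dspeed (euler w0 m)) by exact/suppZ_dspeed/suppZ_euler.
case: (leqP `|j| (A + n).+2) => hj; last first.
  by rewrite hn // expr0n mulr_ge0 // sqr_ge0.
(* One more than the support of the increments at step [n], so that the flux vanishes at both ends,
   [S + 1] and [- S]. *)
pose S := (A + n).+3.
have hS m : (m <= n)%N -> sumZ S (fun j => dspeed (euler w0 m) j ^+ 2) <=
    sumZ S (fun j => dspeed w0 j ^+ 2).
  elim: m => // m IH mn; apply: le_trans (IH (ltnW mn)).
  have [F [F0 hF]] := dspeed_energy (euler w0 m).
  apply: le_trans (sumZ_le S hF) _.
  by rewrite sumZD sumZ_telescope !F0 ?subr0 ?addr0 // hn // /S; lia.
apply: (@le_trans _ _ (sumZ S (fun j => dspeed (euler w0 n) j ^+ 2))).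
  apply: (sumZ_term (f := fun j => dspeed (euler w0 n) j ^+ 2)) => [i|]; first exact: sqr_ge0.
  by rewrite /S; lia.
apply: le_trans (hS n (leqnn _)) _.
apply: sumZ_support => [|i hi|i]; first by rewrite /S; lia.
  by rewrite (suppZ_dspeed hw) ?expr0n.
by rewrite -real_normK ?num_real // lerXn2r ?nnegrE.
Qed.

Lemma speed_time_le w rho : (forall j, `|dspeed w j| <= rho) ->
  forall j, `|speed (euler_step w) j - speed w j| <= rho.
Proof.
move=> hr j; have [kap hkap hq] := speed_step w.
have /andP[k0 k1] := hkap j.
rewrite hq addrAC subrr add0r normrM ger0_norm //.
have h := ler_normB (dspeed w j) (dspeed w (j - 1)).
have h1 := hr j; have h2 := hr (j - 1).
have h3 : `|dspeed w j - dspeed w (j - 1)| <= 2 * rho by lra.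
apply: le_trans (ler_pM k0 (normr_ge0 _) k1 h3) _; lra.
Qed.

Lemma speed_space_le w rho : (forall j, `|dspeed w j| <= rho) ->
  forall j (i : nat), `|speed w (j + i%:Z) - speed w j| <= i%:R * rho.
Proof.
move=> hr j; elim => [|i IH]; first by rewrite addr0 subrr normr0 mul0r.
have -> : j + i.+1%:Z = j + i%:Z + 1 by lia.
have := hr (j + i%:Z); rewrite /dspeed => h.
rewrite -natr1 mulrDl mul1r.
apply: le_trans (lerD IH h); rewrite addrC.
apply: le_trans (ler_normD _ _); rewrite le_eqVlt; apply/orP; left; apply/eqP.
by congr (`| _ |); ring.
Qed.

End scheme.

(** * Moving averages of the initial datum *)

Section moving_average.
Context (R : realFieldType) (m : nat).
Hypothesis m_gt0 : (0 < m)%N.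

Definition maverage (g : int -> R) (j : int) : R :=
  (\sum_(i < m) g (j + i%:Z)) / m%:R.

Let mR_gt0 : 0 < m%:R :> R. Proof. by rewrite ltr0n. Qed.

Lemma maverage_diff g j : maverage g (j + 1) - maverage g j =
  (g (j + m%:Z) - g j) / m%:R.
Proof.
rewrite /maverage -mulrBl; congr (_ / _).
rewrite -sumrB.
transitivity (\sum_(i < m) (g (j + i.+1%:Z) - g (j + i%:Z))).
  by apply: eq_bigr => i _; congr (g _ - _); lia.
by rewrite -(big_mkord xpredT (fun i => g (j + i.+1%:Z) - g (j + i%:Z))) telescope_sumr // addr0.
Qed.

Lemma maverage_near g j v c : (forall i : nat, (i < m)%N -> `|g (j + i%:Z) - v| <= c) ->
  `|maverage g j - v| <= c.
Proof.
move=> hg; have -> : maverage g j - v = (\sum_(i < m) (g (j + i%:Z) - v)) / m%:R.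
  rewrite sumrB sumr_const card_ord mulrBl; congr (_ - _).
  by rewrite -[v *+ m]mulr_natr mulfK // gt_eqF.
rewrite normrM [`|_^-1|]gtr0_norm ?invr_gt0 // ler_pdivrMr //.
apply: le_trans (ler_norm_sum _ _ _) _.
apply: (@le_trans _ _ (\sum_(i < m) c)); first by apply: ler_sum => i _; exact: hg.
by rewrite sumr_const card_ord mulr_natr.
Qed.

Lemma maverage_bound g c : (forall j, `|g j| <= c) -> forall j, `|maverage g j| <= c.
Proof.
move=> hg j; rewrite -[X in `|X|]subr0; apply: maverage_near => i _.
by rewrite subr0.
Qed.

Lemma maverage_lip g L : (forall j (i : nat), `|g (j + i%:Z) - g j| <= L * i%:R) ->
  forall j (i : nat), `|maverage g (j + i%:Z) - maverage g j| <= L * i%:R.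
Proof.
move=> hg j i.
have -> : maverage g (j + i%:Z) = maverage (fun j => g (j + i%:Z)) j.
  by rewrite /maverage; congr (_ / _); apply: eq_bigr => l _; congr g; lia.
have -> : maverage (fun j => g (j + i%:Z)) j - maverage g j =
  maverage (fun j => g (j + i%:Z) - g j) j.
  by rewrite /maverage -mulrBl sumrB.
exact: maverage_bound.
Qed.

Lemma maverage_dist g L : 0 <= L ->
  (forall j (i : nat), `|g (j + i%:Z) - g j| <= L * i%:R) ->
  forall j, `|maverage g j - g j| <= L * m%:R.
Proof.
move=> L0 hg j; apply: maverage_near => i im.
by apply: le_trans (hg j i) _; rewrite ler_wpM2l // ler_nat ltnW.
Qed.

Lemma suppZ_maverage A g : suppZ A g -> suppZ (A + m) (maverage g).
Proof.
move=> hg j hj; rewrite /maverage big1 ?mul0r // => i _.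
by apply: hg; have := ltn_ord i; lia.
Qed.

(* The third differences of a triple average of width [m] are O(m^-3), with no
   regularity assumed on [g]. *)
Definition triple_average g := maverage (maverage (maverage g)).

Let D (f : int -> R) j := f (j + 1) - f j.
Let B (f : int -> R) j := (f (j + m%:Z) - f j) / m%:R.

Let DA f : D (maverage f) = B f.
Proof. by apply/funext => j; exact: maverage_diff. Qed.

Let DB f : D (B f) = B (D f).
Proof.
apply/funext => j; rewrite /D /B (_ : j + 1 + m%:Z = j + m%:Z + 1); last lia.
by rewrite -mulrBl; congr (_ / _); ring.
Qed.

Let B_le f c : (forall j, `|f j| <= c) -> forall j, `|B f j| <= 2 * c / m%:R.
Proof.
move=> hf j; rewrite normrM [`|_^-1|]gtr0_norm ?invr_gt0 //.
rewrite ler_wpM2r ?invr_ge0 ?(ltW mR_gt0) //.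
by have := ler_normB (f (j + m%:Z)) (f j); have := hf j; have := hf (j + m%:Z); lra.
Qed.

Lemma triple_average_diff2 g c : (forall j, `|g j| <= c) ->
  forall j, `|diff2 (triple_average g) j| <= 4 * c / m%:R ^+ 2.
Proof.
move=> hg j.
have -> : diff2 (triple_average g) j = D (D (triple_average g)) (j - 1).
  by rewrite /D /diff2 (subrK 1 j); ring.
rewrite /triple_average DA DB DA.
have -> : 4 * c / m%:R ^+ 2 = 2 * (2 * c / m%:R) / m%:R.
  by field; rewrite gt_eqF.
by do 2!apply: B_le; exact: maverage_bound.
Qed.

(** An average turns a unit difference into the quotient [(g (j + m) - g j) / m], and these
    quotients commute with differences, so three averages absorb three differences. The increment of
    [diff2] from [j] to [j + 1] is the third difference based at [j - 1]. *)
Lemma triple_average_diff3 g c : (forall j, `|g j| <= c) ->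
  forall j, `|diff2 (triple_average g) (j + 1) - diff2 (triple_average g) j| <= 8 * c / m%:R ^+ 3.
Proof.
move=> hg j.
have -> : diff2 (triple_average g) (j + 1) - diff2 (triple_average g) j =
    D (D (D (triple_average g))) (j - 1).
  by rewrite /D /diff2 (subrK 1 j) (addrK 1 j); ring.
rewrite /triple_average DA DB DA !DB DA.
have -> : 8 * c / m%:R ^+ 3 = 2 * (2 * (2 * c / m%:R) / m%:R) / m%:R.
  by field; rewrite gt_eqF.
by do 3!apply: B_le.
Qed.

End moving_average.

(** * B-splines in time and space *)

Section splines.
Context (R : realType).
Implicit Types x s t e : R.

(** Truncated powers [x_+^n / n!], each the derivative of the next; the B-splines below are their
    finite differences. *)
Definition tp1 x := Num.max x 0.
Definition tp2 x := Num.max x 0 ^+ 2 / 2.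
Definition tp3 x := Num.max x 0 ^+ 3 / 6.

Lemma tp_neg x : x <= 0 -> [/\ tp1 x = 0, tp2 x = 0 & tp3 x = 0].
Proof. by move=> x0; rewrite /tp1 /tp2 /tp3 max_r // !expr0n /= !mul0r. Qed.

Lemma tp_pos x : 0 <= x -> [/\ tp1 x = x, tp2 x = x ^+ 2 / 2 & tp3 x = x ^+ 3 / 6].
Proof. by move=> x0; rewrite /tp1 /tp2 /tp3 max_l. Qed.

(** Each truncated power is replaced by zero or by its polynomial, whichever sign of the argument
    [lra] can derive from the context. *)
Ltac eval_tp := repeat match goal with
  | |- context [tp1 ?x] => first [have [-> _ _] := @tp_neg x ltac:(lra)
                                 |have [-> _ _] := @tp_pos x ltac:(lra)]
  | |- context [tp2 ?x] => first [have [_ -> _] := @tp_neg x ltac:(lra)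
                                 |have [_ -> _] := @tp_pos x ltac:(lra)]
  | |- context [tp3 ?x] => first [have [_ _ ->] := @tp_neg x ltac:(lra)
                                 |have [_ _ ->] := @tp_pos x ltac:(lra)]
  end.

Lemma tp1_lip x e : `|tp1 (x + e) - tp1 x| <= `|e|.
Proof.
rewrite /tp1; case: (lerP x 0) => h1; case: (lerP (x + e) 0) => h2;
  rewrite ?subr0 ?sub0r ?subrr ?normr0 //; case: (ler0P e) => he;
  rewrite ler_norml; lra.
Qed.

Lemma tp2_taylor x e : `|tp2 (x + e) - tp2 x - e * tp1 x| <= e ^+ 2.
Proof.
have e2 := sqr_ge0 e.
case: (leP x 0) => h1; case: (leP (x + e) 0) => h2.
- have [-> -> _] := tp_neg h1; have [_ -> _] := tp_neg h2.
  by rewrite mulr0 !subr0 normr0.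
- have [-> -> _] := tp_neg h1; have [_ -> _] := tp_pos (ltW h2).
  have : (x + e) ^+ 2 <= e ^+ 2 by rewrite lerXn2r ?nnegrE //; lra.
  have := sqr_ge0 (x + e).
  by rewrite mulr0 !subr0 ler_norml; lra.
- have [-> -> _] := tp_pos (ltW h1); have [_ -> _] := tp_neg h2.
  have : (- (x + e)) ^+ 2 <= (- e) ^+ 2 by rewrite lerXn2r ?nnegrE //; lra.
  have := sqr_ge0 (x + e); rewrite !sqrrN ler_norml; lra.
- have [-> -> _] := tp_pos (ltW h1); have [_ -> _] := tp_pos (ltW h2).
  by rewrite ler_norml; lra.
Qed.

Lemma tp3_taylor x e :
  `|tp3 (x + e) - tp3 x - e * tp2 x - e ^+ 2 / 2 * tp1 x| <= `|e| ^+ 3.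
Proof.
have e3 : 0 <= `|e| ^+ 3 by rewrite exprn_ge0.
have cube_le (a : R) : 0 <= a -> a <= `|e| -> a ^+ 3 <= `|e| ^+ 3.
  by move=> a0 ae; rewrite lerXn2r ?nnegrE.
case: (leP x 0) => h1; case: (leP (x + e) 0) => h2.
- have [-> -> ->] := tp_neg h1; have [_ _ ->] := tp_neg h2.
  by rewrite !mulr0 !subr0 normr0.
- have [-> -> ->] := tp_neg h1; have [_ _ ->] := tp_pos (ltW h2).
  have h : (x + e) ^+ 3 <= `|e| ^+ 3.
    by apply: cube_le; [exact: ltW|apply: le_trans (ler_norm e); lra].
  have h' : 0 <= (x + e) ^+ 3 by rewrite exprn_ge0 // ltW.
  by rewrite !mulr0 !subr0 ler_norml; lra.
- have [-> -> ->] := tp_pos (ltW h1); have [_ _ ->] := tp_neg h2.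
  have e0 : e < 0 by lra.
  have h : (- (x + e)) ^+ 3 <= `|e| ^+ 3.
    by apply: cube_le; [lra|rewrite ltr0_norm //; lra].
  have h' : 0 <= (- (x + e)) ^+ 3 by rewrite exprn_ge0 //; lra.
  have -> : 0 - x ^+ 3 / 6 - e * (x ^+ 2 / 2) - e ^+ 2 / 2 * x =
    ((- (x + e)) ^+ 3 + e ^+ 3) / 6 by field.
  move: e3 h; rewrite ltr0_norm // => e3 h.
  have -> : e ^+ 3 = - (- e) ^+ 3 by ring.
  by rewrite ler_norml; lra.
- have [-> -> ->] := tp_pos (ltW h1); have [_ _ ->] := tp_pos (ltW h2).
  have -> : (x + e) ^+ 3 / 6 - x ^+ 3 / 6 - e * (x ^+ 2 / 2) - e ^+ 2 / 2 * x =
    e ^+ 3 / 6 by field.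
  by rewrite normrM normrX [`|6^-1|]ger0_norm //; lra.
Qed.

(* The uniform quadratic and cubic B-splines, with integer knots from 0, and
   their derivatives. *)
Definition quad s := tp2 s - 3 * tp2 (s - 1) + 3 * tp2 (s - 2) - tp2 (s - 3).
Definition quad1 s := tp1 s - 3 * tp1 (s - 1) + 3 * tp1 (s - 2) - tp1 (s - 3).
Definition cub s :=
  tp3 s - 4 * tp3 (s - 1) + 6 * tp3 (s - 2) - 4 * tp3 (s - 3) + tp3 (s - 4).
Definition cub1 s :=
  tp2 s - 4 * tp2 (s - 1) + 6 * tp2 (s - 2) - 4 * tp2 (s - 3) + tp2 (s - 4).
Definition cub2 s :=
  tp1 s - 4 * tp1 (s - 1) + 6 * tp1 (s - 2) - 4 * tp1 (s - 3) + tp1 (s - 4).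

Lemma spline_le0 s : s <= 0 ->
  [/\ quad s = 0, quad1 s = 0, cub s = 0, cub1 s = 0 & cub2 s = 0].
Proof.
move=> s0; rewrite /quad /quad1 /cub /cub1 /cub2.
eval_tp.
split; ring.
Qed.

Lemma quad_ge3 s : 3 <= s -> quad s = 0 /\ quad1 s = 0.
Proof.
move=> s0; rewrite /quad /quad1.
eval_tp.
split; by field.
Qed.

Lemma cub_ge4 s : 4 <= s -> [/\ cub s = 0, cub1 s = 0 & cub2 s = 0].
Proof.
move=> s0; rewrite /cub /cub1 /cub2.
eval_tp.
split; by field.
Qed.

Lemma quad_values s : 0 <= s <= 1 ->
  [/\ quad s = s ^+ 2 / 2, quad (s + 1) = (1 + 2 * s - 2 * s ^+ 2) / 2 &
      quad (s + 2) = (1 - s) ^+ 2 / 2].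
Proof.
move=> /andP[s0 s1]; rewrite /quad.
eval_tp.
split; by field.
Qed.

Lemma quad1_values s : 0 <= s <= 1 ->
  [/\ quad1 s = s, quad1 (s + 1) = 1 - 2 * s & quad1 (s + 2) = s - 1].
Proof.
move=> /andP[s0 s1]; rewrite /quad1.
eval_tp.
split; ring.
Qed.

Lemma cub_values s : 0 <= s <= 1 ->
  [/\ cub s = s ^+ 3 / 6, cub (s + 1) = (1 + 3 * s + 3 * s ^+ 2 - 3 * s ^+ 3) / 6,
      cub (s + 2) = (4 - 6 * s ^+ 2 + 3 * s ^+ 3) / 6 &
      cub (s + 3) = (1 - s) ^+ 3 / 6].
Proof.
move=> /andP[s0 s1]; rewrite /cub.
eval_tp.
split; by field.
Qed.

Lemma cub2_values s : 0 <= s <= 1 ->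
  [/\ cub2 s = s, cub2 (s + 1) = 1 - 3 * s, cub2 (s + 2) = 3 * s - 2 &
      cub2 (s + 3) = 1 - s].
Proof.
move=> /andP[s0 s1]; rewrite /cub2.
eval_tp.
split; ring.
Qed.

(* C^{1,1} and C^{2,1} functions with bounded derivatives, in Taylor form. *)
Definition smooth2 (T T1 : R -> R) := exists2 C, 0 <= C & forall t,
  [/\ `|T t| <= C, `|T1 t| <= C & forall e,
  [/\ `|T (t + e) - T t| <= C * `|e|, `|T1 (t + e) - T1 t| <= C * `|e| &
      `|T (t + e) - T t - e * T1 t| <= C * e ^+ 2]].

Definition smooth3 (X X1 X2 : R -> R) := exists2 C, 0 <= C & forall x,
  [/\ `|X x| <= C, `|X1 x| <= C, `|X2 x| <= C & forall e,
  [/\ `|X (x + e) - X x| <= C * `|e|, `|X1 (x + e) - X1 x| <= C * `|e|,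
      `|X2 (x + e) - X2 x| <= C * `|e|,
      `|X1 (x + e) - X1 x - e * X2 x| <= C * e ^+ 2 &
      `|X (x + e) - X x - e * X1 x - e ^+ 2 / 2 * X2 x| <= C * `|e| ^+ 3]].

Lemma quad1_lip s e : `|quad1 (s + e) - quad1 s| <= 8 * `|e|.
Proof.
have h0 := tp1_lip s e; have h1 := tp1_lip (s - 1) e.
have h2 := tp1_lip (s - 2) e; have h3 := tp1_lip (s - 3) e.
move: h0 h1 h2 h3; rewrite /quad1 ![s - _ + e]addrAC !ler_norml; lra.
Qed.

Lemma quad_taylor s e : `|quad (s + e) - quad s - e * quad1 s| <= 8 * e ^+ 2.
Proof.
have h0 := tp2_taylor s e; have h1 := tp2_taylor (s - 1) e.
have h2 := tp2_taylor (s - 2) e; have h3 := tp2_taylor (s - 3) e.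
move: h0 h1 h2 h3; rewrite /quad /quad1 ![s - _ + e]addrAC !ler_norml; lra.
Qed.

Lemma cub2_lip s e : `|cub2 (s + e) - cub2 s| <= 16 * `|e|.
Proof.
have h0 := tp1_lip s e; have h1 := tp1_lip (s - 1) e.
have h2 := tp1_lip (s - 2) e; have h3 := tp1_lip (s - 3) e.
have h4 := tp1_lip (s - 4) e.
move: h0 h1 h2 h3 h4; rewrite /cub2 ![s - _ + e]addrAC !ler_norml; lra.
Qed.

Lemma cub1_taylor s e : `|cub1 (s + e) - cub1 s - e * cub2 s| <= 16 * e ^+ 2.
Proof.
have h0 := tp2_taylor s e; have h1 := tp2_taylor (s - 1) e.
have h2 := tp2_taylor (s - 2) e; have h3 := tp2_taylor (s - 3) e.
have h4 := tp2_taylor (s - 4) e.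
move: h0 h1 h2 h3 h4; rewrite /cub1 /cub2 ![s - _ + e]addrAC !ler_norml; lra.
Qed.

Lemma cub_taylor s e :
  `|cub (s + e) - cub s - e * cub1 s - e ^+ 2 / 2 * cub2 s| <= 16 * `|e| ^+ 3.
Proof.
have h0 := tp3_taylor s e; have h1 := tp3_taylor (s - 1) e.
have h2 := tp3_taylor (s - 2) e; have h3 := tp3_taylor (s - 3) e.
have h4 := tp3_taylor (s - 4) e.
move: h0 h1 h2 h3 h4; rewrite /cub /cub1 /cub2 ![s - _ + e]addrAC !ler_norml; lra.
Qed.

Lemma lip_of_bound (f : R -> R) (a b c : R) : 0 <= a -> 0 <= b ->
  (forall s, `|f s| <= a) ->
  (forall s e, `|e| <= 1 -> `|f (s + e) - f s| <= b * `|e|) ->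
  forall s e, `|f (s + e) - f s| <= (2 * a + b) * `|e|.
Proof.
move=> a0 b0 fa fb s e; case: (leP `|e| 1) => he.
  by apply: le_trans (fb s e he) _; rewrite ler_wpM2r // lerDr mulr_ge0.
apply: (@le_trans _ _ (2 * a)).
  by have := ler_normB (f (s + e)) (f s); have := fa (s + e); have := fa s; lra.
have : 2 * a <= 2 * a * `|e| by rewrite ler_peMr ?mulr_ge0 // ltW.
have : 0 <= b * `|e| by rewrite mulr_ge0.
lra.
Qed.

Lemma quad_smooth2 : smooth2 quad quad1.
Proof.
have b1 s : `|quad1 s| <= 24.
  case: (leP s 0) => s0; first by have [_ -> _ _ _] := spline_le0 s0; rewrite normr0; lra.
  case: (leP 3 s) => s3; first by have [_ ->] := quad_ge3 s3; rewrite normr0; lra.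
  have := quad1_lip 0 s; have [_ -> _ _ _] := spline_le0 (lexx (0 : R)).
  by rewrite add0r subr0 (gtr0_norm s0); lra.
have b0 s : `|quad s| <= 72.
  case: (leP s 0) => s0; first by have [-> _ _ _ _] := spline_le0 s0; rewrite normr0; lra.
  case: (leP 3 s) => s3; first by have [-> _] := quad_ge3 s3; rewrite normr0; lra.
  have := quad_taylor 0 s; have [-> -> _ _ _] := spline_le0 (lexx (0 : R)).
  rewrite add0r mulr0 !subr0 => h; apply: le_trans h _.
  have : s ^+ 2 <= 3 ^+ 2 by rewrite lerXn2r ?nnegrE //; lra.
  lra.
have l0 s e : `|e| <= 1 -> `|quad (s + e) - quad s| <= 32 * `|e|.
  move=> he; have := quad_taylor s e; have := b1 s.
  have -> : e ^+ 2 = `|e| ^+ 2 by rewrite real_normK ?num_real.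
  have e0 := normr_ge0 e => h1 h2.
  have := ler_normD (quad (s + e) - quad s - e * quad1 s) (e * quad1 s).
  rewrite subrK normrM.
  have := ler_wpM2l e0 h1; have := ler_wpM2l e0 he; rewrite -expr2; lra.
have l0' := lip_of_bound 0 (ltac:(lra) : (0 : R) <= 72) (ltac:(lra) : (0 : R) <= 32) b0 l0.
exists 200; first lra.
move=> t; split.
- by apply: le_trans (b0 t) _; lra.
- by apply: le_trans (b1 t) _; lra.
move=> e; have e0 := normr_ge0 e; have e2 := sqr_ge0 e; split.
- by apply: le_trans (l0' t e) _; lra.
- by apply: le_trans (quad1_lip t e) _; lra.
- by apply: le_trans (quad_taylor t e) _; lra.
Qed.

Lemma cub_smooth3 : smooth3 cub cub1 cub2.
Proof.
have [_ _ c0 c10 c20] := spline_le0 (lexx (0 : R)).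
have b2 s : `|cub2 s| <= 64.
  case: (leP s 0) => s0; first by have [_ _ _ _ ->] := spline_le0 s0; rewrite normr0; lra.
  case: (leP 4 s) => s3; first by have [_ _ ->] := cub_ge4 s3; rewrite normr0; lra.
  have := cub2_lip 0 s; rewrite c20.
  by rewrite add0r subr0 (gtr0_norm s0); lra.
have b1 s : `|cub1 s| <= 256.
  case: (leP s 0) => s0; first by have [_ _ _ -> _] := spline_le0 s0; rewrite normr0; lra.
  case: (leP 4 s) => s3; first by have [_ -> _] := cub_ge4 s3; rewrite normr0; lra.
  have := cub1_taylor 0 s; rewrite c10 c20.
  rewrite add0r mulr0 !subr0 => h; apply: le_trans h _.
  have : s ^+ 2 <= 4 ^+ 2 by rewrite lerXn2r ?nnegrE //; lra.
  lra.
have b0 s : `|cub s| <= 1024.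
  case: (leP s 0) => s0; first by have [_ _ -> _ _] := spline_le0 s0; rewrite normr0; lra.
  case: (leP 4 s) => s3; first by have [-> _ _] := cub_ge4 s3; rewrite normr0; lra.
  have := cub_taylor 0 s; rewrite c0 c10 c20.
  rewrite add0r !mulr0 !subr0 (gtr0_norm s0) => h; apply: le_trans h _.
  have : s ^+ 3 <= 4 ^+ 3 by rewrite lerXn2r ?nnegrE //; lra.
  lra.
have l1 s e : `|e| <= 1 -> `|cub1 (s + e) - cub1 s| <= 80 * `|e|.
  move=> he; have := cub1_taylor s e; have := b2 s.
  have -> : e ^+ 2 = `|e| ^+ 2 by rewrite real_normK ?num_real.
  have e0 := normr_ge0 e => h1 h2.
  have := ler_normD (cub1 (s + e) - cub1 s - e * cub2 s) (e * cub2 s).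
  rewrite subrK normrM.
  have := ler_wpM2l e0 h1; have := ler_wpM2l e0 he; rewrite -expr2; lra.
have l0 s e : `|e| <= 1 -> `|cub (s + e) - cub s| <= 336 * `|e|.
  move=> he; have := cub_taylor s e; have := b2 s; have := b1 s.
  have e0 := normr_ge0 e => h0 h1 h2.
  have h3 := ler_normD (cub (s + e) - cub s - e * cub1 s - e ^+ 2 / 2 * cub2 s) (e ^+ 2 / 2 * cub2 s).
  have h4 := ler_normD (cub (s + e) - cub s - e * cub1 s) (e * cub1 s).
  have n1 : `|e ^+ 2 / 2 * cub2 s| = `|e| ^+ 2 / 2 * `|cub2 s|.
    by rewrite [LHS]normrM (@ger0_norm _ (e ^+ 2 / 2)) ?divr_ge0 ?sqr_ge0 // real_normK ?num_real.
  move: h3 h4; rewrite !subrK n1 [`|e * cub1 s|]normrM => h3 h4.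
  have ee : `|e| ^+ 2 <= `|e| by rewrite expr2 ler_piMr.
  have eee : `|e| ^+ 3 <= `|e|.
    by rewrite exprS; apply: le_trans (ler_wpM2l e0 ee) _; rewrite -expr2.
  have := ler_wpM2l e0 h0.
  have := ler_wpM2l (sqr_ge0 `|e|) h1.
  lra.
have l0' := lip_of_bound 0 (ltac:(lra) : (0 : R) <= 1024) (ltac:(lra) : (0 : R) <= 336) b0 l0.
have l1' := lip_of_bound 0 (ltac:(lra) : (0 : R) <= 256) (ltac:(lra) : (0 : R) <= 80) b1 l1.
exists 4000; first lra.
move=> t; split.
- by apply: le_trans (b0 t) _; lra.
- by apply: le_trans (b1 t) _; lra.
- by apply: le_trans (b2 t) _; lra.
move=> e; have e0 := normr_ge0 e; have e2 := sqr_ge0 e.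
have e3 : 0 <= `|e| ^+ 3 by rewrite exprn_ge0.
split.
- by apply: le_trans (l0' t e) _; lra.
- by apply: le_trans (l1' t e) _; lra.
- by apply: le_trans (cub2_lip t e) _; lra.
- by apply: le_trans (cub1_taylor t e) _; lra.
- by apply: le_trans (cub_taylor t e) _; lra.
Qed.

Lemma smooth2_affine T T1 a b : smooth2 T T1 ->
  smooth2 (fun t => T (a * t + b)) (fun t => a * T1 (a * t + b)).
Proof.
move=> [C C0 h]; pose m := 1 + `|a| + `|a| ^+ 2.
have a0 := normr_ge0 a; have a2 := sqr_ge0 `|a|.
have m1 : 1 <= m by rewrite /m; lra.
have ma : `|a| <= m by rewrite /m; lra.
have ma2 : `|a| ^+ 2 <= m by rewrite /m; lra.
exists (m * C) => [|t]; first by rewrite mulr_ge0 //; lra.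
have [h0 h1 h2] := h (a * t + b); split.
- by apply: le_trans h0 _; rewrite ler_peMl.
- by rewrite normrM ler_pM.
move=> e; have [g0 g1 g2] := h2 (a * e).
have -> : a * (t + e) + b = a * t + b + a * e by ring.
have e0 := normr_ge0 e; have e2 := sqr_ge0 e; split.
- apply: le_trans g0 _; rewrite normrM mulrA [m * C]mulrC.
  by rewrite ler_wpM2r // ler_wpM2l.
- rewrite -mulrBr normrM; apply: le_trans (ler_wpM2l a0 g1) _.
  rewrite normrM [leLHS](_ : _ = `|a| ^+ 2 * (C * `|e|)); last by ring.
  by rewrite -[leRHS]mulrA ler_wpM2r // mulr_ge0.
- rewrite (_ : e * (a * T1 (a * t + b)) = a * e * T1 (a * t + b)); last by ring.
  apply: le_trans g2 _; rewrite exprMn -[a ^+ 2]real_normK ?num_real //.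
  rewrite [leLHS](_ : _ = `|a| ^+ 2 * (C * e ^+ 2)); last by ring.
  by rewrite -[leRHS]mulrA ler_wpM2r // mulr_ge0.
Qed.

Lemma smooth3_affine X X1 X2 a b : smooth3 X X1 X2 ->
  smooth3 (fun t => X (a * t + b)) (fun t => a * X1 (a * t + b))
          (fun t => a ^+ 2 * X2 (a * t + b)).
Proof.
move=> [C C0 h]; pose m := 1 + `|a| + `|a| ^+ 2 + `|a| ^+ 3.
have a0 := normr_ge0 a; have a2 := sqr_ge0 `|a|.
have a3 : 0 <= `|a| ^+ 3 by rewrite exprn_ge0.
have m1 : 1 <= m by rewrite /m; lra.
have ma : `|a| <= m by rewrite /m; lra.
have ma2 : `|a| ^+ 2 <= m by rewrite /m; lra.
have ma3 : `|a| ^+ 3 <= m by rewrite /m; lra.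
exists (m * C) => [|t]; first by rewrite mulr_ge0 //; lra.
have [h0 h1 h2 h3] := h (a * t + b); split.
- by apply: le_trans h0 _; rewrite ler_peMl.
- by rewrite normrM ler_pM.
- by rewrite normrM normrX ler_pM.
move=> e; have [g0 g1 g2 g3 g4] := h3 (a * e).
have -> : a * (t + e) + b = a * t + b + a * e by ring.
have e0 := normr_ge0 e; have e2 := sqr_ge0 e.
have e3 : 0 <= `|e| ^+ 3 by rewrite exprn_ge0.
split.
- apply: le_trans g0 _; rewrite normrM mulrA [m * C]mulrC.
  by rewrite ler_wpM2r // ler_wpM2l.
- rewrite -mulrBr normrM; apply: le_trans (ler_wpM2l a0 g1) _.
  rewrite normrM [leLHS](_ : _ = `|a| ^+ 2 * (C * `|e|)); last by ring.
  by rewrite -[leRHS]mulrA ler_wpM2r // mulr_ge0.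
- rewrite -mulrBr normrM normrX; apply: le_trans (ler_wpM2l a2 g2) _.
  rewrite normrM [leLHS](_ : _ = `|a| ^+ 3 * (C * `|e|)); last by ring.
  by rewrite -[leRHS]mulrA ler_wpM2r // mulr_ge0.
- have -> : a * X1 (a * t + b + a * e) - a * X1 (a * t + b) -
     e * (a ^+ 2 * X2 (a * t + b)) = a * (X1 (a * t + b + a * e) - X1 (a * t + b) -
     a * e * X2 (a * t + b)) by ring.
  rewrite normrM; apply: le_trans (ler_wpM2l a0 g3) _.
  rewrite exprMn -[a ^+ 2]real_normK ?num_real //.
  rewrite [leLHS](_ : _ = `|a| ^+ 3 * (C * e ^+ 2)); last by ring.
  by rewrite -[leRHS]mulrA ler_wpM2r // mulr_ge0.
- have -> : e * (a * X1 (a * t + b)) = a * e * X1 (a * t + b) by ring.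
  have -> : e ^+ 2 / 2 * (a ^+ 2 * X2 (a * t + b)) = (a * e) ^+ 2 / 2 * X2 (a * t + b).
    by rewrite exprMn; ring.
  apply: le_trans g4 _; rewrite normrM exprMn.
  rewrite [leLHS](_ : _ = `|a| ^+ 3 * (C * `|e| ^+ 3)); last by ring.
  by rewrite -[leRHS]mulrA ler_wpM2r // mulr_ge0.
Qed.

End splines.
Arguments quad {R}.
Arguments quad1 {R}.
Arguments cub {R}.
Arguments cub1 {R}.
Arguments cub2 {R}.

Lemma big_support (R : realFieldType) (I : eqType) (l1 l2 : seq I) (F : I -> R) :
  uniq l1 -> uniq l2 -> (forall i, F i != 0 -> (i \in l1) = (i \in l2)) ->
  \sum_(i <- l1) F i = \sum_(i <- l2) F i.
Proof.
move=> u1 u2 h.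
have red l : \sum_(i <- l) F i = \sum_(i <- [seq i <- l | F i != 0]) F i.
  rewrite big_filter (bigID (fun i => F i != 0)) /= [X in _ + X]big1 ?addr0 //.
  by move=> i /negbNE/eqP.
rewrite (red l1) (red l2); apply: perm_big; apply: uniq_perm; rewrite ?filter_uniq //.
by move=> i; rewrite !mem_filter; case: eqP => //= /eqP /h.
Qed.

Definition window (S : nat) : seq int := [seq m%:Z - S%:Z | m <- iota 0 (2 * S + 1)].

Lemma window_uniq S : uniq (window S).
Proof. by rewrite map_inj_uniq ?iota_uniq // => m n /addIr [->]. Qed.

Lemma mem_window S j : (j \in window S) = (`|j| <= S)%N.
Proof.
apply/mapP/idP => [[m]|h].
  by rewrite mem_iota => /andP[_ hm] ->; lia.
exists (absz (j + S%:Z)); last by lia.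
by rewrite mem_iota; lia.
Qed.

Section local_sums.
Context (R : realType).

Lemma window_local (v f : int -> R) S j0 : suppZ S v ->
  (forall j, (j < j0 - 1) || (j0 + 2 < j) -> f j = 0) ->
  \sum_(j <- window S) v j * f j =
  v (j0 - 1) * f (j0 - 1) + v j0 * f j0 + v (j0 + 1) * f (j0 + 1) +
  v (j0 + 2) * f (j0 + 2).
Proof.
move=> hv hf.
rewrite (@big_support _ _ _ [:: j0 - 1; j0; j0 + 1; j0 + 2]) ?window_uniq //.
- by rewrite !big_cons big_nil addr0 !addrA.
- by rewrite /= !inE !negb_or; apply/and4P; split; do ?(apply/andP; split); lia.
move=> j hj; rewrite mem_window !inE.
have vj : (`|j| <= S)%N.
  by rewrite leqNgt; apply: contraNN hj => /hv ->; rewrite mul0r.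
rewrite vj; apply/esym.
have : ~~ ((j < j0 - 1) || (j0 + 2 < j)).
  by apply: contraNN hj => /hf ->; rewrite mulr0.
lia.
Qed.

Lemma iota_local (v f : nat -> R) N n0 : (n0 + 2 < N)%N ->
  (forall n, (n < n0)%N || (n0 + 2 < n)%N -> f n = 0) ->
  \sum_(n <- iota 0 N) v n * f n =
  v n0 * f n0 + v n0.+1 * f n0.+1 + v n0.+2 * f n0.+2.
Proof.
move=> hN hf.
rewrite (@big_support _ _ _ [:: n0; n0.+1; n0.+2]) ?iota_uniq //.
- by rewrite !big_cons big_nil addr0 !addrA.
- by rewrite /= !inE !negb_or; do ?(apply/andP; split); lia.
move=> j hj; rewrite mem_iota !inE.
have : ~~ ((j < n0)%N || (n0 + 2 < j)%N).
  by apply: contraNN hj => /hf ->; rewrite mulr0.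
lia.
Qed.

Lemma cubic_local (X : R -> R) (v : int -> R) S (j0 : int) (th : R) :
  (forall s, s <= 0 -> X s = 0) -> (forall s, 4 <= s -> X s = 0) ->
  suppZ S v -> 0 <= th < 1 ->
  \sum_(j <- window S) v j * X (j0%:~R + th + 2 - j%:~R) =
  v (j0 - 1) * X (th + 3) + v j0 * X (th + 2) + v (j0 + 1) * X (th + 1) +
  v (j0 + 2) * X th.
Proof.
move=> X0 X4 hv /andP[t0 t1].
rewrite (@window_local v (fun j => X (j0%:~R + th + 2 - j%:~R)) S j0) //.
  rewrite !rmorphD !rmorphN /= .
  congr (_ * X _ + _ * X _ + _ * X _ + _ * X _); ring.
move=> j /orP[hj|hj].
  apply: X4; have : (j + 2)%:~R <= j0%:~R :> R by rewrite ler_int; lia.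
  rewrite rmorphD /=; lra.
apply: X0; have : (j0 + 3)%:~R <= j%:~R :> R by rewrite ler_int; lia.
rewrite rmorphD /=; lra.
Qed.

Lemma quadratic_local (T : R -> R) (v : nat -> R) N (n0 : nat) (sg : R) :
  (forall s, s <= 0 -> T s = 0) -> (forall s, 3 <= s -> T s = 0) ->
  (n0 + 2 < N)%N -> 0 <= sg < 1 ->
  \sum_(n <- iota 0 N) v n * T (n0%:R + sg + 2 - n%:R) =
  v n0 * T (sg + 2) + v n0.+1 * T (sg + 1) + v n0.+2 * T sg.
Proof.
move=> T0 T3 hN /andP[t0 t1].
rewrite (@iota_local v (fun n => T (n0%:R + sg + 2 - n%:R)) N n0) //.
  by congr (_ * T _ + _ * T _ + _ * T _); rewrite ?mulrS -?natr1; ring.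
move=> n /orP[hn|hn].
  apply: T3; have : n.+1%:R <= n0%:R :> R by rewrite ler_nat.
  rewrite -natr1; lra.
apply: T0; have : (n0 + 3)%:R <= n%:R :> R by rewrite ler_nat; lia.
rewrite natrD; lra.
Qed.

End local_sums.

Lemma convex4 (R : realFieldType) (B0 B1 B2 B3 a0 a1 a2 a3 v c : R) :
  0 <= B0 -> 0 <= B1 -> 0 <= B2 -> 0 <= B3 -> B0 + B1 + B2 + B3 = 1 ->
  `|a0 - v| <= c -> `|a1 - v| <= c -> `|a2 - v| <= c -> `|a3 - v| <= c ->
  `|a0 * B0 + a1 * B1 + a2 * B2 + a3 * B3 - v| <= c.
Proof.
move=> h0 h1 h2 h3 hs g0 g1 g2 g3.
have -> : a0 * B0 + a1 * B1 + a2 * B2 + a3 * B3 - v =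
  (a0 - v) * B0 + (a1 - v) * B1 + (a2 - v) * B2 + (a3 - v) * B3.
  by rewrite -[X in _ - X]mulr1 -hs; ring.
have -> : c = c * B0 + c * B1 + c * B2 + c * B3 by rewrite -[LHS]mulr1 -hs; ring.
have aux a B : 0 <= B -> `|a| <= c -> `|a * B| <= c * B.
  by move=> B0' ha; rewrite normrM (ger0_norm B0') ler_wpM2r.
have := aux _ _ h0 g0; have := aux _ _ h1 g1; have := aux _ _ h2 g2.
have := aux _ _ h3 g3; rewrite !ler_norml; lra.
Qed.

Lemma monotone_le_convex (R : realFieldType) (G : R -> R) (x y z a b d c : R) :
  {homo G : u v / u <= v} -> 0 <= a -> 0 <= b -> 0 <= d -> a + b + d = 1 ->
  G x <= c -> G y <= c -> G z <= c -> G (a * x + b * y + d * z) <= c.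
Proof.
move=> Gm a0 b0 d0 abd hx hy hz.
pose m := Num.max x (Num.max y z).
have [mx my mz] : [/\ x <= m, y <= m & z <= m].
  by rewrite /m !le_max !lexx !orbT.
have Gc : G m <= c.
  by rewrite /m; case: (leP x (Num.max y z)) => _ //; case: (leP y z).
apply: le_trans Gc; apply: Gm.
have -> : m = a * m + b * m + d * m by rewrite -!mulrDl abd mul1r.
by rewrite !lerD // ler_wpM2l.
Qed.

Lemma monotone_ge_convex (R : realFieldType) (G : R -> R) (x y z a b d c : R) :
  {homo G : u v / u <= v} -> 0 <= a -> 0 <= b -> 0 <= d -> a + b + d = 1 ->
  c <= G x -> c <= G y -> c <= G z -> c <= G (a * x + b * y + d * z).
Proof.
move=> Gm a0 b0 d0 abd hx hy hz.
have Gm' : {homo (fun u => - G (- u)) : u v / u <= v}.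
  by move=> u v uv; rewrite lerN2; apply: Gm; rewrite lerN2.
have := @monotone_le_convex _ _ (- x) (- y) (- z) a b d (- c) Gm' a0 b0 d0 abd.
rewrite !opprK !lerN2 => /(_ hx hy hz).
by rewrite !mulrN -!opprD opprK.
Qed.

(** The points will be scaled second differences at neighbouring nodes, of which only the images
    under [G], the speeds, are known to be close. Monotonicity puts the value at a convex
    combination between the extreme images. *)
Lemma monotone_convex_near (R : realFieldType) (G : R -> R) (x y z a b d v c : R) :
  {homo G : u v / u <= v} -> 0 <= a -> 0 <= b -> 0 <= d -> a + b + d = 1 ->
  `|G x - v| <= c -> `|G y - v| <= c -> `|G z - v| <= c ->
  `|G (a * x + b * y + d * z) - v| <= c.
Proof.
move=> Gm a0 b0 d0 abd; rewrite !ler_norml => /andP[x1 x2] /andP[y1 y2] /andP[z1 z2].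
have h1 : v - c <= G (a * x + b * y + d * z).
  by apply: monotone_ge_convex => //; lra.
have h2 : G (a * x + b * y + d * z) <= v + c.
  by apply: monotone_le_convex => //; lra.
lra.
Qed.

Lemma int_shifts (j : int) :
  [/\ j - 1 + 1 = j, j - 1 + 2 = j + 1, j - 1 + 3 = j + 2 & j + 1 + 1 = j + 2].
Proof. by split; lia. Qed.

(** * Interpolation of the scheme *)

Section interpolation.
Context (R : realType).
Variables (G : R -> R) (Lam k : R).
Hypotheses (Lam_gt0 : 0 < Lam) (k_gt0 : 0 < k) (G0 : G 0 = 0).
Hypothesis G_slope : forall a b, exists2 c, 0 <= c <= Lam / 2 & G a - G b = c * (a - b).
Variables (w0 : int -> R) (A N : nat) (rho : R).
Hypothesis w0_supp : suppZ A w0.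

Let h := tstep Lam k.
Let w n := euler G Lam k w0 n.
Let S := (A + N)%N.

Hypothesis rho_bound : forall n j, `|dspeed G k (w n) j| <= rho.

Let h_gt0 : 0 < h. Proof. by rewrite divr_gt0 // exprn_gt0. Qed.

(** The shift by 2 places the nodes that contribute: in time the levels [n0, n0 + 1, n0 + 2] with
    [n0] the integer part of [t / h], all nonnegative for [t >= 0]; in space the nodes
    [j0 - 1, ..., j0 + 2] around [y / k]. *)
Definition spline_sum (T X : R -> R) (t y : R) : R :=
  \sum_(n <- iota 0 N) \sum_(j <- window S)
    w n j * T (t / h + 2 - n%:R) * X (y / k + 2 - j%:~R).

Let loc (X : R -> R) (v : int -> R) (j0 : int) (th : R) :=
  v (j0 - 1) * X (th + 3) + v j0 * X (th + 2) + v (j0 + 1) * X (th + 1) +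
  v (j0 + 2) * X th.

Lemma spline_sum_local (T X : R -> R) (t y : R) (n0 : nat) (sg : R) (j0 : int) (th : R) :
  (forall s, s <= 0 -> T s = 0) -> (forall s, 3 <= s -> T s = 0) ->
  (forall s, s <= 0 -> X s = 0) -> (forall s, 4 <= s -> X s = 0) ->
  t / h = n0%:R + sg -> y / k = j0%:~R + th -> (n0 + 2 < N)%N ->
  0 <= sg < 1 -> 0 <= th < 1 ->
  spline_sum T X t y = loc X (w n0) j0 th * T (sg + 2) +
    loc X (w n0.+1) j0 th * T (sg + 1) + loc X (w n0.+2) j0 th * T sg.
Proof.
move=> T0 T3 X0 X4 ht hy hn hs hth.
rewrite -(@quadratic_local _ T (fun n => loc X (w n) j0 th) N) // /spline_sum -ht.
rewrite big_seq [RHS]big_seq; apply: eq_bigr => n; rewrite mem_iota => /andP[_ nN].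
rewrite /loc -(@cubic_local _ X (w n) S) // -?hy.
  by rewrite mulr_suml; apply: eq_bigr => j _; ring.
move=> j hj; apply: (suppZ_euler Lam_gt0 k_gt0 G0 w0_supp).
by apply: leq_ltn_trans hj; rewrite leq_add2l ltnW.
Qed.

Let q n j := speed G k (w n) j.
Let z n j := diff2 (w n) j / k ^+ 2.

Let q_time n j : `|q n.+1 j - q n j| <= rho.
Proof. by apply: (speed_time_le Lam_gt0 k_gt0 G_slope) => i; exact: rho_bound. Qed.

Let q_near n0 j0 (i l : nat) : (i <= 2)%N ->
  `|q (n0 + i) (j0 + l%:Z) - q n0 j0| <= (l + 2)%:R * rho.
Proof.
move=> i2; have r0 : 0 <= rho by exact: le_trans (normr_ge0 _) (rho_bound 0 0).
have hs := speed_space_le Lam_gt0 k_gt0 (rho_bound n0) j0 l.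
have ht : `|q (n0 + i) (j0 + l%:Z) - q n0 (j0 + l%:Z)| <= 2 * rho.
  apply: (@le_trans _ _ (i%:R * rho)); last by rewrite ler_wpM2r // ler_nat.
  elim: i {i2} => [|i IH]; first by rewrite addn0 subrr normr0 mul0r.
  rewrite addnS -natr1 mulrDl mul1r.
  have := q_time (n0 + i) (j0 + l%:Z) => hq.
  by apply: le_trans (lerD IH hq); rewrite addrC; apply: le_trans (ler_normD _ _);
    rewrite le_eqVlt; apply/orP; left; apply/eqP; congr (`| _ |); ring.
rewrite natrD mulrDl.
apply: le_trans (lerD hs ht); rewrite addrC; apply: le_trans (ler_normD _ _).
by rewrite le_eqVlt; apply/orP; left; apply/eqP; congr (`| _ |); rewrite /q; ring.
Qed.

Let w_step n j : w n.+1 j = w n j + h * q n j. Proof. by []. Qed.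

Lemma cub_weights (th : R) : 0 <= th < 1 ->
  [/\ 0 <= cub (th + 3), 0 <= cub (th + 2), 0 <= cub (th + 1) & 0 <= cub th] /\
  cub (th + 3) + cub (th + 2) + cub (th + 1) + cub th = 1.
Proof.
move=> /andP[t0 t1]; have [-> -> -> ->] := @cub_values _ th ltac:(lra).
split; last by field.
have t3 : 0 <= th ^+ 3 by exact: exprn_ge0.
have u3 : 0 <= (1 - th) ^+ 3 by apply: exprn_ge0; lra.
have u : 0 <= th * (1 - th) by apply: mulr_ge0; lra.
have u' : 0 <= th * (1 - th) * th by apply: mulr_ge0; lra.
have u2 : 0 <= th * (1 - th) * (1 - th) by apply: mulr_ge0; lra.
split; rewrite divr_ge0 //; lra.
Qed.

Lemma quad_weights (sg : R) : 0 <= sg <= 1 ->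
  [/\ 0 <= quad (sg + 2), 0 <= quad (sg + 1) & 0 <= quad sg] /\
  quad (sg + 2) + quad (sg + 1) + quad sg = 1.
Proof.
move=> hsg; have [-> -> ->] := quad_values hsg; move/andP: hsg => [s0 s1].
split; last by field.
have u : 0 <= sg * (1 - sg) by apply: mulr_ge0; lra.
split; rewrite divr_ge0 ?sqr_ge0 //; lra.
Qed.

Lemma floor_decomp (x : R) : exists (j0 : int) (th : R), x = j0%:~R + th /\ 0 <= th < 1.
Proof.
exists (Num.floor x), (x - (Num.floor x)%:~R); rewrite subrKC; split=> //.
have := floor_itv x => /andP[h1 h2].
rewrite subr_ge0 h1 /=; move: h2; rewrite rmorphD /=; lra.
Qed.

Hypothesis G_mono : {homo G : u v / u <= v}.

(** The time derivative is a convex combination of speeds, because [quad1] takes differences of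
    consecutive levels. The second space derivative is a convex combination of the scaled second
    differences [z], because [cub2] takes second differences and interpolates them linearly, and [G]
    of each [z] is a speed. All these speeds are within [5 rho] of the one at [(n0, j0 - 1)]: at
    most two steps away in time and three in space. *)
Lemma spline_sum_equation (t y : R) : 0 <= t -> (Num.truncn (t / h) + 2 < N)%N ->
  `|h^-1 * spline_sum quad1 cub t y - G (k^-1 ^+ 2 * spline_sum quad cub2 t y)|
  <= 10 * rho.
Proof.
move=> t0 tN; have r0 : 0 <= rho by exact: le_trans (normr_ge0 _) (rho_bound 0 0).
have th0 : 0 <= t / h by rewrite divr_ge0 // ltW.
have /andP[hn0 hn1] := truncn_itv th0.
pose n0 := Num.truncn (t / h); rewrite -/n0 in tN hn0 hn1.
pose sg := t / h - n0%:R.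
have hsg : 0 <= sg < 1 by rewrite /sg; move: hn1; rewrite -natr1; lra.
have et : t / h = n0%:R + sg by rewrite /sg subrKC.
have [j0 [th [ey hth]]] := floor_decomp (y / k).
have [js1 js2 js3 js4] := int_shifts j0.
have spl := @spline_le0 R; have q3 := @quad_ge3 R; have c4 := @cub_ge4 R.
rewrite (@spline_sum_local quad1 cub t y n0 sg j0 th) //;
  try by move=> s; (move=> /spl[] || move=> /q3[] || move=> /c4[]).
rewrite (@spline_sum_local quad cub2 t y n0 sg j0 th) //;
  try by move=> s; (move=> /spl[] || move=> /q3[] || move=> /c4[]).
have hsg' : 0 <= sg <= 1 by lra.
have hth' : 0 <= th <= 1 by lra.
have [-> -> ->] := quad1_values hsg'.
have [[b3 b2 b1 b0] bs] := cub_weights hth.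
set Q := q n0 (j0 - 1).
have near (i l : nat) : (i <= 2)%N -> (l <= 3)%N ->
    `|q (n0 + i) (j0 - 1 + l%:Z) - Q| <= 5 * rho.
  move=> i2 l3; apply: le_trans (q_near n0 (j0 - 1) l i2) _.
  have l5 : (l + 2 <= 5)%N by rewrite (leq_add l3).
  by apply: ler_wpM2r => //; rewrite (ler_nat _ (l + 2) 5).
have comb (i l : nat) : (i <= 1)%N -> (l <= 3)%N ->
    `|(1 - sg) * q n0 (j0 - 1 + l%:Z) + sg * q n0.+1 (j0 - 1 + l%:Z) - Q| <= 5 * rho.
  move=> i1 l3; have := near 0%N l isT l3; have := near 1%N l isT l3.
  rewrite addn0 addn1 => h1 h0; move/andP: hsg => [s0 s1].
  have -> : (1 - sg) * q n0 (j0 - 1 + l%:Z) + sg * q n0.+1 (j0 - 1 + l%:Z) - Q =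
    (1 - sg) * (q n0 (j0 - 1 + l%:Z) - Q) + sg * (q n0.+1 (j0 - 1 + l%:Z) - Q) by ring.
  apply: le_trans (ler_normD _ _) _; rewrite !normrM (ger0_norm s0) ger0_norm; last lra.
  have s1' : 0 <= 1 - sg by lra.
  have := ler_wpM2l s0 h1; have := ler_wpM2l s1' h0; lra.
have -> : h^-1 * (loc cub (w n0) j0 th * (sg - 1) + loc cub (w n0.+1) j0 th * (1 - 2 * sg) +
     loc cub (w n0.+2) j0 th * sg) =
   ((1 - sg) * q n0 (j0 - 1 + 0%:Z) + sg * q n0.+1 (j0 - 1 + 0%:Z)) * cub (th + 3) +
   ((1 - sg) * q n0 (j0 - 1 + 1%:Z) + sg * q n0.+1 (j0 - 1 + 1%:Z)) * cub (th + 2) +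
   ((1 - sg) * q n0 (j0 - 1 + 2%:Z) + sg * q n0.+1 (j0 - 1 + 2%:Z)) * cub (th + 1) +
   ((1 - sg) * q n0 (j0 - 1 + 3%:Z) + sg * q n0.+1 (j0 - 1 + 3%:Z)) * cub th.
  rewrite /loc !w_step addr0 js1 js2 js3.
  by field; rewrite gt_eqF.
have e1 := convex4 b3 b2 b1 b0 bs (comb 0%N 0%N isT isT) (comb 0%N 1%N isT isT)
  (comb 0%N 2%N isT isT) (comb 0%N 3%N isT isT).
(* The third term is a dummy of weight 0 that gives [Z] the shape of [monotone_convex_near]. *)
pose Z n := (1 - th) * z n (j0 - 1 + 1%:Z) + th * z n (j0 - 1 + 2%:Z) + 0 * 0.
have locZ n : k^-1 ^+ 2 * loc cub2 (w n) j0 th = Z n.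
  have [c0 c1 c2 c3] := cub2_values hth'.
  rewrite /loc c0 c1 c2 c3 /Z /z /diff2 js1 js2 (addrK 1 j0) js4.
  by field; rewrite gt_eqF.
have e2 : `|G (quad (sg + 2) * Z n0 + quad (sg + 1) * Z n0.+1 + quad sg * Z n0.+2) - Q|
    <= 5 * rho.
  have ZQ n i : (i <= 2)%N -> n = (n0 + i)%N -> `|G (Z n) - Q| <= 5 * rho.
    move=> i2 ->; have n1 := near i 1%N i2 isT; have n2 := near i 2%N i2 isT.
    move/andP: hth' => [t0' t1'].
    have -> : Z (n0 + i)%N = (1 - th) * z (n0 + i)%N (j0 - 1 + 1%:Z) +
      th * z (n0 + i)%N (j0 - 1 + 2%:Z) + 0 * z (n0 + i)%N (j0 - 1 + 2%:Z).
      by rewrite /Z !mul0r.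
    by apply: monotone_convex_near => //; rewrite ?subr_ge0 // subrK addr0.
  have z0 := ZQ n0 0%N isT (esym (addn0 n0)).
  have z1 := ZQ n0.+1 1%N isT (esym (addn1 n0)).
  have z2 := ZQ n0.+2 2%N isT (esym (addn2 n0)).
  have [[q2 q1 q0] qs] := quad_weights hsg'.
  exact: monotone_convex_near.
have -> : k^-1 ^+ 2 * (loc cub2 (w n0) j0 th * quad (sg + 2) +
     loc cub2 (w n0.+1) j0 th * quad (sg + 1) + loc cub2 (w n0.+2) j0 th * quad sg) =
   quad (sg + 2) * Z n0 + quad (sg + 1) * Z n0.+1 + quad sg * Z n0.+2.
  by rewrite -!locZ; ring.
set V := _ + _ * cub th in e1 *.
set U := G _ in e2 *.
have -> : V - U = (V - Q) - (U - Q) by ring.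
apply: le_trans (ler_normB _ _) _; lra.
Qed.

(** At [t = 0] the quadratic spline gives weight 1/2 to the levels 0 and 1 and none to level 2. The
    value is a space average of [w0 + (h / 2) speed], whence the additional error [h b]. *)
Lemma spline_sum_initial (y v c b : R) : (2 < N)%N ->
  (forall j, `|speed G k w0 j| <= b) ->
  (forall j : int, `|j%:~R * k - y| <= 2 * k -> `|w0 j - v| <= c) ->
  `|spline_sum quad cub 0 y - v| <= c + h * b.
Proof.
move=> N2 hb hc.
have b0 : 0 <= b by exact: le_trans (normr_ge0 _) (hb 0).
have hb0 : 0 <= h * b by rewrite mulr_ge0 // ltW.
have [j0 [th [ey hth]]] := floor_decomp (y / k).
have [js1 js2 js3 js4] := int_shifts j0.
have spl := @spline_le0 R; have q3 := @quad_ge3 R; have c4 := @cub_ge4 R.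
rewrite (@spline_sum_local quad cub 0 y 0 0 j0 th) //;
  try by move=> s; (move=> /spl[] || move=> /q3[] || move=> /c4[]).
- have [-> -> ->] := @quad_values R 0 ltac:(lra).
  have [[b3 b2 b1 b0'] bs] := cub_weights hth.
  have hv (l : nat) : (l <= 3)%N -> `|w0 (j0 - 1 + l%:Z) - v| <= c.
    move=> l3; apply: hc.
    have -> : y = (j0%:~R + th) * k by rewrite -ey mulfVK // gt_eqF.
    rewrite -mulrBl normrM (gtr0_norm k_gt0) ler_wpM2r ?(ltW k_gt0) //.
    rewrite !rmorphD /= rmorphN /=.
    have l3' : l%:~R <= 3 :> R by rewrite ler_nat.
    have l0' : 0 <= l%:~R :> R by rewrite ler0n.
    rewrite ler_norml; lra.
  have hv1 (l : nat) : (l <= 3)%N ->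
     `|(w0 (j0 - 1 + l%:Z) + (2^-1 * h) * speed G k w0 (j0 - 1 + l%:Z)) - v| <= c + h * b.
    move=> l3; rewrite addrAC; apply: le_trans (ler_normD _ _) _.
    apply: lerD; first exact: hv.
    have hh : 0 <= 2^-1 * h by apply: mulr_ge0; [|exact: ltW].
    rewrite normrM (ger0_norm hh); apply: ler_pM => //.
    by apply: ler_piMl; [exact: ltW|lra].
  have e1 := convex4 b3 b2 b1 b0' bs (hv1 0%N isT) (hv1 1%N isT) (hv1 2%N isT) (hv1 3%N isT).
  apply: le_trans e1; rewrite le_eqVlt; apply/orP; left; apply/eqP; congr (`| _ - _ |).
  rewrite /loc !w_step /q /w /= addr0 js1 js2 js3.
  by field.
- by rewrite mul0r addr0.
- by rewrite lexx ltr01.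
Qed.

End interpolation.

(* A finite sum of products of a function of the parameter [w], a C^{1,1}
   function of time and a C^{2,1} function of space. *)
Record tensor (R : realType) (Omega : Type) := Tensor {
  tidx : seq (nat * int) ;
  tcoef : nat * int -> Omega -> R ;
  tT : nat * int -> R -> R ;
  tT1 : nat * int -> R -> R ;
  tX : nat * int -> R -> R ;
  tX1 : nat * int -> R -> R ;
  tX2 : nat * int -> R -> R ;
  tT_smooth : forall i, smooth2 (tT i) (tT1 i) ;
  tX_smooth : forall i, smooth3 (tX i) (tX1 i) (tX2 i) ;
  tcoef_bounded : forall i, bounded_fct (tcoef i)
}.

Section tensor_values.
Context (R : realType) (Omega : Type) (W : tensor R Omega).

Definition teval (a b : nat * int -> R -> R) (w : Omega) (t y : R) : R :=
  \sum_(i <- tidx W) tcoef W i w * a i t * b i y.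
Definition tsum := teval (tT W) (tX W).
Definition tsum_t := teval (tT1 W) (tX W).
Definition tsum_y := teval (tT W) (tX1 W).
Definition tsum_yy := teval (tT W) (tX2 W).
End tensor_values.

(** The bound is symmetric in [lo] and [up] because supersolutions are handled by exchanging the
    two. Across 0 the slope is a weighted mean of [lo / 2] and [up / 2]. *)
Lemma Gfun_slope (R : realType) (lo up : R) : 0 <= lo -> 0 <= up -> forall a b,
  exists2 c, 0 <= c <= Num.max lo up / 2 & Gfun lo up a - Gfun lo up b = c * (a - b).
Proof.
move=> lo0 up0 a b; set m := Num.max lo up.
have lom : lo <= m by rewrite le_max lexx.
have upm : up <= m by rewrite le_max lexx orbT.
have Gneg x : x <= 0 -> Gfun lo up x = lo / 2 * x.
  by move=> x0; rewrite /Gfun max_r // max_l ?oppr_ge0 //; ring.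
wlog ab : a b / b <= a.
  move=> h; case: (leP b a) => [/h//|/ltW /h[c hc e]].
  by exists c => //; rewrite -opprB e; ring.
case: (leP 0 b) => hb.
  exists (up / 2); first by apply/andP; split; lra.
  have a0 : 0 <= a by lra.
  by rewrite (Gfun_ge0 lo up a0) (Gfun_ge0 lo up hb) mulrBr.
case: (leP a 0) => ha.
  exists (lo / 2); first by apply/andP; split; lra.
  have b0 : b <= 0 by lra.
  by rewrite (Gneg _ ha) (Gneg _ b0) mulrBr.
have ab' : 0 < a - b by lra.
exists ((up / 2 * a - lo / 2 * b) / (a - b)); last first.
  by rewrite (Gneg _ (ltW hb)) (Gfun_ge0 lo up (ltW ha)) mulfVK ?gt_eqF.
have u1 : 0 <= up / 2 * a by rewrite mulr_ge0 //; lra.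
have u2 : 0 <= lo / 2 * (- b) by rewrite mulr_ge0 //; lra.
apply/andP; split; first by rewrite divr_ge0 //; lra.
rewrite ler_pdivrMr //.
have v1 : up / 2 * a <= m / 2 * a by rewrite ler_wpM2r //; lra.
have v2 : lo / 2 * (- b) <= m / 2 * (- b) by rewrite ler_wpM2r //; lra.
lra.
Qed.

Lemma Gfun0 (R : realType) (lo up : R) : Gfun lo up 0 = 0.
Proof. by rewrite Gfun_ge0 // mulr0. Qed.

Lemma Gfun_lip (R : realType) (lo up a b : R) : 0 <= lo -> 0 <= up ->
  `|Gfun lo up a - Gfun lo up b| <= Num.max lo up / 2 * `|a - b|.
Proof. by move=> l0 u0; apply: G_lip; exact: Gfun_slope. Qed.

Lemma Gfun_mono (R : realType) (lo up : R) : 0 <= lo -> 0 <= up ->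
  {homo Gfun lo up : x y / x <= y}.
Proof.
move=> l0 u0 x y xy; rewrite -subr_ge0.
by have [c /andP[c0 _] ->] := Gfun_slope l0 u0 y x; rewrite mulr_ge0 // subr_ge0.
Qed.

Lemma GfunN (R : realType) (lo up a : R) : Gfun up lo (- a) = - Gfun lo up a.
Proof. by rewrite /Gfun opprK; ring. Qed.

Lemma Gfun_pM (R : realType) (lo up a c : R) : 0 <= c ->
  Gfun lo up (c * a) = c * Gfun lo up a.
Proof. by move=> c0; rewrite /Gfun -[- (c * a)]mulrN !max0_pM //; ring. Qed.

(** * Almost solutions with random data *)

Section scheme_coefficients.
Context (R : realType) (Omega : Type) (G : R -> R) (Lam k : R) (m : nat).
Context (g : Omega -> R -> R).

Definition grid_coef (i : nat * int) (w : Omega) : R :=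
  euler G Lam k (triple_average m (fun j => g w (j%:~R * k))) i.1 i.2.

(** A coefficient arises from finitely many values of [g] by linear operations and [G], so it
    inherits every property stable under these. [S] will be the bounded functions, the space [H t],
    and the constants. *)
Lemma grid_coef_mem (S : set (Omega -> R)) : linear_space S ->
  (forall X, S X -> S (fun w => G (X w))) -> (forall y, S (fun w => g w y)) ->
  forall i, S (grid_coef i).
Proof.
move=> Slin SG Sg [n j]; rewrite /grid_coef /=.
have avg (F : Omega -> int -> R) : (forall i, S (fun w => F w i)) ->
    forall i, S (fun w => maverage m (F w) i).
  move=> SF i; rewrite /maverage.
  have := stableZ Slin (m%:R^-1) (X := fun w => \sum_(l < m) F w (i + l%:Z)).
  under [X in (_ -> S X) -> _]eq_fun do rewrite mulrC.
  apply; have [S0 SD _] := Slin.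
  elim: (index_enum _) => [|l r IH].
    by under eq_fun do rewrite big_nil.
  by under eq_fun do rewrite big_cons; exact: SD.
elim: n j => [|n IH] j /=.
  by rewrite /triple_average; do 3!apply: (avg (fun w => _)) => ?.
rewrite /euler_step /speed.
apply: (stableD Slin) => //; apply: (stableZ Slin); apply: SG.
have := stableZ Slin (k ^+ 2)^-1 (X := fun w => diff2 (euler G Lam k (triple_average m (fun j => g w (j%:~R * k))) n) j).
under [X in (_ -> S X) -> _]eq_fun do rewrite mulrC.
apply; rewrite /diff2; apply: (stableD Slin) => //.
by apply: (stableB Slin) => //; exact: (stableZ Slin).
Qed.

End scheme_coefficients.

Lemma bounded_linear_space (R : realType) (T : Type) :
  linear_space (@bounded_fct R T).
Proof.
split; first exact: (bfct_cst T 0).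
- by move=> X Y; exact: bfctD.
- by move=> a X; apply: bfctM; exact: bfct_cst.
Qed.

Lemma natr_le_norm_int (R : realType) (a : nat) (j : int) :
  (a < `|j|)%N -> a%:R <= `|j%:~R| :> R.
Proof. by move=> h; rewrite -intr_norm -[a%:R]/(a%:Z%:~R) ler_int; lia. Qed.

Lemma stencil_count a m : (2 * (a.+1 + m + m + m).+2 + 1 = 2 * a + 6 * m + 7)%N.
Proof. lia. Qed.

Section approx_solution.
Context (R : realType) (Omega : Type) (lo up : R).
Hypotheses (lo_gt0 : 0 < lo) (up_gt0 : 0 < up).
Let G := Gfun lo up.
Let Lam := Num.max lo up.

(** The averaging width [e] is fixed by the accuracy at time 0; the mesh [k = e / m] is then
    refined. Initial speeds are bounded by [2 Lam C / e^2], independently of [m], and their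
    increments by [4 Lam C / (e^2 m)]. *)
Lemma approx_solution (g : Omega -> R -> R) (A C0 L0 T eps : R) :
  0 <= T -> 0 < eps -> 0 <= A ->
  (forall w y, `|g w y| <= C0) ->
  (forall w y y', `|g w y - g w y'| <= L0 * `|y - y'|) ->
  (forall w y, A <= `|y| -> g w y = 0) ->
  exists W : tensor R Omega,
  [/\ forall w t y, 0 <= t -> t <= T -> `|tsum_t W w t y - G (tsum_yy W w t y)| <= eps,
      forall w y, `|tsum W w 0 y - g w y| <= eps &
      forall S : set (Omega -> R), linear_space S ->
        (forall X, S X -> S (fun w => G (X w))) -> (forall y, S (fun w => g w y)) ->
        forall i, S (tcoef W i)].
Proof.
move=> T0 eps0 A0 gC gL gA.
have lo0 := ltW lo_gt0; have up0 := ltW up_gt0.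
have Lam0 : 0 < Lam by rewrite lt_max lo_gt0.
have [C C_gt0 {}gC] : exists2 C, 0 < C & forall w y, `|g w y| <= C.
  exists (`|C0| + 1) => [|w y]; first by rewrite ltr_wpDl.
  by apply: le_trans (gC w y) _; have := ler_norm C0; lra.
have [L L_gt0 {}gL] : exists2 L, 0 < L & forall w y y', `|g w y - g w y'| <= L * `|y - y'|.
  exists (`|L0| + 1) => [|w y y']; first by rewrite ltr_wpDl.
  apply: le_trans (gL w y y') _; rewrite ler_wpM2r //.
  by have := ler_norm L0; lra.
(* Each of the three averages moves the datum by at most [L e], and the cubic spline reads nodes
   within [2 k <= 2 e]: together [5 L e]. The other half of [eps] is for the time spline. *)
have [e e0 eL] : exists2 e, 0 < e & 5 * (L * e) = eps / 2.
  exists (eps / (10 * L)); first by rewrite divr_gt0 // mulr_gt0.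
  by field; rewrite gt_eqF.
(* [K / m] bounds the squared increments of the speed: at most [m (2 A / e + 13)] nodes, each
   contributing the square of [4 Lam C / (e^2 m)]. *)
pose K := (2 * A / e + 13) * (4 * Lam * C / e ^+ 2) ^+ 2.
have K0 : 0 <= K.
  apply: mulr_ge0 (sqr_ge0 _).
  have : 0 <= 2 * A / e by apply: divr_ge0; [exact: mulr_ge0|exact: ltW].
  lra.
(* The three terms give [m >= 1], [2 C / m <= eps / 2] and [K / m <= (eps / 10)^2]. *)
have [m hm] := exists_nat_gt (1 + 4 * C / eps + 100 * K / eps ^+ 2).
have c1 : 0 <= 4 * C / eps.
  by apply: divr_ge0; [apply: mulr_ge0 => //|]; exact: ltW.
have c2 : 0 <= 100 * K / eps ^+ 2.
  by apply: divr_ge0 (sqr_ge0 _); exact: mulr_ge0.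
have m1 : 1 <= m%:R :> R by lra.
have m0R : 0 < m%:R :> R by lra.
have m0 : (0 < m)%N by rewrite -(ltr0n R).
have mC : 4 * C <= m%:R * eps by rewrite -ler_pdivrMr //; lra.
have mK : 100 * K <= m%:R * eps ^+ 2 by rewrite -ler_pdivrMr ?exprn_gt0 //; lra.
pose k := e / m%:R.
have k0 : 0 < k by rewrite divr_gt0.
have km : k * m%:R = e by rewrite /k mulfVK // gt_eqF.
have kle : k <= e by rewrite -km ler_peMr // ltW.
pose h := tstep Lam k.
have h0 : 0 < h by rewrite divr_gt0 // exprn_gt0.
(* The interpolation at time [T] reads the levels up to the integer part of [T / h] plus 2, and the
   levels are numbered from 0. *)
pose N := (Num.truncn (T / h) + 3)%N.
pose A' := (Num.truncn (A / k)).+1.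
pose B := (A' + m + m + m)%N.
pose gam w (j : int) := g w (j%:~R * k).
pose w0 w := triple_average m (gam w).
have G0 : G 0 = 0 := Gfun0 lo up.
have Gs := Gfun_slope lo0 up0.
have Gm := Gfun_mono lo0 up0.
have gamC w j : `|gam w j| <= C by exact: gC.
have gamL w j (i : nat) : `|gam w (j + i%:Z) - gam w j| <= (L * k) * i%:R.
  apply: le_trans (gL w _ _) _; rewrite -mulrA ler_wpM2l ?(ltW L_gt0) //.
  by rewrite -mulrBl rmorphD /= addrAC subrr add0r normrM (gtr0_norm k0) ger0_norm ?ler0n // mulrC.
have w0_supp w : suppZ B (w0 w).
  do 3!apply: (suppZ_maverage m0); move=> j hj; apply: gA.
  rewrite normrM (gtr0_norm k0) -ler_pdivrMr //.
  have : A / k < A'%:R by exact: truncnS_gt.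
  have : A'%:R <= `|j%:~R| :> R by exact: natr_le_norm_int.
  lra.
have speed0 w j : `|speed G k (w0 w) j| <= 2 * Lam * C / e ^+ 2.
  have -> : speed G k (w0 w) j = G (diff2 (w0 w) j / k ^+ 2) - G 0 by rewrite G0 subr0.
  apply: le_trans (Gfun_lip _ _ lo0 up0) _.
  rewrite subr0 normrM [`|_^-1|]gtr0_norm ?invr_gt0 ?exprn_gt0 //.
  have hd := triple_average_diff2 m0 (gamC w) j.
  have -> : 2 * Lam * C / e ^+ 2 = Lam / 2 * (4 * C / m%:R ^+ 2 / k ^+ 2).
    by rewrite -km; field; rewrite !gt_eqF.
  rewrite -/Lam ler_wpM2l //; first by rewrite divr_ge0 // ltW.
  by rewrite ler_wpM2r // invr_ge0 exprn_ge0 // ltW.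
have dspeed0 w j : `|dspeed G k (w0 w) j| <= 4 * Lam * C / e ^+ 2 / m%:R.
  apply: le_trans (Gfun_lip _ _ lo0 up0) _.
  rewrite -mulrBl normrM [`|_^-1|]gtr0_norm ?invr_gt0 ?exprn_gt0 //.
  have hd := triple_average_diff3 m0 (gamC w) j.
  have -> : 4 * Lam * C / e ^+ 2 / m%:R = Lam / 2 * (8 * C / m%:R ^+ 3 / k ^+ 2).
    by rewrite -km; field; rewrite !gt_eqF.
  rewrite -/Lam ler_wpM2l //; first by rewrite divr_ge0 // ltW.
  by rewrite ler_wpM2r // invr_ge0 exprn_ge0 // ltW.
have B_le : (2 * B.+2 + 1)%:R <= m%:R * (2 * A / e + 13) :> R.
  have hA : (Num.truncn (A / k))%:R <= A / k.
    by have /andP[] := @truncn_itv _ (A / k) (divr_ge0 A0 (ltW k0)).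
  have -> : (2 * B.+2 + 1)%:R = 2 * (Num.truncn (A / k))%:R + 6 * m%:R + 7 :> R.
    rewrite (stencil_count (Num.truncn (A / k)) m).
    by rewrite natrD natrD (natrM _ 2) (natrM _ 6).
  have -> : m%:R * (2 * A / e + 13) = 2 * (A / k) + 13 * m%:R.
    by rewrite /k; field; rewrite !gt_eqF.
  lra.
have rho_bound w n j : `|dspeed G k (euler G Lam k (w0 w) n) j| <= eps / 10.
  rewrite -ler_sqr ?nnegrE ?divr_ge0 ?(ltW eps0) // real_normK ?num_real //.
  apply: le_trans (dspeed_euler_sqr_le Lam0 k0 G0 Gs (w0_supp w) (dspeed0 w) n j) _.
  apply: le_trans (ler_wpM2r (sqr_ge0 _) B_le) _.
  rewrite exprMn -[4 * Lam * C / e ^+ 2]/(4 * Lam * C / e ^+ 2).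
  have -> : m%:R * (2 * A / e + 13) * ((4 * Lam * C / e ^+ 2) ^+ 2 * m%:R^-1 ^+ 2) = K / m%:R.
    by rewrite /K; field; rewrite !gt_eqF.
  by rewrite ler_pdivrMr // exprMn; lra.
pose coef := grid_coef G Lam k m g.
have coef_mem := @grid_coef_mem _ _ G Lam k m g.
have coef_bdd i : bounded_fct (coef i).
  apply: coef_mem => [|X [c hc]|y]; first exact: bounded_linear_space.
    exists (Lam / 2 * c) => w.
    have -> : G (X w) = G (X w) - G 0 by rewrite G0 subr0.
    apply: le_trans (Gfun_lip _ _ lo0 up0) _.
    by rewrite subr0 ler_wpM2l // divr_ge0 // ltW.
  by exists C.
pose TT (i : nat * int) t := quad (h^-1 * t + (2 - i.1%:R)) : R.
pose TT1 (i : nat * int) t := h^-1 * quad1 (h^-1 * t + (2 - i.1%:R)) : R.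
pose XX (i : nat * int) y := cub (k^-1 * y + (2 - i.2%:~R)) : R.
pose XX1 (i : nat * int) y := k^-1 * cub1 (k^-1 * y + (2 - i.2%:~R)) : R.
pose XX2 (i : nat * int) y := k^-1 ^+ 2 * cub2 (k^-1 * y + (2 - i.2%:~R)) : R.
have TTs i : smooth2 (TT i) (TT1 i) by exact: (smooth2_affine h^-1 (2 - i.1%:R) (quad_smooth2 R)).
have XXs i : smooth3 (XX i) (XX1 i) (XX2 i) by exact: (smooth3_affine k^-1 (2 - i.2%:~R) (cub_smooth3 R)).
pose idx := [seq (n, j) | n <- iota 0 N, j <- window (B + N)].
pose W := Tensor idx TTs XXs coef_bdd.
have evalE w (U V : R -> R) (a b : R) t y :
    \sum_(i <- idx) coef i w * (a * U (h^-1 * t + (2 - i.1%:R))) *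
        (b * V (k^-1 * y + (2 - i.2%:~R))) =
    a * (b * spline_sum G Lam k (w0 w) B N U V t y).
  rewrite big_allpairs /= /spline_sum mulr_sumr mulr_sumr; apply: eq_bigr => n _.
  rewrite mulr_sumr mulr_sumr; apply: eq_bigr => j _.
  rewrite /coef /grid_coef /= -/(w0 w) !addrA [h^-1 * t]mulrC [k^-1 * y]mulrC; ring.
exists W; split.
- move=> w t y t0 tT.
  have -> : tsum_t W w t y = h^-1 * spline_sum G Lam k (w0 w) B N quad1 cub t y.
    rewrite -[spline_sum _ _ _ _ _ _ _ _ _ _]mul1r -evalE; apply: eq_bigr => i _.
    by rewrite mul1r.
  have -> : tsum_yy W w t y = k^-1 ^+ 2 * spline_sum G Lam k (w0 w) B N quad cub2 t y.
    rewrite -[RHS]mul1r -evalE; apply: eq_bigr => i _.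
    by rewrite mul1r.
  have := @spline_sum_equation _ G Lam k Lam0 k0 G0 Gs (w0 w) B N (eps / 10)
    (w0_supp w) (rho_bound w) Gm t y t0.
  have -> : 10 * (eps / 10) = eps by field.
  apply; rewrite /N -/h.
  have : (Num.truncn (t / h) <= Num.truncn (T / h))%N.
    by apply: le_truncn; rewrite ler_wpM2r // invr_ge0 ltW.
  by move=> hle; rewrite -addnS leq_add.
- move=> w y.
  have -> : tsum W w 0 y = spline_sum G Lam k (w0 w) B N quad cub 0 y.
    rewrite -[RHS]mul1r -[X in 1 * X]mul1r -evalE; apply: eq_bigr => i _.
    by rewrite !mul1r.
  have hN : (2 < N)%N by rewrite /N addnC.
  have hc : forall j : int, `|j%:~R * k - y| <= 2 * k ->
      `|w0 w j - g w y| <= 3 * (L * e) + 2 * (L * k).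
    move=> j hj.
    have a1 := maverage_dist m0 (mulr_ge0 (ltW L_gt0) (ltW k0)) (gamL w) j.
    have l1 := maverage_lip m0 (gamL w).
    have a2 := maverage_dist m0 (mulr_ge0 (ltW L_gt0) (ltW k0)) l1 j.
    have l2 := maverage_lip m0 l1.
    have a3 := maverage_dist m0 (mulr_ge0 (ltW L_gt0) (ltW k0)) l2 j.
    have a4 : `|gam w j - g w y| <= L * (2 * k).
      by apply: le_trans (gL w _ _) _; rewrite ler_wpM2l // ltW.
    have Lkm : L * k * m%:R = L * e by rewrite -mulrA km.
    rewrite Lkm in a1 a2 a3.
    move: a1 a2 a3 a4; rewrite /w0 /triple_average !ler_norml; lra.
  apply: le_trans (@spline_sum_initial _ G Lam k Lam0 k0 G0 (w0 w) B N (w0_supp w)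
    y (g w y) _ _ hN (speed0 w) hc) _.
  have -> : tstep Lam k * (2 * Lam * C / e ^+ 2) = 2 * C / m%:R / m%:R.
    by rewrite /tstep -km; field; rewrite !gt_eqF.
  have : L * k <= L * e by rewrite ler_wpM2l // ltW.
  have : 2 * C / m%:R / m%:R <= eps / 2.
    apply: (@le_trans _ _ (2 * C / m%:R)).
      rewrite ler_pdivrMr // ler_peMr // divr_ge0 ?mulr_ge0 // ltW //.
    by rewrite ler_pdivrMr //; lra.
  lra.
- move=> S Slin SG Sg i; exact: coef_mem.
Qed.

End approx_solution.

Lemma ClLip_Gfun (R : realType) (lo up : R) : 0 <= lo -> 0 <= up -> ClLip (Gfun lo up).
Proof. by move=> l0 u0; apply: Lipschitz_ClLip => x y; exact: Gfun_lip. Qed.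

Lemma expr3_le (R : realFieldType) (a b : R) p : 0 <= a -> 0 <= b ->
  (1 + a + b) ^+ p <= 3 ^+ p * (1 + a ^+ p + b ^+ p).
Proof.
move=> a0 b0; pose m := Num.max 1 (Num.max a b).
have [m1 ma mb] : [/\ 1 <= m, a <= m & b <= m] by rewrite /m !le_max !lexx !orbT.
have ap : 0 <= a ^+ p by exact: exprn_ge0.
have bp : 0 <= b ^+ p by exact: exprn_ge0.
apply: (@le_trans _ _ ((3 * m) ^+ p)).
  by rewrite lerXn2r ?nnegrE //; lra.
rewrite exprMn ler_wpM2l ?exprn_ge0 //.
rewrite /m; case: (leP 1 (Num.max a b)) => _; last by rewrite expr1n; lra.
by case: (leP a b) => _; lra.
Qed.

Definition clip (R : realType) (A y : R) := Num.max (- A) (Num.min A y).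

Section clip_lemmas.
Context (R : realType) (A : R).
Hypothesis A_gt0 : 0 < A.

Lemma clipE (z : R) :
  clip A z = if A <= z then A else if - A <= z then z else - A.
Proof.
rewrite /clip; case: (leP A z) => h1.
  by rewrite max_r // (le_trans _ (ltW A_gt0)) // oppr_le0 ltW.
by case: (leP (- A) z).
Qed.

Lemma clip_le (y : R) : `|clip A y| <= A.
Proof.
have A0 := ltW A_gt0.
rewrite clipE; case: (leP A y) => h1; last case: (leP (- A) y) => h2;
  rewrite ler_norml; lra.
Qed.

Lemma clip_id (y : R) : `|y| <= A -> clip A y = y.
Proof. by rewrite ler_norml => /andP[h1 h2]; rewrite /clip min_r // max_r. Qed.

Lemma clip_lip (y y' : R) : `|clip A y - clip A y'| <= `|y - y'|.
Proof.
have A0 := ltW A_gt0.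
rewrite !clipE; case: (ler0P (y - y')) => h;
  case: (leP A y) => ?; case: (leP A y') => ?;
  case: (leP (- A) y) => ?; case: (leP (- A) y') => ?; rewrite ler_norml; lra.
Qed.
End clip_lemmas.

Section approx_growth.
Context (R : realType) (Omega : Type) (lo up : R).
Hypotheses (lo_gt0 : 0 < lo) (up_gt0 : 0 < up).
Context (g0 : Omega -> R -> R) (Nr : Omega -> R) (C : R) (m : nat).
Hypotheses (Nr_ge0 : forall w, 0 <= Nr w) (C_gt0 : 0 < C).
Hypothesis g0_lip : forall w y y',
  `|g0 w y - g0 w y'| <= C * (1 + Nr w ^+ m + `|y| ^+ m + `|y'| ^+ m) * `|y - y'|.
Hypothesis g0_0 : forall w, `|g0 w 0| <= C * (1 + Nr w ^+ m).

Let q (w : Omega) (y : R) := 1 + Nr w + `|y|.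

Lemma growth_bound w y : `|g0 w y| <= 6 * C * q w y ^+ m.+1.
Proof.
have N0 := Nr_ge0 w; have y0 := normr_ge0 y.
have q1 : 1 <= q w y by rewrite /q; lra.
have qm1 : 1 <= q w y ^+ m by rewrite exprn_ege1.
have Nm : Nr w ^+ m <= q w y ^+ m by rewrite lerXn2r ?nnegrE /q //; lra.
have ym : `|y| ^+ m <= q w y ^+ m by rewrite lerXn2r ?nnegrE /q //; lra.
have zm : `|0 : R| ^+ m <= 1 by rewrite normr0; case: (m) => [|n]; rewrite ?expr0 // expr0n.
have h := g0_lip w y 0; rewrite subr0 in h.
have h1 : `|g0 w y| <= `|g0 w y - g0 w 0| + `|g0 w 0|.
  by rewrite -{1}(subrK (g0 w 0) (g0 w y)) ler_normD.
have h2 : C * (1 + Nr w ^+ m) <= C * (2 * q w y ^+ m) by rewrite ler_wpM2l ?(ltW C_gt0) //; lra.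
have yq : `|y| <= q w y by rewrite /q; lra.
have h3 : C * (1 + Nr w ^+ m + `|y| ^+ m + `|0 : R| ^+ m) * `|y| <= C * (4 * q w y ^+ m) * q w y.
  apply: ler_pM => //.
    apply: mulr_ge0; first exact: ltW.
    by rewrite !addr_ge0 ?exprn_ge0.
  by rewrite ler_wpM2l ?(ltW C_gt0) //; lra.
have h4 : C * (2 * q w y ^+ m) <= C * (2 * q w y ^+ m) * q w y.
  rewrite ler_peMr // mulr_ge0 ?(ltW C_gt0) // mulr_ge0 //; lra.
have := g0_0 w; rewrite exprSr; lra.
Qed.

(** Reduction to bounded, Lipschitz, compactly supported data: [y] and the size [Nr] of the
    parameters are both cut off at level [A], and [clip] freezes [g0] outside the support of the
    cutoff, so that the product has a global Lipschitz constant. The cost is at most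
    [|g0| (Nr + |y|) / A]. *)
Lemma approx_growth (T eps : R) : 0 <= T -> 0 < eps ->
  exists W : tensor R Omega,
  [/\ forall w t y, 0 <= t -> t <= T ->
        `|tsum_t W w t y - Gfun lo up (tsum_yy W w t y)| <= eps,
      forall w y, `|tsum W w 0 y - g0 w y| <=
        eps * (1 + Nr w ^+ (2 * m.+1) + `|y| ^+ (2 * m.+1)) &
      forall S : set (Omega -> R), linear_space S -> ClLip_stable S -> S Nr ->
        (forall y, S (fun w => g0 w y)) -> forall i, S (tcoef W i)].
Proof.
move=> T0 eps0.
(* The degree of the barrier [bpow m]; it is at least [m + 2], the degree of the cutoff error. *)
set p := (2 * m.+1)%N.
(* Chosen so that [6 C (1 + Nr + |y|)^(m+2) / A] is at most [eps / 2] times [1 + Nr^p + |y|^p], by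
   [expr3_le]. *)
pose A := 6 * C * 3 ^+ p * 2 / eps.
have p3 : 0 < 3 ^+ p :> R by rewrite exprn_gt0.
have A0 : 0 < A by rewrite divr_gt0 // !mulr_gt0.
pose A2 := 2 * A.
have A20 : 0 < A2 by rewrite mulr_gt0.
pose g w y := cutoff A (Nr w) * (cutoff A y * g0 w (clip A2 y)).
pose D := 6 * C * (1 + A2 + A2) ^+ m.+1.
have D0 : 0 <= D.
  by apply: mulr_ge0; [apply: mulr_ge0 => //; exact: ltW|apply: exprn_ge0; lra].
have g0D w y : Nr w <= A2 -> `|g0 w (clip A2 y)| <= D.
  move=> hN; apply: le_trans (growth_bound _ _) _.
  rewrite ler_wpM2l //; first by rewrite mulr_ge0 // ltW.
  have := clip_le A20 y; have := normr_ge0 (clip A2 y); have := Nr_ge0 w => n0 c0 c1.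
  by rewrite lerXn2r ?nnegrE /q //; lra.
have Nout w : A2 < Nr w -> forall y, g w y = 0.
  move=> h y; rewrite /g cutoff_out ?mul0r //.
  by rewrite ger0_norm ?Nr_ge0 // ltW.
have gD w y : `|g w y| <= D.
  case: (ltP A2 (Nr w)) => hN; first by rewrite Nout // normr0.
  rewrite /g normrM normrM -[leRHS]mul1r ler_pM // ?mulr_ge0 //.
    by rewrite ger0_norm ?cutoff_ge0 ?cutoff_le1.
  rewrite -[leRHS]mul1r ler_pM ?g0D //.
  by rewrite ger0_norm ?cutoff_ge0 ?cutoff_le1.
pose L := A^-1 * D + C * (1 + A2 ^+ m + A2 ^+ m + A2 ^+ m).
have L0 : 0 <= L.
  apply: addr_ge0; first by apply: mulr_ge0 => //; rewrite invr_ge0 ltW.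
  by apply: mulr_ge0; [exact: ltW|rewrite !addr_ge0 ?exprn_ge0 // ltW].
have gL w y y' : `|g w y - g w y'| <= L * `|y - y'|.
  case: (ltP A2 (Nr w)) => hN; first by rewrite !Nout // subrr normr0 mulr_ge0.
  rewrite /g -mulrBr normrM -[leRHS]mul1r; apply: ler_pM => //.
    by rewrite ger0_norm ?cutoff_ge0 ?cutoff_le1.
  have -> : cutoff A y * g0 w (clip A2 y) - cutoff A y' * g0 w (clip A2 y') =
     (cutoff A y - cutoff A y') * g0 w (clip A2 y) +
     cutoff A y' * (g0 w (clip A2 y) - g0 w (clip A2 y')) by ring.
  apply: le_trans (ler_normD _ _) _; rewrite /L [leRHS]mulrDl; apply: lerD.
    rewrite normrM mulrAC; apply: ler_pM => //; [exact: cutoff_lip|exact: g0D].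
  rewrite normrM -[leRHS]mul1r; apply: ler_pM => //.
    by rewrite ger0_norm ?cutoff_ge0 ?cutoff_le1.
  apply: le_trans (g0_lip _ _ _) _.
  apply: ler_pM => //; last exact: clip_lip.
    apply: mulr_ge0; first exact: ltW.
    by rewrite !addr_ge0 ?exprn_ge0.
  rewrite ler_wpM2l ?(ltW C_gt0) // !lerD // lerXn2r ?nnegrE ?Nr_ge0 ?(ltW A20) //;
    exact: clip_le.
have gA w y : A2 <= `|y| -> g w y = 0.
  by move=> h; rewrite /g (cutoff_out A0 h) mul0r mulr0.
have near w y : `|g w y - g0 w y| <= eps / 2 * (1 + Nr w ^+ p + `|y| ^+ p).
  have N0 := Nr_ge0 w; have y0 := normr_ge0 y.
  have h1 : `|g w y - g0 w y| <= `|g0 w y| * ((Nr w + `|y|) / A).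
    case: (leP `|y| A2) => hy.
      rewrite /g clip_id //.
      have -> : cutoff A (Nr w) * (cutoff A y * g0 w y) - g0 w y =
        - (g0 w y * (1 - cutoff A (Nr w) * cutoff A y)) by ring.
      rewrite normrN normrM ler_wpM2l //.
      have c1 := cutoff_sub_le (Nr w) A0; have c2 := cutoff_sub_le y A0.
      rewrite (ger0_norm N0) in c1.
      have c3 := cutoff_ge0 A (Nr w); have c4 := cutoff_le1 A (Nr w).
      have c5 := cutoff_ge0 A y; have c6 := cutoff_le1 A y.
      have c7 : cutoff A (Nr w) * cutoff A y <= 1 by rewrite mulr_ile1.
      have c8 : 0 <= (1 - cutoff A (Nr w)) * (1 - cutoff A y) by apply: mulr_ge0; lra.
      rewrite ger0_norm; last lra.
      rewrite mulrDl; lra.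
    rewrite gA; last exact: ltW.
    rewrite sub0r normrN ler_peMr // ler_pdivlMr // mul1r.
    by move: hy; rewrite /A2; lra.
  apply: le_trans h1 _.
  have q1 : 1 <= q w y by rewrite /q; lra.
  have h2 : (Nr w + `|y|) / A <= q w y / A.
    by rewrite ler_wpM2r ?invr_ge0 ?(ltW A0) // /q; lra.
  have h3 := growth_bound w y.
  have h20 : 0 <= (Nr w + `|y|) / A by rewrite divr_ge0 ?(ltW A0) // addr_ge0.
  apply: le_trans (ler_pM (normr_ge0 _) h20 h3 h2) _.
  have h4 : q w y ^+ m.+1 * q w y <= q w y ^+ p.
    by rewrite -exprSr ler_weXn2l // /p mul2n -addnn addSn addnS ltnS ltnS leq_addr.
  have h5 := expr3_le p N0 y0; rewrite -/(q w y) in h5.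
  have -> : 6 * C * q w y ^+ m.+1 * (q w y / A) = (eps / 2) * (q w y ^+ m.+1 * q w y) / 3 ^+ p.
    by rewrite /A; field; rewrite !gt_eqF // !mulr_gt0.
  rewrite ler_pdivrMr // -[leRHS]mulrA ler_wpM2l //; first by rewrite divr_ge0 // ltW.
  by apply: le_trans h4 _; rewrite [leRHS]mulrC.
have eps2 : 0 < eps / 2 by rewrite divr_gt0.
have [W [W1 W2 W3]] := approx_solution lo_gt0 up_gt0 T0 eps2 (ltW A20) gD gL gA.
exists W; split.
- by move=> w t y t0 tT; apply: le_trans (W1 w t y t0 tT) _; lra.
- move=> w y; have h1 := W2 w y; have h2 := near w y.
  have n1 : 0 <= Nr w ^+ p by rewrite exprn_ge0.
  have n2 : 0 <= `|y| ^+ p by rewrite exprn_ge0.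
  have h3 : eps / 2 <= eps / 2 * (1 + Nr w ^+ p + `|y| ^+ p).
    by rewrite ler_peMr ?(ltW eps2) //; lra.
  have -> : tsum W w 0 y - g0 w y = (tsum W w 0 y - g w y) + (g w y - g0 w y) by ring.
  apply: le_trans (ler_normD _ _) _; lra.
- move=> S Slin Sst SN Sg i; apply: W3 => // [X SX|y].
    by apply: (stable_comp Sst) SX; apply: ClLip_Gfun; exact: ltW.
  apply: (stableM Sst).
    exact: (stable_comp Sst (ClLip_cutoff A0) SN).
  exact: (stableZ Slin).
Qed.

End approx_growth.

(** * Viscosity solutions *)

Section derivatives.
Context (R : realType).

Lemma is_derive_taylor (f : R -> R) (x a C : R) : 0 <= C ->
  (forall e, `|f (x + e) - f x - e * a| <= C * (e ^+ 2 + `|e| ^+ 3)) ->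
  is_derive x 1 f a.
Proof.
move=> C0 hf.
have cv : h^-1 *: ((f \o shift x) (h *: (1 : R)) - f x) @[h --> (0 : R)^'] --> a.
  apply/cvgrPdist_le => eps eps0.
  pose r := Num.min 1 (eps / (2 * C + 1)).
  have r0 : 0 < r by rewrite lt_min ltr01 divr_gt0 //; lra.
  near=> h.
  have h0 : h != 0 by near: h; exact: nbhs_dnbhs_neq.
  have hr : `|h| <= r by near: h; exact: dnbhs0_le.
  have h1 : `|h| <= 1 by apply: le_trans hr _; rewrite ge_min lexx.
  have h2 : `|h| <= eps / (2 * C + 1) by apply: le_trans hr _; rewrite ge_min lexx orbT.
  have hp : 0 < `|h| by rewrite normr_gt0.
  rewrite /= [h *: (1 : R)]mulr1 [h + x]addrC.
  have -> : a - h^-1 *: (f (x + h) - f x) = - (h^-1 * (f (x + h) - f x - h * a)).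
    by rewrite /GRing.scale /=; field.
  rewrite normrN normrM normfV ler_pdivrMl //.
  apply: le_trans (hf h) _.
  have e1 : `|h| ^+ 3 <= `|h| ^+ 2 by rewrite ler_wiXn2l.
  have -> : h ^+ 2 = `|h| ^+ 2 by rewrite real_normK ?num_real.
  apply: (@le_trans _ _ (C * (2 * `|h| ^+ 2))); first by rewrite ler_wpM2l //; lra.
  have -> : C * (2 * `|h| ^+ 2) = `|h| * (2 * C * `|h|) by ring.
  rewrite ler_pM2l //.
  have c1 : 0 < 2 * C + 1 by lra.
  move: h2; rewrite ler_pdivlMr // => h2.
  have := normr_ge0 h; lra.
apply: DeriveDef; first by apply/cvg_ex; exists a.
exact: cvg_lim cv.
Unshelve. all: by end_near.
Qed.

Lemma continuous_lip (f : R -> R) C : 0 <= C ->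
  (forall x e, `|f (x + e) - f x| <= C * `|e|) -> continuous f.
Proof.
move=> C0 hf x; apply/cvgrPdist_le => eps eps0.
have r0 : 0 < eps / (C + 1) by rewrite divr_gt0 //; lra.
have cid : y @[y --> x] --> x by exact: cvg_id.
move/cvgrPdist_le: cid => cid.
near=> y.
have hy : `|x - y| <= eps / (C + 1) by near: y; exact: cid.
have -> : f x - f y = f (y + (x - y)) - f y by rewrite subrKC.
apply: le_trans (hf y (x - y)) _.
move: hy; rewrite ler_pdivlMr; last lra.
by have := normr_ge0 (x - y); lra.
Unshelve. all: by end_near.
Qed.

(** The derivatives are given explicitly and on the whole plane, so that sums, opposites and
    barriers are assembled without computing [derive1]. *)
Definition C12_with (psi pt px pxx : R -> R -> R) : Prop :=
  (forall t x : R, [/\ is_derive t 1 (psi^~ x) (pt t x), is_derive x 1 (psi t) (px t x)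
     & is_derive x 1 (px t) (pxx t x)]) /\
  [/\ continuous (fun p : R * R => psi p.1 p.2), continuous (fun p : R * R => pt p.1 p.2),
      continuous (fun p : R * R => px p.1 p.2)
    & continuous (fun p : R * R => pxx p.1 p.2)].

Lemma C12_with_derive (psi pt px pxx : R -> R -> R) : C12_with psi pt px pxx ->
  [/\ dt psi = pt, dx psi = px & dxx psi = pxx].
Proof.
move=> [h _].
have hx : dx psi = px.
  apply/funext => t; apply/funext => x; have [_ d _] := h t x.
  by rewrite /dx derive1E; exact: derive_val.
split => //; apply/funext => t; apply/funext => x; have [d1 _ d2] := h t x.
  by rewrite /dt derive1E; exact: derive_val.
rewrite /dxx (_ : derive1 (psi t) = px t); last by rewrite -hx.
by rewrite derive1E; exact: derive_val.
Qed.

Lemma C12_with_C12 (psi pt px pxx : R -> R -> R) : C12_with psi pt px pxx -> C12 psi.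
Proof.
move=> hpsi; have [et ex exx] := C12_with_derive hpsi.
have [h [_ ct cx cxx]] := hpsi.
move=> t x _; rewrite et ex exx; split; last by split; [exact: ct|exact: cx|exact: cxx].
have [d1 d2 d3] := h t x; split.
- exact: ex_derive.
- exact: ex_derive.
- rewrite (_ : derive1 (psi t) = px t); first exact: ex_derive.
  by rewrite -ex.
Qed.

Lemma C12_withD (psi pt px pxx phi qt qx qxx : R -> R -> R) :
  C12_with psi pt px pxx -> C12_with phi qt qx qxx ->
  C12_with (fun t x => psi t x + phi t x) (fun t x => pt t x + qt t x)
    (fun t x => px t x + qx t x) (fun t x => pxx t x + qxx t x).
Proof.
move=> [h [c0 c1 c2 c3]] [g [d0 d1 d2 d3]]; split.
  move=> t x; have [h1 h2 h3] := h t x; have [g1 g2 g3] := g t x.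
  by split; exact: is_deriveD.
split=> p; apply: continuousD.
- exact: c0.
- exact: d0.
- exact: c1.
- exact: d1.
- exact: c2.
- exact: d2.
- exact: c3.
- exact: d3.
Qed.

Lemma C12_with_tensor (a a1 b b1 b2 : R -> R) (c : R) :
  (forall t : R, is_derive t 1 a (a1 t)) -> (forall x : R, is_derive x 1 b (b1 x)) ->
  (forall x : R, is_derive x 1 b1 (b2 x)) ->
  continuous a -> continuous a1 -> continuous b -> continuous b1 -> continuous b2 ->
  C12_with (fun t x => c * a t * b x) (fun t x => c * a1 t * b x)
    (fun t x => c * a t * b1 x) (fun t x => c * a t * b2 x).
Proof.
move=> ha hb hb1 ca ca1 cb cb1 cb2.
have cont (f g : R -> R) : continuous f -> continuous g ->
    continuous (fun p : R * R => c * f p.1 * g p.2).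
  move=> cf cg p.
  have cf1 : {for p, continuous (fun p : R * R => f p.1)}.
    by apply: (continuous_comp (f := fst) (g := f)); [exact: cvg_fst|exact: cf].
  have cg2 : {for p, continuous (fun p : R * R => g p.2)}.
    by apply: (continuous_comp (f := snd) (g := g)); [exact: cvg_snd|exact: cg].
  apply: (continuousM (s := fun p : R * R => c * f p.1)) => //.
  by apply: (continuousM (s := fun=> c)) => //; exact: cvg_cst.
have der (f : R -> R) (k x df : R) : is_derive x 1 f df -> is_derive x 1 (fun y => k * f y) (k * df).
  by move=> hf; exact: (is_deriveZ k hf).
split; last by split; exact: cont.
move=> t x; split.
- have -> : (fun t => c * a t * b x) = (fun t => (c * b x) * a t) by apply/funext => s; ring.
  by rewrite mulrAC; exact: der.
- exact: der.
- exact: der.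
Qed.

Lemma C12_with0 : C12_with (fun _ _ => 0) (fun _ _ => 0) (fun _ _ => 0) (fun _ _ => 0).
Proof.
split; first by move=> t x; split; exact: is_derive_cst.
by split=> p; exact: cvg_cst.
Qed.

Lemma smooth2_derive (T T1 : R -> R) : smooth2 T T1 ->
  [/\ forall t : R, is_derive t 1 T (T1 t), continuous T & continuous T1].
Proof.
move=> [C C0 h]; split.
- move=> t; have [_ _ ht] := h t; apply: (is_derive_taylor C0) => e.
  have [_ _ he] := ht e; apply: le_trans he _.
  by rewrite ler_wpM2l // lerDl exprn_ge0.
- by apply: (continuous_lip C0) => x e; have [_ _ /(_ e)[]] := h x.
- by apply: (continuous_lip C0) => x e; have [_ _ /(_ e)[]] := h x.
Qed.

Lemma smooth3_derive (X X1 X2 : R -> R) : smooth3 X X1 X2 ->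
  [/\ forall t : R, is_derive t 1 X (X1 t), forall t : R, is_derive t 1 X1 (X2 t),
      continuous X, continuous X1 & continuous X2].
Proof.
move=> [C C0 h]; split.
- move=> x; have [_ _ x2 hx] := h x.
  have CC : 0 <= C + C by lra.
  apply: (is_derive_taylor CC) => e; have [_ _ _ _ he] := hx e.
  have -> : X (x + e) - X x - e * X1 x = (X (x + e) - X x - e * X1 x - e ^+ 2 / 2 * X2 x)
    + e ^+ 2 / 2 * X2 x by ring.
  apply: le_trans (ler_normD _ _) _.
  have e3 : 0 <= `|e| ^+ 3 by exact: exprn_ge0.
  have e2 := sqr_ge0 e.
  have : `|e ^+ 2 / 2 * X2 x| <= e ^+ 2 * C.
    rewrite normrM ger0_norm ?divr_ge0 // ler_pM ?divr_ge0 //; lra.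
  have : 0 <= C * e ^+ 2 by exact: mulr_ge0.
  have : 0 <= C * `|e| ^+ 3 by exact: mulr_ge0.
  lra.
- move=> x; have [_ _ _ hx] := h x; apply: (is_derive_taylor C0) => e.
  have [_ _ _ he _] := hx e; apply: le_trans he _.
  by rewrite ler_wpM2l // lerDl exprn_ge0.
- by apply: (continuous_lip C0) => x e; have [_ _ _ /(_ e)[]] := h x.
- by apply: (continuous_lip C0) => x e; have [_ _ _ /(_ e)[]] := h x.
- by apply: (continuous_lip C0) => x e; have [_ _ _ /(_ e)[]] := h x.
Qed.

Lemma tsum_C12 (Omega : Type) (W : tensor R Omega) w :
  C12_with (tsum W w) (tsum_t W w) (tsum_y W w) (tsum_yy W w).
Proof.
rewrite /tsum /tsum_t /tsum_y /tsum_yy /teval.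
elim: (tidx W) => [|i r IH].
  have e (F : nat * int -> R -> R -> R) :
    (fun t y => \sum_(j <- [::]) F j t y) = (fun _ _ => 0).
    by apply/funext => t; apply/funext => y; rewrite big_nil.
  rewrite !(e (fun j t y => tcoef W j w * _ j t * _ j y)); exact: C12_with0.
have e (F : nat * int -> R -> R -> R) :
    (fun t y => \sum_(j <- i :: r) F j t y) =
    (fun t y => F i t y + \sum_(j <- r) F j t y).
  by apply/funext => t; apply/funext => y; rewrite big_cons.
rewrite !(e (fun j t y => tcoef W j w * _ j t * _ j y)).
apply: C12_withD; last exact: IH.
have [a1 a2 a3] := smooth2_derive (tT_smooth W i).
have [b1 b2 b3 b4 b5] := smooth3_derive (tX_smooth W i).
exact: C12_with_tensor.
Qed.

End derivatives.

Lemma near_box (R : realType) (t0 x0 a b c d : R) : a < t0 -> t0 < b -> c < x0 -> x0 < d ->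
  \forall p \near ((t0, x0) : R * R), [/\ a < p.1, p.1 < b, c < p.2 & p.2 < d].
Proof.
move=> h1 h2 h3 h4.
have ht : t0 \in `]a, b[ by rewrite in_itv /= h1.
have hx : x0 \in `]c, d[ by rewrite in_itv /= h3.
exists ([set t | t \in `]a, b[], [set x | x \in `]c, d[]).
  by split => /=; exact: near_in_itvoo.
by move=> [t x] /=; rewrite !in_itv /= => -[/andP[? ?] /andP[? ?]].
Qed.

(** * Comparison with smooth functions *)

Section comparison.
Context (R : realType) (lo up : R).

(* Testing with [C12_with] functions only makes the notion symmetric under
   [v |-> - v], which turns supersolutions into subsolutions and swaps [lo]
   and [up]. *)
Definition tested_subsolution (v : R -> R -> R) : Prop :=
  forall psi pt px pxx, C12_with psi pt px pxx -> forall t x : R, 0 < t ->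
    (\forall p \near ((t, x) : R * R), v p.1 p.2 - psi p.1 p.2 <= v t x - psi t x) ->
    pt t x - Gfun lo up (pxx t x) <= 0.

Lemma viscosity_tested_subsolution v : viscosity_subsolution lo up v -> tested_subsolution v.
Proof.
move=> hv psi pt px pxx hpsi t x t0 hmax.
have := hv psi (C12_with_C12 hpsi) t x t0 hmax.
by have [-> _ ->] := C12_with_derive hpsi.
Qed.

(** The smooth [psi] is itself a test function, which avoids doubling of variables: a positive
    maximum of [v - psi] over the box is interior by the boundary assumptions, and there the
    subsolution inequality contradicts strictness. The final time is part of the boundary because
    the maxima in the definition are two-sided in time. *)
Lemma comparison_core (v psi pt px pxx : R -> R -> R) (T B : R) :
  C12_with psi pt px pxx ->
  {within [set p : R * R | 0 <= p.1], continuous (fun p : R * R => v p.1 p.2)} ->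
  tested_subsolution v ->
  (forall t x, 0 < t -> t < T -> 0 < pt t x - Gfun lo up (pxx t x)) ->
  (forall x, v 0 x <= psi 0 x) -> (forall x, v T x <= psi T x) ->
  (forall t x, 0 <= t -> t <= T -> B <= `|x| -> v t x <= psi t x) ->
  forall t x, 0 <= t -> t <= T -> v t x <= psi t x.
Proof.
move=> hpsi vcont vsub strict h0 hT hB t x t0 tT.
rewrite leNgt; apply/negP => hlt.
have xB : `|x| < B by rewrite ltNge; apply/negP => /(hB t x t0 tT); rewrite leNgt hlt.
pose A : set (R * R) := `[0, T]%classic `*` `[- B, B]%classic.
pose F (p : R * R) := v p.1 p.2 - psi p.1 p.2.
have Atx : A (t, x).
  rewrite /A /= !in_itv /= t0 tT /=; split => //.
  by rewrite -ler_norml ltW.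
have cF : {within A, continuous F}.
  have cv : {within A, continuous (fun p : R * R => v p.1 p.2)}.
    apply: continuous_subspaceW vcont => -[r y] /= [+ _].
    by rewrite ?in_itv /= => /andP[].
  have cp : {within A, continuous (fun p : R * R => psi p.1 p.2)}.
    by apply: continuous_subspaceT; have [_ []] := hpsi.
  apply/subspace_continuousP => p Ap.
  move/subspace_continuousP: cv => /(_ p Ap) cv.
  move/subspace_continuousP: cp => /(_ p Ap) cp.
  exact: cvgB cv cp.
have Acomp : compact A by apply: compact_setX; exact: segment_compact.
have A0 : A !=set0 by exists (t, x).
have [[t1 x1] /set_mem Ac hmax] := compact_EVT_max A0 Acomp cF.
have hm r y : 0 <= r -> r <= T -> `|y| <= B -> v r y - psi r y <= v t1 x1 - psi t1 x1.
  move=> r0 rT yB; apply: (hmax (r, y)); apply/mem_set; rewrite /A /= !in_itv /= r0 rT.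
  by rewrite -ler_norml.
have pos : 0 < v t1 x1 - psi t1 x1.
  by apply: lt_le_trans (hm t x t0 tT (ltW xB)); rewrite subr_gt0.
move: Ac; rewrite /A /= !in_itv /= => -[/andP[t10 t1T] x1B].
have t1_gt0 : 0 < t1.
  rewrite lt_neqAle t10 andbT; apply/negP => /eqP e.
  by move: pos; rewrite -e subr_gt0 ltNge h0.
have t1_ltT : t1 < T.
  rewrite lt_neqAle t1T andbT; apply/negP => /eqP e.
  by move: pos; rewrite e subr_gt0 ltNge hT.
have x1_lt : - B < x1 < B.
  rewrite -ltr_norml ltNge; apply/negP => /(hB t1 x1 t10 t1T).
  by rewrite leNgt -subr_gt0 pos.
have /andP[x1_lo x1_hi] := x1_lt.
have near_max : \forall p \near ((t1, x1) : R * R),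
    v p.1 p.2 - psi p.1 p.2 <= v t1 x1 - psi t1 x1.
  have n1 := near_box t1_gt0 t1_ltT x1_lo x1_hi.
  near=> p.
  have [p1 p2 p3 p4] : [/\ 0 < p.1, p.1 < T, - B < p.2 & p.2 < B] by near: p.
  apply: hm; [exact: ltW|exact: ltW|].
  by rewrite ler_norml !ltW.
have := vsub psi pt px pxx hpsi t1 x1 t1_gt0 near_max.
by rewrite leNgt strict.
Unshelve. all: by end_near.
Qed.

End comparison.

(** * Barriers of polynomial growth *)

Section barriers.
Context (R : realType).

Definition bpow (n : nat) (x : R) : R := 1 + x ^+ (2 * n).+2.
Definition bpow1 (n : nat) (x : R) : R := (2 * n).+2%:R * x ^+ (2 * n).+1.
Definition bpow2 (n : nat) (x : R) : R :=
  (2 * n).+2%:R * ((2 * n).+1%:R * x ^+ (2 * n)).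
(** A rate for which [e^(brate t) bpow n] is a supersolution, by [bpow2_le]. *)
Definition brate (Lam : R) (n : nat) : R := Lam / 2 * ((2 * n).+2%:R * (2 * n).+1%:R).

Lemma bpow_ge1 n x : 1 <= bpow n x.
Proof. by rewrite lerDl; apply: exprn_even_ge0; rewrite /= negbK mul2n odd_double. Qed.

Lemma bpow2_ge0 n x : 0 <= bpow2 n x.
Proof.
rewrite /bpow2 !mulr_ge0 ?ler0n //.
by apply: exprn_even_ge0; rewrite mul2n odd_double.
Qed.

Lemma bpow2_le Lam n x : 0 <= Lam -> Lam / 2 * bpow2 n x <= brate Lam n * bpow n x.
Proof.
move=> Lam0; rewrite /brate /bpow2.
have h : x ^+ (2 * n) <= bpow n x.
  rewrite /bpow -[(2 * n).+2]addn2 exprD.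
  have : 0 <= x ^+ (2 * n) by apply: exprn_even_ge0; rewrite mul2n odd_double.
  case: (leP 1 (x ^+ 2)) => hx h0.
    have := ler_wpM2l h0 hx; lra.
  have -> : x ^+ (2 * n) = (x ^+ 2) ^+ n by rewrite exprM.
  have h1 : (x ^+ 2) ^+ n <= 1 by rewrite exprn_ile1 ?sqr_ge0 // ltW.
  have : 0 <= (x ^+ 2) ^+ n * x ^+ 2 by apply: mulr_ge0; [apply: exprn_ge0|]; exact: sqr_ge0.
  lra.
have -> : Lam / 2 * ((2 * n).+2%:R * ((2 * n).+1%:R * x ^+ (2 * n))) =
  Lam / 2 * ((2 * n).+2%:R * (2 * n).+1%:R) * x ^+ (2 * n) by ring.
apply: ler_wpM2l => //; apply: mulr_ge0; first by rewrite divr_ge0.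
by apply: mulr_ge0; exact: ler0n.
Qed.

Lemma is_derive_pow (n : nat) (x : R) : is_derive x 1 (fun y : R => y ^+ n.+1) (n.+1%:R * x ^+ n).
Proof.
have h := is_deriveX n.+1 (is_derive_id x (1 : R)).
have -> : (fun y : R => y ^+ n.+1) = (id : R -> R) ^+ n.+1.
  by apply/funext => y; rewrite exprfctE.
by apply: is_derive_eq; rewrite /GRing.scale /= mulr1.
Qed.

Lemma is_derive_cM (f : R -> R) (c x df : R) : is_derive x 1 f df ->
  is_derive x 1 (fun y => c * f y) (c * df).
Proof. by move=> hf; exact: (is_deriveZ c hf). Qed.

Lemma bpow_derive n (x : R) : is_derive x 1 (bpow n) (bpow1 n x).
Proof.
have h := is_deriveD (is_derive_cst (1 : R) x (1 : R)) (is_derive_pow (2 * n).+1 x).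
by rewrite add0r in h.
Qed.

Lemma bpow1_derive n (x : R) : is_derive x 1 (bpow1 n) (bpow2 n x).
Proof. exact: is_derive_cM (is_derive_pow (2 * n) x). Qed.

Lemma is_derive_expRM (lam t : R) :
  is_derive t 1 (fun t => expR (lam * t)) (lam * expR (lam * t)).
Proof.
have h : is_derive t 1 (fun t : R => lam * t) lam.
  have := is_derive_cM lam (is_derive_id t (1 : R)); by rewrite mulr1.
have := is_derive1_comp (is_derive_expR (lam * t)) h.
by rewrite mulrC.
Qed.

Lemma derive_continuous (f f1 : R -> R) : (forall x : R, is_derive x 1 f (f1 x)) ->
  continuous f.
Proof.
move=> hf x; apply: differentiable_continuous.
by apply/derivable1_diffP; have h := hf x; exact: ex_derive.
Qed.

Lemma monomial_continuous (a : R) k : continuous (fun x : R => a * x ^+ k).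
Proof.
move=> x.
have h1 : {for x, continuous (fun y : R => y ^+ k)} by exact: exprn_continuous.
have h2 : {for x, continuous (fun y : R => a)} by exact: cvg_cst.
have h := continuousM h2 h1.
exact: h.
Qed.

Lemma bpow2_continuous n : continuous (bpow2 n).
Proof.
have -> : bpow2 n = (fun x => ((2 * n).+2%:R * (2 * n).+1%:R) * x ^+ (2 * n)).
  by apply/funext => y; rewrite -mulrA.
exact: monomial_continuous.
Qed.

Lemma barrier_C12 (lam c : R) n :
  C12_with (fun t x => c * expR (lam * t) * bpow n x)
    (fun t x => c * (lam * expR (lam * t)) * bpow n x)
    (fun t x => c * expR (lam * t) * bpow1 n x)
    (fun t x => c * expR (lam * t) * bpow2 n x).
Proof.
have d (t : R) := is_derive_expRM lam t.
apply: C12_with_tensor => //; try exact: bpow_derive; try exact: bpow1_derive.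
- exact: derive_continuous d.
- by apply: derive_continuous => t; exact: is_derive_cM (d t).
- exact: derive_continuous (bpow_derive n).
- exact: derive_continuous (bpow1_derive n).
- exact: bpow2_continuous.
Qed.

Lemma time_C12 (a a1 : R -> R) (c : R) :
  (forall t : R, is_derive t 1 a (a1 t)) -> continuous a1 ->
  C12_with (fun t _ => c * a t * 1) (fun t _ => c * a1 t * 1)
   (fun t _ => c * a t * 0) (fun t _ => c * a t * 0).
Proof.
move=> ha ca1; apply: (C12_with_tensor (b := fun=> 1) (b1 := fun=> 0) (b2 := fun=> 0)) => //.
- exact: derive_continuous ha.
- by move=> x; exact: cvg_cst.
- by move=> x; exact: cvg_cst.
- by move=> x; exact: cvg_cst.
Qed.

(** A correction that depends on time only: an initial error [c], a drift [k], and a penalty that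
    vanishes up to time [T] and is quadratic afterwards. *)
Lemma clock_C12 (c k K T : R) : 0 <= K ->
  C12_with (fun t _ => 1 * (c + k * t + K * tp2 (t - T)) * 1)
    (fun t _ => 1 * (k + K * tp1 (t - T)) * 1)
    (fun t _ => 1 * (c + k * t + K * tp2 (t - T)) * 0)
    (fun t _ => 1 * (c + k * t + K * tp2 (t - T)) * 0).
Proof.
move=> K0; apply: (time_C12 (a := fun t => c + k * t + K * tp2 (t - T))
  (a1 := fun t => k + K * tp1 (t - T))).
  move=> t; apply: (is_derive_taylor K0) => e.
  have -> : t + e - T = (t - T) + e by ring.
  have -> : c + k * (t + e) + K * tp2 (t - T + e) - (c + k * t + K * tp2 (t - T))
    - e * (k + K * tp1 (t - T)) = K * (tp2 (t - T + e) - tp2 (t - T) - e * tp1 (t - T)) by ring.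
  rewrite normrM ger0_norm // ler_wpM2l //; apply: le_trans (tp2_taylor _ _) _.
  by rewrite lerDl exprn_ge0.
apply: (continuous_lip K0) => t e.
have -> : t + e - T = (t - T) + e by ring.
have -> : k + K * tp1 (t - T + e) - (k + K * tp1 (t - T)) =
  K * (tp1 (t - T + e) - tp1 (t - T)) by ring.
by rewrite normrM ger0_norm // ler_wpM2l // tp1_lip.
Qed.

Lemma bpow_growth (Cv CW eta : R) m : 0 <= Cv -> 0 <= CW -> 0 < eta ->
  exists2 B, 0 <= B & forall x, B <= `|x| -> Cv * (1 + `|x| ^+ m) + CW <= eta * bpow m x.
Proof.
move=> Cv0 CW0 eta0; exists (Num.max 1 ((2 * Cv + CW) / eta)); first by rewrite le_max ler01.
move=> x; rewrite ge_max => /andP[x1]; rewrite ler_pdivrMr // => x2.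
have xm : 1 <= `|x| ^+ m by rewrite exprn_ege1.
have h1 : Cv * (1 + `|x| ^+ m) + CW <= (2 * Cv + CW) * `|x| ^+ m.
  have : 0 <= (Cv + CW) * (`|x| ^+ m - 1) by apply: mulr_ge0; [exact: addr_ge0|rewrite subr_ge0].
  lra.
have h2 : (2 * Cv + CW) * `|x| ^+ m <= `|x| * eta * `|x| ^+ m by rewrite ler_wpM2r // exprn_ge0.
have h3 : `|x| ^+ m.+1 <= bpow m x.
  rewrite /bpow.
  have -> : x ^+ (2 * m).+2 = `|x| ^+ (2 * m).+2.
    by rewrite -normrX ger0_norm // exprn_even_ge0 //= negbK mul2n odd_double.
  apply: (@le_trans _ _ (`|x| ^+ (2 * m).+2)); last by rewrite lerDr.
  by rewrite ler_weXn2l // !ltnS (leq_trans (leq_pmull m (isT : (0 < 2)%N))).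
have h4 : eta * `|x| ^+ m.+1 <= eta * bpow m x by rewrite ler_wpM2l // ltW.
apply: le_trans h1 (le_trans h2 (le_trans _ h4)).
by rewrite exprS; have -> : `|x| * eta * `|x| ^+ m = eta * (`|x| * `|x| ^+ m) by ring.
Qed.

End barriers.

Section comparison_estimate.
Context (R : realType) (lo up : R).
Hypotheses (lo0 : 0 <= lo) (up0 : 0 <= up).

Let Lam := Num.max lo up.

Lemma Gfun_barrier (a b : R) : 0 <= b -> Gfun lo up (a + b) <= Gfun lo up a + Lam / 2 * b.
Proof.
move=> b0; have [c /andP[c0 c1]] := Gfun_slope lo0 up0 (a + b) a.
have := ler_wpM2r b0 c1; rewrite -/Lam => h e; move: e.
have -> : a + b - a = b by ring.
lra.
Qed.

(* The barriers absorb the growth of [v] at spatial infinity and the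
   penalty [K * tp2 (t - T)] keeps a positive maximum away from the final time. *)
Lemma subsolution_le (v W Wt Wx Wxx : R -> R -> R) (T Cv CW c eps e2 : R) (m n : nat) :
  0 <= T -> 0 <= Cv -> 0 <= c -> 0 < eps -> 0 <= e2 ->
  {within [set p : R * R | 0 <= p.1], continuous (fun p : R * R => v p.1 p.2)} ->
  (forall t x, 0 <= t <= T + 1 -> `|v t x| <= Cv * (1 + `|x| ^+ m)) ->
  tested_subsolution lo up v ->
  C12_with W Wt Wx Wxx -> (forall t x, `|W t x| <= CW) ->
  (forall t x, 0 < t -> t < T + 1 -> - eps <= Wt t x - Gfun lo up (Wxx t x)) ->
  (forall x, v 0 x <= W 0 x + c + e2 * bpow n x) ->
  forall x, v T x <= W T x + c + 2 * eps * T + e2 * expR (brate Lam n * T) * bpow n x.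
Proof.
move=> T0 Cv0 c0 eps0 e20 vcont vgrow vsub hW Wbd Wres v0 x.
have CW0 : 0 <= CW by exact: le_trans (normr_ge0 _) (Wbd 0 0).
have Lam0 : 0 <= Lam by rewrite le_max lo0.
(* The barrier [eta e^(brate t) bpow m] beats the growth of [v] at infinity; [eta] is arbitrary, and
   [eta'] is the value of this barrier at [(T, x)]. *)
apply/ler_addgt0Pr => eta' eta'0.
have qpos : 0 < expR (brate Lam m * T) * bpow m x.
  by rewrite mulr_gt0 ?expR_gt0 // (lt_le_trans ltr01) // bpow_ge1.
have [eta eta0 eta_def] : exists2 eta, 0 < eta & eta' = eta * expR (brate Lam m * T) * bpow m x.
  exists (eta' / (expR (brate Lam m * T) * bpow m x)); first by rewrite divr_gt0.
  by rewrite -mulrA divfK // gt_eqF.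
have [B B0 hB] := bpow_growth m Cv0 CW0 eta0.
(* [tp2 1 = 1/2], so the penalty at time [T + 1] is [K / 2], enough to dominate [v - W] on
   [|x| <= B]. *)
have [K K0 hK] : exists2 K, 0 <= K & K / 2 = Cv * (1 + B ^+ m) + CW.
  exists (2 * (Cv * (1 + B ^+ m) + CW)); last by field.
  by rewrite mulr_ge0 // addr_ge0 // mulr_ge0 // addr_ge0 // exprn_ge0.
(* The drift [2 eps] outweighs the residual of [W], which is at least [- eps]; the sum is a strict
   supersolution. *)
have hpsi := C12_withD (C12_withD hW (clock_C12 c (2 * eps) T K0))
  (C12_withD (barrier_C12 (brate Lam n) e2 n) (barrier_C12 (brate Lam m) eta m)).
have rate0 k t : 0 <= t -> 1 <= expR (brate Lam k * t).
  move=> t0; rewrite -expR0 ler_expR mulr_ge0 // /brate; apply: mulr_ge0; first by rewrite divr_ge0.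
  by apply: mulr_ge0; exact: ler0n.
have bar0 a k t y : 0 <= a -> 0 <= t -> 0 <= a * expR (brate Lam k * t) * bpow k y.
  move=> a0 t0; rewrite !mulr_ge0 ?expR_ge0 //; exact: le_trans ler01 (bpow_ge1 _ _).
have bar1 t y : 0 <= t -> eta * bpow m y <= eta * expR (brate Lam m * t) * bpow m y.
  move=> t0; rewrite ler_wpM2r //; first exact: le_trans ler01 (bpow_ge1 _ _).
  by rewrite ler_peMr ?rate0 // ltW.
have far t y : 0 <= t <= T + 1 -> B <= `|y| -> v t y - W t y <= eta * bpow m y.
  move=> t01 yB; apply: le_trans (hB y yB).
  have := vgrow t y t01; have := Wbd t y; rewrite !ler_norml => /andP[w1 w2] /andP[v1 v2].
  lra.
have tp20 t : 0 <= tp2 t by rewrite /tp2 divr_ge0 // sqr_ge0.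
apply: le_trans (comparison_core (T := T + 1) (B := B) hpsi vcont vsub _ _ _ _ x T0 _) _ => /=.
- move=> t y t0 tT.
  have bar2 a k : 0 <= a -> 0 <= a * expR (brate Lam k * t) * bpow2 k y.
    by move=> a0; apply: mulr_ge0 (bpow2_ge0 k y); rewrite mulr_ge0 ?expR_ge0.
  have b0 := bar2 e2 n e20; have b1 := bar2 eta m (ltW eta0).
  have hG := Gfun_barrier (Wxx t y) (addr_ge0 b0 b1).
  have k1 k a : 0 <= a -> Lam / 2 * (a * expR (brate Lam k * t) * bpow2 k y) <=
      a * (brate Lam k * expR (brate Lam k * t)) * bpow k y.
    move=> a0; have -> : Lam / 2 * (a * expR (brate Lam k * t) * bpow2 k y) =
      (a * expR (brate Lam k * t)) * (Lam / 2 * bpow2 k y) by ring.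
    have -> : a * (brate Lam k * expR (brate Lam k * t)) * bpow k y =
      (a * expR (brate Lam k * t)) * (brate Lam k * bpow k y) by ring.
    by rewrite ler_wpM2l ?bpow2_le // mulr_ge0 ?expR_ge0.
  have k2 := k1 n e2 e20; have k3 := k1 m eta (ltW eta0).
  have w := Wres t y t0 tT.
  have tp10 : 0 <= K * tp1 (t - T) by rewrite mulr_ge0 // /tp1 le_max lexx orbT.
  have -> : Wxx t y + 1 * (c + 2 * eps * t + K * tp2 (t - T)) * 0 +
    (e2 * expR (brate Lam n * t) * bpow2 n y + eta * expR (brate Lam m * t) * bpow2 m y) =
    Wxx t y + (e2 * expR (brate Lam n * t) * bpow2 n y + eta * expR (brate Lam m * t) * bpow2 m y)
    by ring.
  move: hG k2 k3 w tp10; lra.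
- move=> y; have h := v0 y; have h1 := bar0 eta m 0 y (ltW eta0) (lexx 0).
  have h2 : 0 <= K * tp2 (0 - T) by rewrite mulr_ge0.
  have -> : e2 * expR (brate Lam n * 0) * bpow n y = e2 * bpow n y by rewrite mulr0 expR0 mulr1.
  lra.
- move=> y; have T10 : 0 <= T + 1 by rewrite addr_ge0.
  have h1 := bar0 e2 n (T + 1) y e20 T10; have h2 := bar1 (T + 1) y T10.
  have eT : 0 <= 2 * eps * (T + 1) by rewrite !mulr_ge0 // ltW.
  have e : tp2 (T + 1 - T) = 1 / 2.
    have -> : T + 1 - T = 1 :> R by ring.
    by have [_ -> _] := tp_pos (ler01 : (0 : R) <= 1); rewrite expr1n.
  rewrite e; have hT : 0 <= T + 1 <= T + 1 by rewrite T10 lexx.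
  case: (leP B `|y|) => hy.
    have := far (T + 1) y hT hy; have : 0 <= K * (1 / 2) by rewrite mulr_ge0.
    lra.
  have h3 : Cv * (1 + `|y| ^+ m) <= Cv * (1 + B ^+ m).
    by rewrite ler_wpM2l // lerD2l lerXn2r ?nnegrE // ltW.
  have := vgrow (T + 1) y hT; have := Wbd (T + 1) y; rewrite !ler_norml => /andP[w1 w2] /andP[v1 v2].
  have h4 : 0 <= eta * bpow m y by rewrite mulr_ge0 ?(ltW eta0) // (le_trans ler01) // bpow_ge1.
  lra.
- move=> t y t0 tT yB.
  have h1 := bar0 e2 n t y e20 t0; have h2 := bar1 t y t0.
  have eT : 0 <= 2 * eps * t by rewrite !mulr_ge0 // ltW.
  have h3 : 0 <= K * tp2 (t - T) by rewrite mulr_ge0.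
  have t01 : 0 <= t <= T + 1 by rewrite t0.
  have := far t y t01 yB.
  lra.
- by rewrite lerDl.
- have -> : tp2 (T - T) = 0 by rewrite subrr; have [_ -> _] := tp_neg (lexx (0 : R)).
  rewrite eta_def; lra.
Qed.

End comparison_estimate.

Lemma C12_withN (R : realType) (psi pt px pxx : R -> R -> R) : C12_with psi pt px pxx ->
  C12_with (fun t x => - psi t x) (fun t x => - pt t x)
    (fun t x => - px t x) (fun t x => - pxx t x).
Proof.
move=> [h [c0 c1 c2 c3]]; split.
  by move=> t x; have [h1 h2 h3] := h t x; split; exact: is_deriveN.
split=> p; apply: continuousN.
- exact: c0.
- exact: c1.
- exact: c2.
- exact: c3.
Qed.

Lemma supersolution_testedN (R : realType) (lo up : R) v : viscosity_supersolution lo up v ->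
  tested_subsolution up lo (fun t x => - v t x).
Proof.
move=> hv psi pt px pxx hpsi t x t0 hmax.
have hN := C12_withN hpsi.
have := hv _ (C12_with_C12 hN) t x t0 _.
have [-> _ ->] := C12_with_derive hN; rewrite GfunN => h.
suff : 0 <= - pt t x - - Gfun up lo (pxx t x) by lra.
by apply: h; apply: filterS hmax => p; lra.
Qed.

(** The upper bound is [subsolution_le] for [v]; the lower bound is [subsolution_le] for [- v] and
    [- W], which belong to the equation with [lo] and [up] exchanged. *)
Lemma viscosity_close (R : realType) (lo up : R) (v W Wt Wx Wxx : R -> R -> R) (phi : R -> R)
    (T CW c eps e2 : R) (n : nat) :
  0 <= lo -> 0 <= up -> 0 <= T -> 0 <= c -> 0 < eps -> 0 <= e2 ->
  viscosity_solution lo up phi v -> C12_with W Wt Wx Wxx -> (forall t x, `|W t x| <= CW) ->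
  (forall t x, 0 < t -> t < T + 1 -> `|Wt t x - Gfun lo up (Wxx t x)| <= eps) ->
  (forall x, `|phi x - W 0 x| <= c + e2 * bpow n x) ->
  forall x, `|v T x - W T x| <=
    c + 2 * eps * T + e2 * expR (brate (Num.max lo up) n * T) * bpow n x.
Proof.
move=> lo0 up0 T0 c0 eps0 e20 [vcont vgrow vinit vsub vsup] hW Wbd Wres W0 x.
have [Cv [m vb]] := vgrow (T + 1).
have T10 : 0 <= T + 1 by rewrite addr_ge0.
have Cv0 : 0 <= Cv.
  have := vb 0 1; rewrite lexx T10 normr1 expr1n => /(_ isT) h.
  have := le_trans (normr_ge0 _) h; lra.
have h1 := subsolution_le lo0 up0 T0 Cv0 c0 eps0 e20 vcont vb
  (viscosity_tested_subsolution vsub) hW Wbd.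
have vNcont : {within [set p : R * R | 0 <= p.1], continuous (fun p : R * R => - v p.1 p.2)}.
  by move=> p; apply: continuousN; exact: vcont.
have vNb t y : 0 <= t <= T + 1 -> `|- v t y| <= Cv * (1 + `|y| ^+ m).
  by rewrite normrN; exact: vb.
have WNbd t y : `|- W t y| <= CW by rewrite normrN.
have h2 := subsolution_le up0 lo0 T0 Cv0 c0 eps0 e20 vNcont vNb
  (supersolution_testedN vsup) (C12_withN hW) WNbd.
rewrite ler_norml; apply/andP; split.
- rewrite maxC; have := h2 n _ _ x; rewrite /= => h; rewrite lerNl.
  suff : - v T x <= - W T x + c + 2 * eps * T + e2 * expR (brate (Num.max up lo) n * T) * bpow n x by lra.
  apply: h => [t y t0 tT|y].
    by rewrite GfunN; have := Wres t y t0 tT; rewrite ler_norml => /andP[]; lra.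
  by have := W0 y; rewrite vinit ler_norml => /andP[]; lra.
- suff : v T x <= W T x + c + 2 * eps * T + e2 * expR (brate (Num.max lo up) n * T) * bpow n x by lra.
  apply: h1 => [t y t0 tT|y].
    by have := Wres t y t0 tT; rewrite ler_norml => /andP[].
  by have := W0 y; rewrite vinit ler_norml => /andP[]; lra.
Qed.

Section local_maxima.
Context (R : realType).

Lemma nbhs_box (P : R * R -> Prop) (t0 x0 : R) : (\forall p \near ((t0, x0) : R * R), P p) ->
  exists2 r : R, 0 < r & forall t x, `|t - t0| <= r -> `|x - x0| <= r -> P (t, x).
Proof.
move=> /nbhs_ballP[r /= r0 h]; exists (r / 2); first by rewrite divr_gt0.
have r2 : r / 2 < r by lra.
move=> t x ht hx; apply: h; split; rewrite /ball /= /ball_ distrC.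
- exact: le_lt_trans ht r2.
- exact: le_lt_trans hx r2.
Qed.

Lemma mean_value (f f1 : R -> R) : (forall x : R, is_derive x 1 f (f1 x)) ->
  forall x y, exists2 c, `|c - x| <= `|y - x| & f y - f x = f1 c * (y - x).
Proof.
move=> hf x y.
have cont a b : {within `[a, b], continuous f}.
  by apply: continuous_subspaceT; exact: derive_continuous hf.
have hd a b z (h : z \in `]a, b[) := hf z.
case: (leP x y) => xy.
- have [c + e] := MVT_segment xy (hd x y) (cont x y).
  rewrite in_itv /= => /andP[c1 c2]; exists c => //.
  by rewrite !ger0_norm ?subr_ge0 // lerB.
- have [c + e] := MVT_segment (ltW xy) (hd y x) (cont y x).
  rewrite in_itv /= => /andP[c1 c2]; exists c; last first.
    by rewrite -opprB e; ring.
  rewrite !ler0_norm ?subr_le0 ?(ltW xy) //; lra.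
Qed.

Lemma max_is_derive0 (f : R -> R) (f1 x0 r : R) : 0 < r ->
  (forall x : R, `|x - x0| < r -> derivable f x 1) -> is_derive x0 1 f f1 ->
  (forall x, `|x - x0| < r -> f x <= f x0) -> f1 = 0.
Proof.
move=> r0 df d1 hmax.
have bx z : z \in `]x0 - r, x0 + r[ -> `|z - x0| < r.
  rewrite in_itv /= => /andP[z1 z2]; rewrite ltr_norml; apply/andP; split; lra.
have d0 : is_derive x0 1 f 0.
  apply: (@derive1_at_max _ f (x0 - r) (x0 + r)).
  - lra.
  - by move=> z /bx; exact: df.
  - rewrite in_itv /=; apply/andP; split; lra.
  - by move=> z /bx; exact: hmax.
by rewrite -(@derive_val _ _ _ _ _ _ _ d1) (@derive_val _ _ _ _ _ _ _ d0).
Qed.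

(** [f1 x0 = 0]; if [f2] were positive, [f1] would be positive just to the right of [x0], and by the
    mean value theorem [f] would exceed its maximum. *)
Lemma max_derive2_le0 (f f1 : R -> R) (f2 x0 r : R) : 0 < r ->
  (forall x : R, is_derive x 1 f (f1 x)) -> is_derive x0 1 f1 f2 ->
  (forall x, `|x - x0| < r -> f x <= f x0) -> f2 <= 0.
Proof.
move=> r0 df d2 hmax; rewrite leNgt; apply/negP => f2_gt0.
have f10 : f1 x0 = 0.
  apply: (max_is_derive0 r0 _ (df x0) hmax) => x _; have h := df x; exact: ex_derive.
have cv : h^-1 *: ((f1 \o shift x0) (h *: (1 : R)) - f1 x0) @[h --> (0 : R)^'] --> f2.
  by rewrite -(@derive_val _ _ _ _ _ _ _ d2); exact: (@ex_derive _ _ _ _ _ _ _ d2).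
have pos : \forall h \near (0 : R)^', 0 < h^-1 *: ((f1 \o shift x0) (h *: (1 : R)) - f1 x0).
  by apply: (cvgr_gt f2 cv).
move: pos => /nbhs_ballP[d /= d0 hd].
have [e [e0 ed er]] : exists e, [/\ 0 < e, e < d & e < r].
  exists (Num.min d r / 2); have m0 : 0 < Num.min d r by rewrite lt_min d0.
  have m1 : Num.min d r <= d by rewrite ge_min lexx.
  have m2 : Num.min d r <= r by rewrite ge_min lexx orbT.
  split; lra.
have xe : x0 < x0 + e by rewrite ltrDl.
have cont : {within `[x0, x0 + e], continuous f}.
  by apply: continuous_subspaceT; exact: derive_continuous df.
have [c + hc] := MVT xe (fun z _ => df z) cont.
rewrite in_itv /= => /andP[c1 c2].
have f1c : 0 < f1 c.
  have ch : ball (0 : R) d (c - x0).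
    rewrite /ball /= /ball_ sub0r normrN ger0_norm; lra.
  have cn0 : c - x0 != 0 by rewrite subr_eq0 gt_eqF.
  have := hd _ ch cn0; rewrite /= /GRing.scale /= mulr1 subrK f10 subr0.
  by rewrite pmulr_rgt0 // invr_gt0 subr_gt0.
have : f (x0 + e) <= f x0 by apply: hmax; rewrite addrAC subrr add0r gtr0_norm.
rewrite -subr_le0 hc leNgt mulr_gt0 //; lra.
Qed.

End local_maxima.

(** * Stability of viscosity solutions *)

Section stability.
Context (R : realType).

Definition C12_pos (psi pt px pxx : R -> R -> R) : Prop :=
  forall t x : R, 0 < t ->
  [/\ is_derive t 1 (psi^~ x) (pt t x), is_derive x 1 (psi t) (px t x)
    & is_derive x 1 (px t) (pxx t x)] /\
  [/\ {for (t, x), continuous (fun p : R * R => pt p.1 p.2)},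
      {for (t, x), continuous (fun p : R * R => px p.1 p.2)}
    & {for (t, x), continuous (fun p : R * R => pxx p.1 p.2)}].

Lemma C12_posP (psi : R -> R -> R) : C12 psi -> C12_pos psi (dt psi) (dx psi) (dxx psi).
Proof.
move=> h t x t0; have [[d1 d2 d3] [c1 c2 c3]] := h t x t0.
split; last by split; [exact: c1|exact: c2|exact: c3].
split.
- by have := derivableP d1; rewrite -derive1E.
- by have := derivableP d2; rewrite -derive1E.
- by have := derivableP d3; rewrite -derive1E.
Qed.

Lemma C12_posN (psi pt px pxx : R -> R -> R) : C12_pos psi pt px pxx ->
  C12_pos (fun t x => - psi t x) (fun t x => - pt t x)
    (fun t x => - px t x) (fun t x => - pxx t x).
Proof.
move=> h t x t0; have [[d1 d2 d3] [c1 c2 c3]] := h t x t0.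
by split; split; [exact: is_deriveN|exact: is_deriveN|exact: is_deriveN
  |exact: continuousN c1|exact: continuousN c2|exact: continuousN c3].
Qed.

(** Joint continuity of [psi] itself comes from continuity in time at the fixed [x] and a local
    bound on the space derivative, by the mean value theorem in [x]. *)
Lemma C12_pos_continuous (psi pt px pxx : R -> R -> R) (t x : R) : C12_pos psi pt px pxx ->
  0 < t -> {for (t, x), continuous (fun p : R * R => psi p.1 p.2)}.
Proof.
move=> h t0; have [[d1 _ _] [_ c2 _]] := h t x t0.
have ct : {for t, continuous (psi^~ x)}.
  by apply: differentiable_continuous; apply/derivable1_diffP; exact: ex_derive.
apply/cvgrPdist_le => /= eps eps0.
have A0 : 0 < `|px t x| + 1 by rewrite ltr_pwDr.
have bd : \forall p \near ((t, x) : R * R), `|px p.1 p.2| <= `|px t x| + 1.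
  move/cvgrPdist_le: c2 => /(_ 1 ltr01); apply: filterS => p /= hp.
  by have := ler_normB (px t x) (px t x - px p.1 p.2); rewrite subKr; lra.
have [r r0 hr] := nbhs_box bd.
have n1 : \forall p \near ((t, x) : R * R), `|psi t x - psi p.1 x| <= eps / 2.
  have e2 : 0 < eps / 2 by lra.
  have := ct; move/cvgrPdist_le => /(_ _ e2) /nbhs_ballP[d /= d0 hd].
  by apply/nbhs_ballP; exists d => // p [p1 _]; exact: hd.
have [q [q0 qr qe]] : exists q : R, [/\ 0 < q, q <= r & (`|px t x| + 1) * q <= eps / 2].
  exists (Num.min r (eps / 2 / (`|px t x| + 1))); split.
  - by rewrite lt_min r0 divr_gt0 //; lra.
  - by rewrite ge_min lexx.
  - by rewrite mulrC -ler_pdivlMr // ge_min lexx orbT.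
have tq : t - Num.min q t < t by rewrite ltrBlDr ltrDl lt_min q0.
have n2 := @near_box R t x (t - Num.min q t) (t + q) (x - q) (x + q) tq
  ltac:(lra) ltac:(lra) ltac:(lra).
have key (t' x' : R) : `|psi t x - psi t' x| <= eps / 2 ->
    [/\ t - Num.min q t < t', t' < t + q, x - q < x' & x' < x + q] ->
    `|psi t x - psi t' x'| <= eps.
  move=> h1 [p1 p2 p3 p4] {n1 n2 bd ct c2 d1}.
  have m1 : Num.min q t <= q by rewrite ge_min lexx.
  have m2 : Num.min q t <= t by rewrite ge_min lexx orbT.
  have p10 : 0 < t' by lra.
  have dp (z : R) : is_derive z 1 (psi t') (px t' z) by have [[]] := h t' z p10.
  have xq : `|x' - x| <= q by rewrite ler_distl; apply/andP; split; lra.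
  have [c hc e] := mean_value dp x x'.
  have hpx : `|px t' c| <= `|px t x| + 1.
    apply: (hr t' c); last by apply: le_trans hc (le_trans xq qr).
    by rewrite ler_distl; apply/andP; split; lra.
  have h2 : `|psi t' x' - psi t' x| <= eps / 2.
    by rewrite e normrM (le_trans _ qe) // ler_pM.
  have -> : psi t x - psi t' x' = (psi t x - psi t' x) - (psi t' x' - psi t' x) by ring.
  by apply: le_trans (ler_normB _ _) _; lra.
near=> p; apply: key; first by near: p.
by near: p.
Unshelve. all: by end_near.
Qed.

Lemma is_derive_quadratic (kappa a x : R) :
  is_derive x 1 (fun y : R => kappa * (y - a) ^+ 2) (kappa * (2 * (x - a))).
Proof.
apply: (is_derive_taylor (normr_ge0 kappa)) => e.
have -> : kappa * (x + e - a) ^+ 2 - kappa * (x - a) ^+ 2 - e * (kappa * (2 * (x - a))) =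
  kappa * e ^+ 2 by ring.
by rewrite normrM (ger0_norm (sqr_ge0 e)) ler_wpM2l // lerDl exprn_ge0.
Qed.

Lemma perturbed_maximum (W Wt Wx Wxx psi pt px pxx : R -> R -> R) (k t0 x0 t1 x1 s : R) :
  C12_with W Wt Wx Wxx -> C12_pos psi pt px pxx -> 0 < t1 -> 0 < s -> s <= t1 ->
  (forall t x : R, `|t - t1| < s -> `|x - x1| < s ->
     W t x - psi t x - k * (t - t0) ^+ 2 - k * (x - x0) ^+ 2 <=
     W t1 x1 - psi t1 x1 - k * (t1 - t0) ^+ 2 - k * (x1 - x0) ^+ 2) ->
  Wt t1 x1 = pt t1 x1 + k * (2 * (t1 - t0)) /\ Wxx t1 x1 <= pxx t1 x1 + 2 * k.
Proof.
move=> [hd _] hpsi t1_gt0 s0 st1 hm.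
have z (a : R) : `|a - a| < s by rewrite subrr normr0.
split.
  have dF (t : R) : 0 < t -> is_derive t 1 (fun t : R => W t x1 - psi t x1 - k * (t - t0) ^+ 2
      - k * (x1 - x0) ^+ 2) (Wt t x1 - pt t x1 - k * (2 * (t - t0)) - 0).
    move=> tpos; have [w1 _ _] := hd t x1; have [[p1 _ _] _] := hpsi t x1 tpos.
    exact: is_deriveB (is_deriveB (is_deriveB w1 p1) (is_derive_quadratic k t0 t)) (is_derive_cst _ _ _).
  have h0 := max_is_derive0 s0 _ (dF t1 t1_gt0) _.
  suff : Wt t1 x1 - pt t1 x1 - k * (2 * (t1 - t0)) - 0 = 0 by lra.
  apply: h0 => t ht.
    have tpos : 0 < t by move: ht; rewrite ltr_norml => /andP[]; lra.
    have d := dF t tpos; exact: ex_derive.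
  exact: hm.
have dF (x : R) : is_derive x 1 (fun x : R => W t1 x - psi t1 x - k * (t1 - t0) ^+ 2
    - k * (x - x0) ^+ 2) (Wx t1 x - px t1 x - 0 - k * (2 * (x - x0))).
  have [_ w1 _] := hd t1 x; have [[_ p1 _] _] := hpsi t1 x t1_gt0.
  exact: is_deriveB (is_deriveB (is_deriveB w1 p1) (is_derive_cst _ _ _)) (is_derive_quadratic k x0 x).
have dlin : is_derive x1 1 (fun x : R => k * (2 * (x - x0))) (2 * k).
  apply: (is_derive_taylor (lexx 0)) => e.
  have -> : k * (2 * (x1 + e - x0)) - k * (2 * (x1 - x0)) - e * (2 * k) = 0 by ring.
  by rewrite normr0 mul0r.
have dF1 : is_derive x1 1 (fun x : R => Wx t1 x - px t1 x - 0 - k * (2 * (x - x0)))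
    (Wxx t1 x1 - pxx t1 x1 - 0 - 2 * k).
  have [_ _ w1] := hd t1 x1; have [[_ _ p1] _] := hpsi t1 x1 t1_gt0.
  exact: is_deriveB (is_deriveB (is_deriveB w1 p1) (is_derive_cst _ _ _)) dlin.
suff : Wxx t1 x1 - pxx t1 x1 - 0 - 2 * k <= 0 by lra.
by apply: (max_derive2_le0 s0 dF dF1) => x hx; exact: hm.
Qed.

Variables (lo up : R).
Hypotheses (lo0 : 0 <= lo) (up0 : 0 <= up).

Definition almost_solution (T eps : R) (W : R -> R -> R) : Prop :=
  exists Wt Wx Wxx, C12_with W Wt Wx Wxx /\
    forall t x : R, 0 < t -> t <= T -> `|Wt t x - Gfun lo up (Wxx t x)| <= eps.

(* Adding a small quadratic to [psi] makes the maximum of [u - psi] strict, so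
   that [W - psi] has a nearby interior maximum. *)
Lemma stable_subsolution (u psi pt px pxx : R -> R -> R) (t0 x0 : R) :
  (forall T B eps : R, 0 < T -> 0 < B -> 0 < eps -> exists2 W, almost_solution T eps W &
     forall t x : R, 0 < t -> t <= T -> `|x| <= B -> `|u t x - W t x| <= eps) ->
  C12_pos psi pt px pxx -> 0 < t0 ->
  (\forall p \near ((t0, x0) : R * R), u p.1 p.2 - psi p.1 p.2 <= u t0 x0 - psi t0 x0) ->
  pt t0 x0 - Gfun lo up (pxx t0 x0) <= 0.
Proof.
move=> happ hpsi t0_gt0 hmax; rewrite leNgt; apply/negP.
set del := pt t0 x0 - _ => del0.
set Lam := Num.max lo up.
have Lam0 : 0 <= Lam by rewrite le_max lo0.
have [_ [c1 _ c3]] := hpsi t0 x0 t0_gt0.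
have near_res : \forall p \near ((t0, x0) : R * R),
    del / 2 <= pt p.1 p.2 - Gfun lo up (pxx p.1 p.2).
  have d4 : 0 < del / 4 by lra.
  have d5 : 0 < del / 4 / (Lam / 2 + 1) by rewrite divr_gt0 //; lra.
  move/cvgrPdist_le: c1 => /(_ _ d4) n1; move/cvgrPdist_le: c3 => /(_ _ d5) n3.
  apply: filterS2 n1 n3 => p /= h1 h3.
  have := Gfun_lip (pxx t0 x0) (pxx p.1 p.2) lo0 up0; rewrite -/Lam.
  move: h3; rewrite ler_pdivlMr; last lra.
  move: h1; rewrite !ler_norml => /andP[h1 h1'] h3 /andP[h4 h5].
  have := normr_ge0 (pxx t0 x0 - pxx p.1 p.2).
  rewrite /del; move: h1 h1' h3 h4 h5; rewrite /del; lra.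
have [r1 r10 hr1] := nbhs_box hmax; have [r2 r20 hr2] := nbhs_box near_res.
have [r [r0 rr1 rr2 r_1 r_t]] :
    exists r : R, [/\ 0 < r, r <= r1, r <= r2, r <= 1 & r < t0].
  exists (Num.min (Num.min r1 r2) (Num.min 1 (t0 / 2))); split.
  - by rewrite !lt_min r10 r20 ltr01 divr_gt0.
  - by rewrite !ge_min lexx.
  - by rewrite !ge_min lexx orbT.
  - by rewrite !ge_min lexx !orbT.
  - have : t0 / 2 < t0 by lra.
    by apply: le_lt_trans; rewrite !ge_min lexx !orbT.
(* At the perturbed maximum the quadratics change the residual by at most [k (2 + Lam)]: at most
   [2 k] in the time derivative, as [r <= 1], and [2 k] in the second space derivative. *)
have [k k0 hk] : exists2 k : R, 0 < k & k * (2 + Lam) <= del / 4.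
  exists (del / 4 / (2 + Lam)); first by rewrite !divr_gt0 //; lra.
  by rewrite divfK // gt_eqF //; lra.
have kr0 : 0 < k * r ^+ 2 by rewrite mulr_gt0 // exprn_gt0.
(* [2 eps < k r^2] keeps the maximum of [F] off the boundary of the box, and [eps < del / 4]
   contradicts the residual that remains there. *)
have [eps [eps0 eps1 eps2]] : exists eps : R, [/\ 0 < eps, 2 * eps < k * r ^+ 2 & eps < del / 4].
  have [m [m0 m1 m2]] : exists m : R, [/\ 0 < m, m <= k * r ^+ 2 & m <= del].
    exists (Num.min (k * r ^+ 2) del); split; last 2 first.
    - by rewrite ge_min lexx.
    - by rewrite ge_min lexx orbT.
    - by rewrite lt_min kr0.
  exists (m / 8); have m8 : 0 < m / 8 by rewrite divr_gt0.
  have -> : k * r ^+ 2 = m / 8 * 8 + (k * r ^+ 2 - m) by field.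
  by split => //; lra.
have B0 : 0 < `|x0| + r by rewrite ltr_wpDl.
have [W [Wt [Wx [Wxx [hW hres]]]] hclose] := happ (t0 + r) _ eps (addr_gt0 t0_gt0 r0) B0 eps0.
have close (t x : R) : `|t - t0| <= r -> `|x - x0| <= r -> `|u t x - W t x| <= eps.
  move=> ht hx; apply: hclose.
  - by move: ht; rewrite ler_norml => /andP[]; lra.
  - by move: ht; rewrite ler_norml => /andP[]; lra.
  - by rewrite -(subrKC x0 x) (le_trans (ler_normD _ _)) // lerD2l.
pose F (p : R * R) := W p.1 p.2 - psi p.1 p.2 - k * (p.1 - t0) ^+ 2 - k * (p.2 - x0) ^+ 2.
pose A : set (R * R) := `[t0 - r, t0 + r]%classic `*` `[x0 - r, x0 + r]%classic.
have inA (t x : R) : A (t, x) <-> `|t - t0| <= r /\ `|x - x0| <= r.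
  rewrite /A /= !in_itv /= !ler_distl; split.
    by move=> [/andP[a1 a2] /andP[a3 a4]]; split; apply/andP; split.
  by move=> [/andP[a1 a2] /andP[a3 a4]]; split; apply/andP; split.
have Acomp : compact A by apply: compact_setX; exact: segment_compact.
have Ac : A (t0, x0) by apply/inA; split; rewrite subrr normr0 ltW.
have pos_t (t x : R) : A (t, x) -> 0 < t.
  by move/inA => [+ _]; rewrite ler_norml => /andP[]; lra.
have cF : {within A, continuous F}.
  apply: continuous_in_subspaceT => -[t x] /set_mem /pos_t tpos.
  have q1 : {for (t, x), continuous (fun p : R * R => k * (p.1 - t0) ^+ 2)}.
    apply: (continuous_comp (f := fst) (g := fun y : R => k * (y - t0) ^+ 2)); first exact: cvg_fst.
    by apply: derive_continuous => y; exact: is_derive_quadratic.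
  have q2 : {for (t, x), continuous (fun p : R * R => k * (p.2 - x0) ^+ 2)}.
    apply: (continuous_comp (f := snd) (g := fun y : R => k * (y - x0) ^+ 2)); first exact: cvg_snd.
    by apply: derive_continuous => y; exact: is_derive_quadratic.
  have q3 := C12_pos_continuous (x := x) hpsi tpos.
  have q4 : {for (t, x), continuous (fun p : R * R => W p.1 p.2)} by have [_ [cW _ _ _]] := hW; exact: cW.
  exact: continuousB (continuousB (continuousB q4 q3) q1) q2.
have A0 : A !=set0 by exists (t0, x0).
have [[t1 x1] /set_mem A1 hm] := compact_EVT_max A0 Acomp cF.
have hmF (t x : R) : `|t - t0| <= r -> `|x - x0| <= r -> F (t, x) <= F (t1, x1).
  by move=> ht hx; apply: hm; apply/mem_set/inA.
have [t1r x1r] := (inA t1 x1).1 A1; have t1_gt0 := pos_t t1 x1 A1.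
have F0 : u t0 x0 - psi t0 x0 - eps <= F (t0, x0).
  have z : 0 <= r by exact: ltW.
  have := close t0 x0; rewrite /F /= !subrr normr0 expr0n /= mulr0 !subr0 => /(_ z z).
  by rewrite ler_norml => /andP[]; clear; lra.
have F1 : F (t1, x1) <= u t0 x0 - psi t0 x0 + eps - k * (t1 - t0) ^+ 2 - k * (x1 - x0) ^+ 2.
  have := hr1 t1 x1 (le_trans t1r rr1) (le_trans x1r rr1) => /= h1.
  have := close t1 x1 t1r x1r; rewrite ler_norml /F /= => /andP[]; move: h1; clear; lra.
have FF := hmF t0 x0 ltac:(by rewrite subrr normr0 ltW) ltac:(by rewrite subrr normr0 ltW).
have sq_lt (y : R) : k * y ^+ 2 < k * r ^+ 2 -> `|y| < r.
  rewrite ltr_pM2l // -(normr_id y) -[y ^+ 2]real_normK ?num_real // => h.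
  by rewrite -(ltr_pXn2r (n := 2)) ?nnegrE ?(ltW r0) // normr_id.
have kt : 0 <= k * (t1 - t0) ^+ 2 by rewrite mulr_ge0 ?(ltW k0) // sqr_ge0.
have kx : 0 <= k * (x1 - x0) ^+ 2 by rewrite mulr_ge0 ?(ltW k0) // sqr_ge0.
have t1lt : `|t1 - t0| < r by apply: sq_lt; move: FF F0 F1 kx eps1; clear; lra.
have x1lt : `|x1 - x0| < r by apply: sq_lt; move: FF F0 F1 kt eps1; clear; lra.
have [s s0 [st sx]] : exists2 s : R, 0 < s & (s <= r - `|t1 - t0|) /\ (s <= r - `|x1 - x0|).
  exists (Num.min (r - `|t1 - t0|) (r - `|x1 - x0|)); first by rewrite lt_min !subr_gt0 t1lt.
  by split; rewrite ge_min lexx // orbT.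
have st1 : s <= t1.
  by have := ler_norm (t0 - t1); rewrite distrC; move: st r_t; clear; lra.
have mF (t x : R) : `|t - t1| < s -> `|x - x1| < s -> F (t, x) <= F (t1, x1).
  move=> ht hx; apply: hmF.
    have -> : t - t0 = (t - t1) + (t1 - t0) by ring.
    by apply: le_trans (ler_normD _ _) _; move: ht st; clear; lra.
  have -> : x - x0 = (x - x1) + (x1 - x0) by ring.
  by apply: le_trans (ler_normD _ _) _; move: hx sx; clear; lra.
have [et exx] := perturbed_maximum hW hpsi t1_gt0 s0 st1 mF.
have res := hr2 t1 x1 (le_trans t1r rr2) (le_trans x1r rr2); rewrite /= in res.
have t1T : t1 <= t0 + r by move: t1r; rewrite ler_norml => /andP[_]; clear; lra.
have := hres t1 x1 t1_gt0 t1T; rewrite ler_norml => /andP[_ hle].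
have g1 := Gfun_mono lo0 up0 exx.
have k20 : 0 <= 2 * k by rewrite mulr_ge0 // ltW.
have g2 := Gfun_barrier lo0 up0 (pxx t1 x1) k20; rewrite -/Lam in g2.
have kt1 : k * (- 1) <= k * (t1 - t0).
  rewrite ler_wpM2l ?(ltW k0) //; move: t1r; rewrite ler_norml => /andP[+ _].
  by move: r_1; clear; lra.
move: et hle g1 g2 kt1 res hk eps2 del0; clear; lra.
Qed.

End stability.

(** * Limits of almost solutions *)

Section approximable.
Context (R : realType).

Lemma bpow_norm n (x : R) : bpow n x = 1 + `|x| ^+ (2 * n).+2.
Proof.
by rewrite /bpow -normrX ger0_norm // exprn_even_ge0 //= negbK mul2n odd_double.
Qed.

Lemma bpow_le n (x B : R) : `|x| <= B -> bpow n x <= bpow n B.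
Proof.
move=> xB; have B0 := le_trans (normr_ge0 x) xB.
by rewrite !bpow_norm lerD2l (ger0_norm B0) lerXn2r ?nnegrE.
Qed.

Lemma eq_small (a b C : R) : 0 <= C -> (forall e : R, 0 < e -> `|a - b| <= e * C) -> a = b.
Proof.
move=> C0 h; apply/eqP; rewrite -subr_eq0 -normr_le0; apply/ler_addgt0Pr => e e0.
have C1 : 0 < C + 1 by lra.
rewrite add0r; apply: le_trans (h (e / (C + 1)) _) _; first exact: divr_gt0.
by rewrite -mulrA ger_pMr // mulrC ler_pdivrMr // mul1r lerDl.
Qed.

(** What a candidate [u] has to provide: at each accuracy an almost solution [W] close to [u] and to
    the initial datum, with errors measured by one fixed weight. Stability then makes [u] a
    solution, and comparing any other solution with the same [W] gives uniqueness. *)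
Definition approximable (lo up : R) (phi : R -> R) (u : R -> R -> R) : Prop :=
  exists n : nat, forall T eps : R, 0 <= T -> 0 < eps ->
  exists W CW, [/\ almost_solution lo up T eps W, forall t x, `|W t x| <= CW,
    forall x, `|phi x - W 0 x| <= eps * bpow n x
  & forall t x, 0 <= t -> t <= T -> `|u t x - W t x| <= eps * bpow n x].

Variables (lo up : R) (phi : R -> R) (u : R -> R -> R).
Hypotheses (lo0 : 0 <= lo) (up0 : 0 <= up).
Hypothesis happ : approximable lo up phi u.

Let bpow_gt0 n (x : R) : 0 < bpow n x.
Proof. exact: lt_le_trans ltr01 (bpow_ge1 _ _). Qed.

Lemma approximable_local (T B eps : R) : 0 <= T -> 0 < eps -> exists W CW,
  [/\ almost_solution lo up T eps W, forall t x : R, `|W t x| <= CW &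
     forall t x : R, 0 <= t -> t <= T -> `|x| <= B -> `|u t x - W t x| <= eps].
Proof.
move=> T0 eps0; have [n hn] := happ.
have e0 : 0 < eps / bpow n B by rewrite divr_gt0.
have [W [CW [[Wt [Wx [Wxx [hW hres]]]] hbd _ hu]]] := hn T _ T0 e0.
exists W, CW; split => //.
  exists Wt, Wx, Wxx; split => // t x t0 tT; apply: le_trans (hres t x t0 tT) _.
  by rewrite ler_pdivrMr // ler_peMr ?bpow_ge1 // ltW.
move=> t x t0 tT xB; apply: le_trans (hu t x t0 tT) _.
rewrite -mulrA ger_pMr // mulrC ler_pdivrMr // mul1r; exact: bpow_le.
Qed.

Lemma approximable_continuous :
  {within [set p : R * R | 0 <= p.1], continuous (fun p : R * R => u p.1 p.2)}.
Proof.
apply/subspace_continuousP => -[t0 x0] /= t00.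
apply/cvgrPdist_le => /= eps eps0.
have e3 : 0 < eps / 3 by rewrite divr_gt0.
have T0 : 0 <= t0 + 1 by rewrite addr_ge0.
have [W [CW [[Wt [Wx [Wxx [hW _]]]] _ hu]]] := approximable_local (`|x0| + 1) T0 e3.
have cW : {for (t0, x0), continuous (fun p : R * R => W p.1 p.2)} by have [_ [c _ _ _]] := hW; exact: c.
move/cvgrPdist_le: cW => /(_ _ e3) /= n1.
have n2 := @near_box R t0 x0 (t0 - 1) (t0 + 1) (x0 - 1) (x0 + 1)
  ltac:(lra) ltac:(lra) ltac:(lra) ltac:(lra).
have key (t x : R) : `|W t0 x0 - W t x| <= eps / 3 ->
    [/\ t0 - 1 < t, t < t0 + 1, x0 - 1 < x & x < x0 + 1] -> 0 <= t -> `|u t0 x0 - u t x| <= eps.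
  move=> h1 [_ h2 h3 h4] t_ge0.
  have xB : `|x| <= `|x0| + 1.
    rewrite -(subrKC x0 x) (le_trans (ler_normD _ _)) // lerD2l ler_norml.
    by apply/andP; split; move: h3 h4; lra.
  have a1 := hu t x t_ge0 (ltW h2) xB.
  have x0B : `|x0| <= `|x0| + 1 by rewrite lerDl.
  have t0T : t0 <= t0 + 1 by rewrite lerDl.
  have a2 := hu t0 x0 t00 t0T x0B.
  have -> : u t0 x0 - u t x = (u t0 x0 - W t0 x0) + (W t0 x0 - W t x) - (u t x - W t x) by ring.
  apply: le_trans (ler_normB _ _) _.
  apply: (@le_trans _ _ (eps / 3 + eps / 3 + eps / 3)); last by move: eps0; lra.
  by apply: lerD => //; apply: le_trans (ler_normD _ _) _; exact: lerD.
apply: filterS2 n1 n2 => p /= h1 h2 h3; exact: key.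
Qed.

Lemma approximable_growth T : exists (C : R) (m : nat), forall t x : R,
  0 <= t <= T -> `|u t x| <= C * (1 + `|x| ^+ m).
Proof.
have [n hn] := happ; have T0 : 0 <= Num.max T 0 by rewrite le_max lexx orbT.
have [W [CW [_ hbd _ hu]]] := hn _ 1 T0 ltr01.
exists (CW + 1), (2 * n).+2 => t x /andP[t0 tT].
have tT' : t <= Num.max T 0 by rewrite le_max tT.
have := hu t x t0 tT'; rewrite mul1r bpow_norm => h1.
have := hbd t x => h2; have CW0 := le_trans (normr_ge0 _) h2.
rewrite -[u t x](subrK (W t x)); apply: le_trans (ler_normD _ _) _.
have : 0 <= CW * `|x| ^+ (2 * n).+2 by rewrite mulr_ge0.
move: h1 h2; lra.
Qed.

Lemma approximable_initial x : u 0 x = phi x.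
Proof.
have [n hn] := happ; apply: (@eq_small _ _ (2 * bpow n x)).
  by rewrite mulr_ge0 // ltW.
move=> e e0; have [W [CW [_ _ h0 hu]]] := hn 0 e (lexx 0) e0.
have := hu 0 x (lexx 0) (lexx 0); have := h0 x => a1 a2.
have -> : u 0 x - phi x = (u 0 x - W 0 x) - (phi x - W 0 x) by ring.
by apply: le_trans (ler_normB _ _) _; move: a1 a2; lra.
Qed.

Lemma approximable_subsolution : viscosity_subsolution lo up u.
Proof.
move=> psi /C12_posP hpsi t0 x0 t0_gt0 hmax.
apply: (stable_subsolution lo0 up0 (u := u) _ hpsi t0_gt0 hmax) => T B eps T0 _ eps0.
have [W [CW [h1 _ h2]]] := approximable_local B (ltW T0) eps0.
by exists W => // t x tpos; apply: h2; exact: ltW.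
Qed.

Lemma approximable_supersolution : viscosity_supersolution lo up u.
Proof.
move=> psi /C12_posP /C12_posN hpsi t0 x0 t0_gt0 hmin.
have hmax : \forall p \near ((t0, x0) : R * R),
    - u p.1 p.2 - - psi p.1 p.2 <= - u t0 x0 - - psi t0 x0.
  by apply: filterS hmin => p; lra.
suff : - dt psi t0 x0 - Gfun up lo (- dxx psi t0 x0) <= 0 by rewrite GfunN; lra.
apply: (stable_subsolution up0 lo0 (u := fun t x => - u t x) _ hpsi t0_gt0 hmax).
move=> T B eps T0 _ eps0.
have [W [CW [[Wt [Wx [Wxx [hW hres]]]] _ h2]]] := approximable_local B (ltW T0) eps0.
exists (fun t x => - W t x).
  exists (fun t x => - Wt t x), (fun t x => - Wx t x), (fun t x => - Wxx t x).
  split; first exact: C12_withN.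
  by move=> t x tpos tT; rewrite GfunN -opprB opprK normrN addrC; apply: hres.
by move=> t x tpos tT xB; rewrite -opprB opprK normrN addrC; apply: h2 => //; exact: ltW.
Qed.

Lemma approximable_unique v : viscosity_solution lo up phi v ->
  forall t x, 0 <= t -> v t x = u t x.
Proof.
move=> hv t x t0; have [n hn] := happ.
set L := expR (brate (Num.max lo up) n * t).
apply: (@eq_small _ _ (2 * t + L * bpow n x + bpow n x)).
  have b0 := ltW (bpow_gt0 n x); apply: addr_ge0 => //.
  by apply: addr_ge0; apply: mulr_ge0 => //; exact: expR_ge0.
move=> e e0; have t10 : 0 <= t + 1 by rewrite addr_ge0.
(* The equation for [W] is required up to [t + 1] because the penalty of the comparison acts on
   [[t, t + 1]]. *)
have [W [CW [[Wt [Wx [Wxx [hW hres]]]] hbd h0 hu]]] := hn (t + 1) e t10 e0.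
have hres' s y : 0 < s -> s < t + 1 -> `|Wt s y - Gfun lo up (Wxx s y)| <= e.
  by move=> s0 st; apply: hres => //; exact: ltW.
have h0' y : `|phi y - W 0 y| <= 0 + e * bpow n y by rewrite add0r.
have a1 := viscosity_close lo0 up0 t0 (lexx 0) e0 (ltW e0) hv hW hbd hres' h0' x.
have tt : t <= t + 1 by rewrite lerDl.
have a2 := hu t x t0 tt.
have -> : v t x - u t x = (v t x - W t x) - (u t x - W t x) by ring.
apply: le_trans (ler_normB _ _) _; rewrite -/L in a1.
apply: le_trans (lerD a1 a2) _; lra.
Qed.

Theorem approximable_viscosity : unique_viscosity_solution lo up phi u.
Proof.
split; last by move=> v hv t x t0; exact: approximable_unique.
split; [exact: approximable_continuous|exact: approximable_growth|exact: approximable_initial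
  |exact: approximable_subsolution|exact: approximable_supersolution].
Qed.

End approximable.

(** * Martingales and almost solutions *)

Lemma product_taylor (R : realType) (T T1 X X1 X2 : R -> R) :
  smooth2 T T1 -> smooth3 X X1 X2 -> exists2 K, 0 <= K & forall t y d e,
  `|T (t + d) * X (y + e) - (T t * X y + d * (T1 t * X y) + e * (T t * X1 y) +
    e ^+ 2 / 2 * (T t * X2 y))| <= K * (d ^+ 2 + `|d| * `|e| + `|e| ^+ 3).
Proof.
move=> [C C0 hT] [D D0 hX]; exists (C * D) => [|t y d e]; first exact: mulr_ge0.
have [T0 T10 /(_ d)[_ _ Td]] := hT t.
have [X0 X10 X20 /(_ e)[Xe _ _ _ Xee]] := hX y.
have [Xye _ _ _] := hX (y + e).
have -> : T (t + d) * X (y + e) - (T t * X y + d * (T1 t * X y) + e * (T t * X1 y) +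
    e ^+ 2 / 2 * (T t * X2 y)) =
  (T (t + d) - T t - d * T1 t) * X (y + e) + d * T1 t * (X (y + e) - X y) +
  T t * (X (y + e) - X y - e * X1 y - e ^+ 2 / 2 * X2 y) by ring.
apply: le_trans (ler_normD _ _) _.
apply: le_trans (lerD (ler_normD _ _) (lexx _)) _.
have -> : C * D * (d ^+ 2 + `|d| * `|e| + `|e| ^+ 3) =
    C * d ^+ 2 * D + `|d| * C * (D * `|e|) + C * (D * `|e| ^+ 3) by ring.
apply: lerD; first apply: lerD.
- by rewrite normrM; exact: ler_pM.
- by rewrite !normrM; apply: ler_pM => //; exact: ler_wpM2l.
- by rewrite normrM; exact: ler_pM.
Qed.

Section tensor_expansion.
Context (R : realType) (Omega : Type) (W : tensor R Omega).

Lemma tsum_taylor : exists2 K, 0 <= K & forall w t y d e,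
  `|tsum W w (t + d) (y + e) - (tsum W w t y + d * tsum_t W w t y +
     e * tsum_y W w t y + e ^+ 2 / 2 * tsum_yy W w t y)|
  <= K * (d ^+ 2 + `|d| * `|e| + `|e| ^+ 3).
Proof.
rewrite /tsum /tsum_t /tsum_y /tsum_yy /teval.
elim: (tidx W) => [|i r [K K0 IH]].
  by exists 0 => // w t y d e; rewrite !big_nil !mulr0 !addr0 subr0 normr0 mul0r.
have [L L0 hL] := product_taylor (tT_smooth W i) (tX_smooth W i).
have [c c0 hc] := bfct_ge0 (tcoef_bounded W i).
exists (c * L + K) => [|w t y d e]; first by rewrite addr_ge0 // mulr_ge0.
rewrite !big_cons.
have h1 := hL t y d e; have h2 := IH w t y d e.
set S0 := \sum_(j <- r) _ in h2 *; set S1 := \sum_(j <- r) _ in h2 *.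
set S2 := \sum_(j <- r) _ in h2 *; set S3 := \sum_(j <- r) _ in h2 *.
set S4 := \sum_(j <- r) _ in h2 *.
set P := (X in `|X|) in h1; set Q := (X in `|X|) in h2.
rewrite [X in `|X|](_ : _ = tcoef W i w * P + Q); last by rewrite /P /Q; ring.
apply: le_trans (ler_normD _ _) _; rewrite mulrDl; apply: lerD => //.
by rewrite normrM -mulrA; apply: ler_pM => //.
Qed.

Lemma teval_bounded (a b : nat * int -> R -> R) :
  (forall i, exists2 C, 0 <= C & forall t, `|a i t| <= C) ->
  (forall i, exists2 C, 0 <= C & forall t, `|b i t| <= C) ->
  exists2 C, 0 <= C & forall w t y, `|teval W a b w t y| <= C.
Proof.
move=> ha hb; rewrite /teval; elim: (tidx W) => [|i r [K K0 IH]].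
  by exists 0 => // w t y; rewrite big_nil normr0.
have [A A0 hA] := ha i; have [B B0 hB] := hb i.
have [c c0 hc] := bfct_ge0 (tcoef_bounded W i).
exists (c * A * B + K) => [|w t y]; first by rewrite addr_ge0 // !mulr_ge0.
rewrite big_cons; apply: le_trans (ler_normD _ _) _; apply: lerD => //.
by rewrite !normrM; do 2!apply: ler_pM => //; rewrite mulr_ge0.
Qed.

Let T_bdd i : exists2 C, 0 <= C & forall t, `|tT W i t| <= C.
Proof. by have [C C0 h] := tT_smooth W i; exists C => // t; have [] := h t. Qed.
Let T1_bdd i : exists2 C, 0 <= C & forall t, `|tT1 W i t| <= C.
Proof. by have [C C0 h] := tT_smooth W i; exists C => // t; have [] := h t. Qed.
Let X_bdd i : exists2 C, 0 <= C & forall t, `|tX W i t| <= C.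
Proof. by have [C C0 h] := tX_smooth W i; exists C => // t; have [] := h t. Qed.
Let X1_bdd i : exists2 C, 0 <= C & forall t, `|tX1 W i t| <= C.
Proof. by have [C C0 h] := tX_smooth W i; exists C => // t; have [] := h t. Qed.
Let X2_bdd i : exists2 C, 0 <= C & forall t, `|tX2 W i t| <= C.
Proof. by have [C C0 h] := tX_smooth W i; exists C => // t; have [] := h t. Qed.

Lemma tsum_bounded : exists2 C, 0 <= C & forall w t y, `|tsum W w t y| <= C.
Proof. exact: teval_bounded. Qed.
Lemma tsum_t_bounded : exists2 C, 0 <= C & forall w t y, `|tsum_t W w t y| <= C.
Proof. exact: teval_bounded. Qed.
Lemma tsum_y_bounded : exists2 C, 0 <= C & forall w t y, `|tsum_y W w t y| <= C.
Proof. exact: teval_bounded. Qed.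
Lemma tsum_yy_bounded : exists2 C, 0 <= C & forall w t y, `|tsum_yy W w t y| <= C.
Proof. exact: teval_bounded. Qed.

Lemma teval_mem (S : set (Omega -> R)) (a b : nat * int -> R -> R) t (Y : Omega -> R) :
  linear_space S -> ClLip_stable S -> (forall i, S (tcoef W i)) -> S Y ->
  (forall i, ClLip (b i)) -> S (fun w => teval W a b w t (Y w)).
Proof.
move=> Slin Sst Sc SY hb.
apply: (stable_sum Slin Sst) => i; apply: (stableM Sst).
  have := stableZ Slin (a i t) (Sc i).
  by congr S; apply/funext => w; rewrite mulrC.
exact: (stable_comp Sst).
Qed.

Lemma ClLip_tX i : ClLip (tX W i).
Proof.
have [C _ h] := tX_smooth W i; apply: (@Lipschitz_ClLip _ _ C) => x y.
by have [_ _ _ /(_ (x - y))[]] := h y; rewrite subrKC.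
Qed.
Lemma ClLip_tX1 i : ClLip (tX1 W i).
Proof.
have [C _ h] := tX_smooth W i; apply: (@Lipschitz_ClLip _ _ C) => x y.
by have [_ _ _ /(_ (x - y))[]] := h y; rewrite subrKC.
Qed.
Lemma ClLip_tX2 i : ClLip (tX2 W i).
Proof.
have [C _ h] := tX_smooth W i; apply: (@Lipschitz_ClLip _ _ C) => x y.
by have [_ _ _ /(_ (x - y))[]] := h y; rewrite subrKC.
Qed.

End tensor_expansion.

(** * Almost solutions along the martingale *)

Section martingale_side.
Context (R : realType) (dOmega : measure_display) (Omega : measurableType dOmega).
Context (E : sublinear_expectation R Omega).
Context (H : R -> set (Omega -> R)) (Et : R -> (Omega -> R) -> Omega -> R).
Hypotheses (H_filtration : filtration E H) (Et_cond : conditional_expectation E H Et).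
Context (M : R -> Omega -> R) (lo up : R).
Hypothesis M0 : forall w, M 0 w = 0.
Hypothesis M_moments : forall p t : R, 0 < p -> 0 <= t ->
  (choquet E (fun w => (`|M t w| `^ p)%R) < +oo)%E ->
  (Ehat E (fun w => (`|M t w| `^ p)%R) < +oo)%E.
Hypotheses (hI : martingale E H Et M /\ martingale E H Et (fun t w => - M t w)).
Hypothesis hII : martingale E H Et (fun t w => M t w ^+ 2 - up * t).
Hypothesis hIII : martingale E H Et (fun t w => - (M t w ^+ 2 - lo * t)).
Hypotheses (lo_ge0 : 0 <= lo) (up_ge0 : 0 <= up).
Hypothesis hIV : forall T : R, 0 < T -> modulusW E M T delta @[delta --> 0^'+] --> 0%E.

Let momY := incr_moment H_filtration Et_cond M0 M_moments hI hII hIII up_ge0 hIV.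
Let cubeY := ex_incr_cube H_filtration Et_cond M0 M_moments hI hII hIII up_ge0 hIV.
Let second_order := ex_second_order H_filtration Et_cond M0 M_moments hI hII hIII up_ge0 hIV.

Section one_tensor.
Variables (W : tensor R Omega) (t s a x eps : R).
Hypotheses (t_ge0 : 0 <= t) (ts : t <= s) (eps_ge0 : 0 <= eps).
Hypothesis W_mem : forall i, H t (tcoef W i).
Hypothesis W_eq : forall w r y, 0 <= r -> r <= a ^+ 2 * (s - t) ->
  `|tsum_t W w r y - Gfun lo up (tsum_yy W w r y)| <= eps.

(** [W] is run backwards in time along the martingale. The scale [a] will be a square root of time
    for the G-normality of [M_1], and 1 for the increments. *)
Let U r w := tsum W w (a ^+ 2 * (s - r)) (x + a * (M r w - M t w)).

Lemma tsum_M_mem (f g : nat * int -> R -> R) r tau : t <= r ->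
  (forall i, ClLip (g i)) ->
  H r (fun w => teval W f g w tau (x + a * (M r w - M t w))).
Proof.
move=> tr hg; have r0 := le_trans t_ge0 tr.
have Hlin := H_linear H_filtration r0; have Hst := H_stable H_filtration r0.
apply: (teval_mem f tau Hlin Hst) => // [i|].
  exact: (H_mono H_filtration t_ge0 tr).
apply: (stableD Hlin); first exact: (stable_cst Hst).
apply: (stableZ Hlin); apply: (stableB Hlin); first exact: (M_H hI).
by apply: (H_mono H_filtration t_ge0 tr); exact: (M_H hI).
Qed.

Lemma U_Lone r : t <= r -> Lone E (U r).
Proof.
move=> tr; have r0 := le_trans t_ge0 tr.
apply: bounded_Lone.
  apply: (H_rv H_filtration r0); apply: tsum_M_mem => //; exact: ClLip_tX.
by have [C C0 hC] := tsum_bounded W; exists C => w; exact: hC.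
Qed.

(** The remainders [rho^4], [rho^2 |Y|] and [|Y|^3] of the expansion about time [r] are [O(rho^3)]
    in expectation by [ex_incr_cube]. The second-order identity replaces the main part by
    [A + G(C) (r' - r)], which differs from [U r] by the residual of [W] times [a^2 (r' - r)],
    because [G] is positively homogeneous. *)
Lemma U_step : exists2 K, 0 <= K & forall r r' rho, t <= r -> r <= r' -> r' <= s ->
  0 <= rho -> rho <= 1 -> r' - r = rho ^+ 2 ->
  `|ex E (U r') - ex E (U r)| <= a ^+ 2 * (r' - r) * eps + K * rho ^+ 3.
Proof.
have [K1 K10 hK1] := tsum_taylor W.
pose c3 := 108 * expR (2 * up).
have c30 : 0 <= c3 by rewrite mulr_ge0 // expR_ge0.
pose b := `|a|.
have b0 : 0 <= b := normr_ge0 a.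
have b3 : 0 <= b ^+ 3 by exact: exprn_ge0.
have b4 : 0 <= b ^+ 4 by exact: exprn_ge0.
exists (K1 * (b ^+ 4 + b ^+ 3 + 2 * b ^+ 3 * c3)).
  by rewrite mulr_ge0 // !addr_ge0 // !mulr_ge0.
move=> r r' rho tr rr' r's rho0 rho1 hrho.
have r0 := le_trans t_ge0 tr; have r'0 := le_trans r0 rr'.
have rs := le_trans rr' r's; have tr' := le_trans tr rr'.
have Hlin := H_linear H_filtration r0; have Hst := H_stable H_filtration r0.
pose tau := a ^+ 2 * (s - r).
pose eta := r' - r.
pose y w := x + a * (M r w - M t w).
pose Wt w := tsum_t W w tau (y w).
pose Wy w := tsum_y W w tau (y w).
pose Wyy w := tsum_yy W w tau (y w).
have HU : H r (U r) by apply: tsum_M_mem => //; exact: ClLip_tX.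
have HWt : H r Wt by apply: tsum_M_mem => //; exact: ClLip_tX.
have HWy : H r Wy by apply: tsum_M_mem => //; exact: ClLip_tX1.
have HWyy : H r Wyy by apply: tsum_M_mem => //; exact: ClLip_tX2.
have bU : bounded_fct (U r) by have [C _ hC] := tsum_bounded W; exists C => w; exact: hC.
have bWt : bounded_fct Wt by have [C _ hC] := tsum_t_bounded W; exists C => w; exact: hC.
have bWy : bounded_fct Wy by have [C _ hC] := tsum_y_bounded W; exists C => w; exact: hC.
have bWyy : bounded_fct Wyy by have [C _ hC] := tsum_yy_bounded W; exists C => w; exact: hC.
pose A w := U r w - (a ^+ 2 * eta) * Wt w.
pose B w := a * Wy w.
pose C w := a ^+ 2 * Wyy w.
have HA : H r A by apply: (stableB Hlin) => //; exact: (stableZ Hlin).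
have HB : H r B by exact: (stableZ Hlin).
have HC : H r C by exact: (stableZ Hlin).
have bA : bounded_fct A.
  by apply: bfctD => //; apply: bfctN; apply: bfctM => //; exact: bfct_cst.
have bB : bounded_fct B by apply: bfctM => //; exact: bfct_cst.
have bC : bounded_fct C by apply: bfctM => //; exact: bfct_cst.
pose Y w := M r' w - M r w.
pose V w := A w + B w * Y w + C w / 2 * Y w ^+ 2.
have key : ex E V = ex E (fun w => A w + Gfun lo up (C w) * eta).
  exact: second_order.
have LU := U_Lone tr; have LU' := U_Lone tr'.
have LA : Lone E A by apply: bounded_Lone => //; exact: (H_rv H_filtration r0).
have LY3 : Lone E (fun w => `|Y w| ^+ 3) by exact: momY.
have LY2 : Lone E (fun w => Y w ^+ 2).
  have := momY 2 r0 rr'; congr Lone; apply/funext => w.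
  by rewrite real_normK ?num_real.
have LY : Lone E Y by apply: LoneB; exact: (M_Lone hI).
have rC2 : rv E (fun w => C w / 2).
  have := stableZ (rv_linear E) (2^-1) (H_rv H_filtration r0 HC).
  by congr rv; apply/funext => w; rewrite mulrC.
have LV : Lone E V.
  apply: LoneD; first apply: LoneD => //.
    by apply: bounded_LoneM => //; exact: (H_rv H_filtration r0).
  apply: bounded_LoneM => //; apply: bfctM => //; exact: bfct_cst.
have lo0 : 0 <= lo := lo_ge0.
have LG : Lone E (fun w => A w + Gfun lo up (C w) * eta).
  apply: LoneD => //.
  have LGC : Lone E (fun w => Gfun lo up (C w)).
    apply: bounded_Lone.
      apply: (H_rv H_filtration r0).
      exact: (stable_comp Hst (ClLip_Gfun lo0 up_ge0) HC).
    have [c hc] := bC; exists (Num.max lo up / 2 * c) => w.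
    rewrite -[Gfun _ _ _]subr0 -(Gfun0 lo up).
    apply: le_trans (Gfun_lip _ _ lo0 up_ge0) _; rewrite subr0 ler_wpM2l //.
    by rewrite divr_ge0 // le_max lo0.
  by have := LoneZ eta LGC; congr Lone; apply/funext => w; rewrite mulrC.
have eta0 : 0 <= eta by rewrite /eta hrho sqr_ge0.
have d1 : `|ex E (U r') - ex E V| <=
    K1 * (b ^+ 4 + b ^+ 3 + 2 * b ^+ 3 * c3) * rho ^+ 3.
  have r3 : 0 <= rho ^+ 3 by exact: exprn_ge0.
  pose Z w := K1 * ((b ^+ 4 + b ^+ 3) * rho ^+ 3) + K1 * (2 * b ^+ 3) * `|Y w| ^+ 3.
  have LZ : Lone E Z by apply: LoneD; [exact: Lone_cst|exact: LoneZ].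
  apply: (@le_trans _ _ (ex E Z)).
    apply: ex_dist_le => // w.
    have := hK1 w tau (y w) (- (a ^+ 2 * eta)) (a * Y w).
    have -> : tau + - (a ^+ 2 * eta) = a ^+ 2 * (s - r') by rewrite /tau /eta; ring.
    have -> : y w + a * Y w = x + a * (M r' w - M t w) by rewrite /y /Y; ring.
    rewrite -/(U r' w) -/(U r w) -/(Wt w) -/(Wy w) -/(Wyy w).
    have -> : U r w + - (a ^+ 2 * eta) * Wt w + a * Y w * Wy w +
       (a * Y w) ^+ 2 / 2 * Wyy w = V w by rewrite /V /A /B /C; ring.
    move=> h; apply: le_trans h _.
    rewrite /Z -[K1 * (2 * b ^+ 3) * _]mulrA -mulrDr ler_wpM2l //.
    rewrite normrN sqrrN normrM [`|a ^+ 2|]ger0_norm ?sqr_ge0 // (ger0_norm eta0).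
    rewrite normrM -/b /eta hrho.
    have -> : a ^+ 2 = b ^+ 2 by rewrite /b real_normK ?num_real.
    set z := `|Y w|; have z0 : 0 <= z by exact: normr_ge0.
    have z3 : 0 <= z ^+ 3 by exact: exprn_ge0.
    have e1 : (b ^+ 2 * rho ^+ 2) ^+ 2 <= b ^+ 4 * rho ^+ 3.
      rewrite (_ : _ ^+ 2 = b ^+ 4 * (rho ^+ 3 * rho)); last by ring.
      by rewrite ler_wpM2l // ler_piMr.
    have e2 : b ^+ 2 * rho ^+ 2 * (b * z) <= b ^+ 3 * (rho ^+ 3 + z ^+ 3).
      rewrite (_ : _ * (b * z) = b ^+ 3 * (rho ^+ 2 * z)); last by ring.
      rewrite ler_wpM2l //; case: (leP z rho) => hz.
        have : rho ^+ 2 * z <= rho ^+ 2 * rho by rewrite ler_wpM2l // sqr_ge0.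
        by rewrite -exprSr; lra.
      have : rho ^+ 2 * z <= z ^+ 2 * z.
        by rewrite ler_wpM2r // lerXn2r ?nnegrE // ltW.
      by rewrite -exprSr; lra.
    rewrite [(b * z) ^+ 3]exprMn; lra.
  have c := cubeY r0 rr' rho0 hrho; rewrite -/Y -/c3 in c.
  apply: le_trans (exD (Lone_cst E _) (LoneZ _ LY3)) _.
  rewrite ex_cst exZ //; last by rewrite !mulr_ge0.
  have k2 : 0 <= K1 * (2 * b ^+ 3) by rewrite !mulr_ge0.
  have := ler_wpM2l k2 c; lra.
have d2 : `|ex E V - ex E (U r)| <= a ^+ 2 * eta * eps.
  rewrite key; apply: (@le_trans _ _ (ex E (fun=> a ^+ 2 * eta * eps))); last by rewrite ex_cst.
  apply: ex_dist_le => //; first exact: Lone_cst.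
  move=> w; rewrite /A /C Gfun_pM ?sqr_ge0 //.
  have -> : U r w - a ^+ 2 * eta * Wt w + a ^+ 2 * Gfun lo up (Wyy w) * eta - U r w =
    - (a ^+ 2 * eta * (Wt w - Gfun lo up (Wyy w))) by ring.
  rewrite normrN normrM ger0_norm; last by rewrite mulr_ge0 ?sqr_ge0.
  rewrite ler_wpM2l //; first by rewrite mulr_ge0 ?sqr_ge0.
  apply: W_eq; rewrite /tau; first by rewrite mulr_ge0 ?sqr_ge0 ?subr_ge0.
  by rewrite ler_wpM2l ?sqr_ge0 // lerD2l lerN2.
have -> : ex E (U r') - ex E (U r) = (ex E (U r') - ex E V) + (ex E V - ex E (U r)) by ring.
apply: le_trans (ler_normD _ _) _; rewrite -/eta; lra.
Qed.

(** With [n] steps of length [rho^2 = (s - t) / n] the accumulated remainder is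
    [n K rho^3 = K (s - t) rho], which tends to 0. *)
Lemma tsum_martingale :
  `|ex E (fun w => tsum W w 0 (x + a * (M s w - M t w))) -
    ex E (fun w => tsum W w (a ^+ 2 * (s - t)) x)| <= a ^+ 2 * (s - t) * eps.
Proof.
have -> : (fun w => tsum W w 0 (x + a * (M s w - M t w))) = U s.
  by apply/funext => w; rewrite /U subrr mulr0.
have -> : (fun w => tsum W w (a ^+ 2 * (s - t)) x) = U t.
  by apply/funext => w; rewrite /U subrr mulr0 addr0.
have [K K0 hK] := U_step.
have st0 : 0 <= s - t by rewrite subr_ge0.
apply/ler_addgt0Pr => eps' eps'0.
pose q := eps' / (K * (s - t) + 1).
have Kst : 0 <= K * (s - t) by exact: mulr_ge0.
have q0 : 0 < q by rewrite divr_gt0 //; lra.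
have [n hn] := exists_nat_gt (1 + (s - t) + (s - t) / q ^+ 2).
have sq0 : 0 <= (s - t) / q ^+ 2 by rewrite divr_ge0 // sqr_ge0.
have n0 : 0 < n%:R :> R by lra.
pose eta := (s - t) / n%:R.
have eta0 : 0 <= eta by rewrite divr_ge0 // ltW.
have etan : n%:R * eta = s - t by rewrite mulrC mulfVK // gt_eqF.
pose rho := Num.sqrt eta.
have rho0 : 0 <= rho by exact: sqrtr_ge0.
have rho2 : rho ^+ 2 = eta by rewrite sqr_sqrtr.
have rho1 : rho <= 1.
  by rewrite -(expr_le1 (n := 2)) // rho2 ler_pdivrMr // mul1r; lra.
have rhoq : rho <= q.
  rewrite -(ler_pXn2r (n := 2)) ?nnegrE // ?(ltW q0) // rho2 ler_pdivrMr // mulrC.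
  by rewrite -ler_pdivrMr ?exprn_gt0 //; lra.
pose r i := t + i%:R * eta.
have r_le i : (i <= n)%N -> r i <= s.
  move=> hi; have : i%:R * eta <= n%:R * eta by rewrite ler_wpM2r // ler_nat.
  by rewrite /r etan; lra.
have tr i : t <= r i by rewrite /r lerDl mulr_ge0.
have rS i : r i.+1 - r i = eta by rewrite /r -natr1; ring.
have step i : (i < n)%N ->
    `|ex E (U (r i.+1)) - ex E (U (r i))| <= a ^+ 2 * eta * eps + K * rho ^+ 3.
  move=> hi; have := hK (r i) (r i.+1) rho (tr i).
  rewrite rS; apply => //; last exact: r_le.
  by rewrite -subr_ge0 rS.
have tele i : (i <= n)%N ->
    `|ex E (U (r i)) - ex E (U t)| <= i%:R * (a ^+ 2 * eta * eps + K * rho ^+ 3).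
  elim: i => [|i IH] hi; first by rewrite /r mul0r addr0 subrr normr0 mul0r.
  have -> : ex E (U (r i.+1)) - ex E (U t) =
    (ex E (U (r i)) - ex E (U t)) + (ex E (U (r i.+1)) - ex E (U (r i))) by ring.
  apply: le_trans (ler_normD _ _) _; rewrite -natr1 mulrDl mul1r.
  by apply: lerD; [apply: IH; exact: ltnW|exact: step].
have := tele n (leqnn n).
have -> : r n = s by rewrite /r etan subrKC.
move=> h; apply: le_trans h _.
have -> : n%:R * (a ^+ 2 * eta * eps + K * rho ^+ 3) =
  a ^+ 2 * (n%:R * eta) * eps + K * (n%:R * rho ^+ 2) * rho by ring.
rewrite rho2 etan lerD2l.
apply: (@le_trans _ _ (K * (s - t) * q)); first by rewrite ler_wpM2l.
rewrite /q mulrA ler_pdivrMr; last lra.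
rewrite mulrC ler_pM2l //; lra.
Qed.

End one_tensor.
End martingale_side.

Section growth_estimates.
Context (R : realType).

Lemma expn_leS (z : R) m : 0 <= z -> z ^+ m <= 1 + z ^+ m.+1.
Proof.
move=> z0; case: (leP z 1) => z1.
  have : z ^+ m <= 1 by exact: exprn_ile1.
  have : 0 <= z ^+ m.+1 by exact: exprn_ge0.
  lra.
have : z ^+ m <= z ^+ m.+1 by rewrite ler_weXn2l // ltW.
lra.
Qed.

Lemma expn_normD_le (a b : R) p : 0 <= a -> 0 <= b ->
  (a + b) ^+ p <= 3 ^+ p * (1 + a ^+ p + b ^+ p).
Proof.
move=> a0 b0; apply: le_trans (expr3_le p a0 b0).
by rewrite lerXn2r ?nnegrE ?addr_ge0 // lerD2r lerDr.
Qed.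

(** [X w y] consists of a frozen part of size [Nr w] and a moving coordinate [y]. The exponent is
    raised to one more than that of [phi], so that a single weight serves the Lipschitz estimate and
    the size at [y = 0]. *)
Lemma ClLip_uniform_growth (Omega : Type) (V : normedZmodType R) (phi : V -> R)
    (X : Omega -> R -> V) (Nr : Omega -> R) :
  ClLip phi -> (forall w, 0 <= Nr w) ->
  (forall w y, `|X w y| <= Nr w + `|y|) ->
  (forall w y y', `|X w y - X w y'| <= `|y - y'|) ->
  exists C m, [/\ 0 < C,
    forall w y y', `|phi (X w y) - phi (X w y')| <=
      C * (1 + Nr w ^+ m + `|y| ^+ m + `|y'| ^+ m) * `|y - y'|
  & forall w, `|phi (X w 0)| <= C * (1 + Nr w ^+ m)].
Proof.
move=> [C [m [C0 hphi]]] N0 X_le X_lip.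
have [K K1 hK] : exists2 K : R, 1 <= K & K = 3 ^+ m.
  by exists (3 ^+ m) => //; rewrite exprn_ege1 // ler1n.
have K0 : 0 <= K := le_trans ler01 K1.
exists (7 * K * C + `|phi 0| + C * 2), m.+1.
have p0 := normr_ge0 (phi 0).
have KC0 : C <= K * C by rewrite ler_peMl // ltW.
have KC1 : 0 < K * C by apply: lt_le_trans KC0.
split; first lra.
- move=> w y y'.
  have hX z : `|X w z| ^+ m <= K * (3 + Nr w ^+ m.+1 + `|z| ^+ m.+1).
    apply: (@le_trans _ _ ((Nr w + `|z|) ^+ m)).
      by rewrite lerXn2r ?nnegrE ?addr_ge0.
    apply: le_trans (expn_normD_le m (N0 w) (normr_ge0 z)) _.
    rewrite -hK ler_wpM2l //.
    have := expn_leS m (N0 w); have := expn_leS m (normr_ge0 z); lra.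
  apply: le_trans (hphi _ _) _.
  apply: ler_pM => //; first by rewrite mulr_ge0 ?(ltW C0) // !addr_ge0 // exprn_ge0.
  have h1 := hX y; have h2 := hX y'.
  set a := Nr w ^+ m.+1 in h1 h2 *; set b := `|y| ^+ m.+1 in h1 *; set b' := `|y'| ^+ m.+1 in h2 *.
  have a0 : 0 <= a by exact: exprn_ge0.
  have b0 : 0 <= b by exact: exprn_ge0.
  have b'0 : 0 <= b' by exact: exprn_ge0.
  set S := 1 + a + b + b'; have S1 : 1 <= S by rewrite /S; lra.
  apply: (@le_trans _ _ (C * (7 * K * S))).
    rewrite ler_wpM2l ?(ltW C0) //.
    apply: le_trans (lerD (lerD K1 h1) h2) _.
    have -> : K + K * (3 + a + b) + K * (3 + a + b') = K * (7 + 2 * a + b + b') by ring.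
    have -> : 7 * K * S = K * (7 * S) by ring.
    rewrite ler_wpM2l // /S; lra.
  have -> : C * (7 * K * S) = 7 * K * C * S by ring.
  rewrite ler_wpM2r ?(le_trans ler01 S1) //; lra.
- move=> w.
  have x0 : `|X w 0| <= Nr w by have := X_le w 0; rewrite normr0 addr0.
  have h := hphi (X w 0) 0; rewrite subr0 in h.
  have e0 : `|0 : V| ^+ m <= 1 by rewrite normr0; case: (m) => [|k]; rewrite ?expr0 ?exprS ?mul0r.
  have xm : (1 + `|X w 0| ^+ m + `|0 : V| ^+ m) * `|X w 0| <= 2 * (1 + Nr w ^+ m.+1) + Nr w ^+ m.+1.
    have c1 : `|X w 0| ^+ m * `|X w 0| <= Nr w ^+ m.+1 by rewrite -exprSr lerXn2r ?nnegrE.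
    have c2 : `|0 : V| ^+ m * `|X w 0| <= 1 * `|X w 0| by rewrite ler_wpM2r.
    have c3 : Nr w <= 1 + Nr w ^+ m.+1.
      case: (leP (Nr w) 1) => hn.
        by apply: le_trans hn _; rewrite lerDl exprn_ge0.
      have : Nr w ^+ 1 <= Nr w ^+ m.+1 by rewrite ler_weXn2l // ltW.
      by rewrite expr1; lra.
    rewrite !mulrDl mul1r; lra.
  have b0 : 0 <= Nr w ^+ m.+1 by exact: exprn_ge0.
  have := ler_wpM2l (ltW C0) xm; rewrite mulrA => xm'.
  have h1 : `|phi (X w 0)| <= `|phi (X w 0) - phi 0| + `|phi 0|.
    by rewrite -{1}(subrK (phi 0) (phi (X w 0))) ler_normD.
  have h2 : 0 <= (K * C) * (1 + Nr w ^+ m.+1) by rewrite mulr_ge0 ?(ltW KC1) // addr_ge0.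
  have h3 : C * (1 + Nr w ^+ m.+1) <= K * C * (1 + Nr w ^+ m.+1) by rewrite ler_wpM2r // addr_ge0.
  have h4 : 0 <= `|phi 0| * Nr w ^+ m.+1 by rewrite mulr_ge0.
  lra.
Qed.

End growth_estimates.

Section all_moments.
Context (R : realType) (d : measure_display) (Omega : measurableType d).
Context (E : sublinear_expectation R Omega).
Implicit Types X Y : Omega -> R.

Definition all_moments X := rv E X /\ forall n, Lone E (fun w => `|X w| ^+ n).

Lemma all_momentsP X : (forall n, rv E (fun w => `|X w| ^+ n)) -> rv E X ->
  (forall n, exists2 Y, Lone E Y & forall w, `|X w| ^+ n <= Y w) -> all_moments X.
Proof.
move=> hn hX h; split => // n; have [Y LY XY] := h n.
by apply: (Lone_le (hn n) LY) => w; rewrite ger0_norm // exprn_ge0.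
Qed.

Lemma rv_normX X n : rv E X -> rv E (fun w => `|X w| ^+ n).
Proof.
by move=> rX; apply: (stableX (@rv_ClLip _ _ _ E)); exact: (stable_norm (@rv_ClLip _ _ _ E)).
Qed.

Lemma all_momentsD X Y : all_moments X -> all_moments Y -> all_moments (fun w => X w + Y w).
Proof.
move=> [rX mX] [rY mY]; have rXY := stableD (rv_linear E) rX rY.
apply: all_momentsP => // [n|n]; first exact: rv_normX.
exists (fun w => 3 ^+ n * (1 + `|X w| ^+ n + `|Y w| ^+ n)).
  by apply: LoneZ; apply: LoneD; [apply: LoneD; [exact: Lone_cst|]|].
move=> w; apply: le_trans (expn_normD_le n (normr_ge0 _) (normr_ge0 _)).
by rewrite lerXn2r ?nnegrE ?addr_ge0 // ler_normD.
Qed.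

Lemma all_moments_cst (c : R) : all_moments (fun=> c).
Proof. by split=> [|n]; [exact: (stable_cst (@rv_ClLip _ _ _ E))|exact: Lone_cst]. Qed.

Lemma all_momentsZ (a : R) X : all_moments X -> all_moments (fun w => a * X w).
Proof.
move=> [rX mX]; split=> [|n]; first exact: (stableZ (rv_linear E)).
by have := LoneZ (`|a| ^+ n) (mX n); congr Lone; apply/funext => w; rewrite normrM exprMn.
Qed.

Lemma all_moments_norm X : all_moments X -> all_moments (fun w => `|X w|).
Proof.
move=> [rX mX]; split=> [|n]; first exact: (stable_norm (@rv_ClLip _ _ _ E)).
by have := mX n; congr Lone; apply/funext => w; rewrite normr_id.
Qed.

Lemma all_moments_sum (I : Type) (r : seq I) (X : I -> Omega -> R) :
  (forall i, all_moments (X i)) -> all_moments (fun w => \sum_(i <- r) X i w).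
Proof.
move=> mX; elim: r => [|i r IH].
  have := all_moments_cst 0; congr all_moments; apply/funext => w; by rewrite big_nil.
have := all_momentsD (mX i) IH; congr all_moments; apply/funext => w; by rewrite big_cons.
Qed.

Lemma Lone_pow X n : (forall w, 0 <= X w) -> all_moments X -> Lone E (fun w => X w ^+ n).
Proof.
by move=> X0 [_ /(_ n)]; congr Lone; apply/funext => w; rewrite ger0_norm.
Qed.

End all_moments.

(** * G-normality and the increment formula *)

Section growth_step.
Context (R : realType) (dOmega : measure_display) (Omega : measurableType dOmega).
Context (E : sublinear_expectation R Omega).
Context (H : R -> set (Omega -> R)) (Et : R -> (Omega -> R) -> Omega -> R).
Hypotheses (H_filtration : filtration E H) (Et_cond : conditional_expectation E H Et).
Context (M : R -> Omega -> R) (lo up : R).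
Hypothesis M0 : forall w, M 0 w = 0.
Hypothesis M_moments : forall p t : R, 0 < p -> 0 <= t ->
  (choquet E (fun w => (`|M t w| `^ p)%R) < +oo)%E ->
  (Ehat E (fun w => (`|M t w| `^ p)%R) < +oo)%E.
Hypotheses (hI : martingale E H Et M /\ martingale E H Et (fun t w => - M t w)).
Hypothesis hII : martingale E H Et (fun t w => M t w ^+ 2 - up * t).
Hypothesis hIII : martingale E H Et (fun t w => - (M t w ^+ 2 - lo * t)).
Hypotheses (lo_gt0 : 0 < lo) (up_gt0 : 0 < up).
Hypothesis hIV : forall T : R, 0 < T -> modulusW E M T delta @[delta --> 0^'+] --> 0%E.

Let lo0 : 0 <= lo := ltW lo_gt0.
Let up0 : 0 <= up := ltW up_gt0.

Lemma all_momentsM (t : R) : 0 <= t -> all_moments E (M t).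
Proof.
move=> t0; split; first exact: (H_rv H_filtration t0 (M_H hI t0)).
by move=> n; exact: (M_moment H_filtration Et_cond M0 M_moments hI hII hIII up0 hIV n t0).
Qed.

Lemma all_moments_incr (t s : R) : 0 <= t -> 0 <= s -> all_moments E (fun w => M s w - M t w).
Proof.
move=> t0 s0; have := all_momentsD (all_momentsM s0) (all_momentsZ (-1) (all_momentsM t0)).
by congr all_moments; apply/funext => w; rewrite mulN1r.
Qed.

Lemma all_moments_affine (t s a x : R) : 0 <= t -> 0 <= s ->
  all_moments E (fun w => x + a * (M s w - M t w)).
Proof.
move=> t0 s0; apply: all_momentsD; first exact: all_moments_cst.
by apply: all_momentsZ; exact: all_moments_incr.
Qed.

Section one_function.
Context (g0 : Omega -> R -> R) (Nr : Omega -> R) (C : R) (m : nat).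
Hypotheses (Nr_ge0 : forall w, 0 <= Nr w) (C_gt0 : 0 < C).
Hypothesis g0_lip : forall w y y',
  `|g0 w y - g0 w y'| <= C * (1 + Nr w ^+ m + `|y| ^+ m + `|y'| ^+ m) * `|y - y'|.
Hypothesis g0_0 : forall w, `|g0 w 0| <= C * (1 + Nr w ^+ m).
Hypothesis Nr_moments : all_moments E Nr.

Lemma Lone_growth (Y : Omega -> R) : all_moments E Y -> rv E (fun w => g0 w (Y w)) ->
  Lone E (fun w => g0 w (Y w)).
Proof.
move=> mY rg.
apply: (Lone_le (Y := fun w => 6 * C * (3 ^+ m.+1 * (1 + Nr w ^+ m.+1 + `|Y w| ^+ m.+1))) rg).
  apply: LoneZ; apply: LoneZ; apply: LoneD; last by case: mY.
  by apply: LoneD; [exact: Lone_cst|exact: Lone_pow].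
move=> w; apply: le_trans (growth_bound Nr_ge0 C_gt0 g0_lip g0_0 w (Y w)) _.
rewrite ler_wpM2l //; first by rewrite mulr_ge0 // ltW.
exact: expr3_le.
Qed.

(** Two errors add up: the replacement of [g0] by [W] at time 0, paid for by moments of [Nr] and of
    the increment, and that of [tsum_martingale]. *)
Lemma growth_step (W : tensor R Omega) (t s a x eps : R) :
  0 <= t -> t <= s -> 0 <= eps ->
  rv E (fun w => g0 w (x + a * (M s w - M t w))) ->
  (forall i, H t (tcoef W i)) ->
  (forall w r y, 0 <= r -> r <= a ^+ 2 * (s - t) ->
    `|tsum_t W w r y - Gfun lo up (tsum_yy W w r y)| <= eps) ->
  (forall w y, `|tsum W w 0 y - g0 w y| <=
    eps * (1 + Nr w ^+ (2 * m.+1) + `|y| ^+ (2 * m.+1))) ->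
  `|ex E (fun w => g0 w (x + a * (M s w - M t w))) -
    ex E (fun w => tsum W w (a ^+ 2 * (s - t)) x)| <=
  eps * (a ^+ 2 * (s - t) +
    ex E (fun w => 1 + Nr w ^+ (2 * m.+1) + `|x + a * (M s w - M t w)| ^+ (2 * m.+1))).
Proof.
move=> t0 ts eps0 rg Wmem Weq W0; have s0 := le_trans t0 ts.
have mY := all_moments_affine a x t0 s0.
have h1 := tsum_martingale H_filtration Et_cond M0 M_moments hI hII hIII lo0 up0 hIV
  x t0 ts Wmem Weq.
set p := (2 * m.+1)%N in W0 *.
set Y := fun w => x + a * (M s w - M t w).
have LZ : Lone E (fun w => 1 + Nr w ^+ p + `|Y w| ^+ p).
  apply: LoneD; last by case: mY.
  by apply: LoneD; [exact: Lone_cst|exact: Lone_pow].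
have LW : Lone E (fun w => tsum W w 0 (Y w)).
  apply: bounded_Lone; last first.
    by have [c c0 hc] := tsum_bounded W; exists c => w; exact: hc.
  apply: (teval_mem _ _ (rv_linear E) (@rv_ClLip _ _ _ E)) => [i||]; last exact: ClLip_tX.
    exact: (H_rv H_filtration t0).
  by case: mY.
have h2 : `|ex E (fun w => g0 w (Y w)) - ex E (fun w => tsum W w 0 (Y w))| <=
    eps * ex E (fun w => 1 + Nr w ^+ p + `|Y w| ^+ p).
  rewrite -exZ //; apply: ex_dist_le => //; [exact: Lone_growth|exact: LoneZ|].
  by move=> w; rewrite distrC; exact: W0.
rewrite [leRHS]mulrDr [leRHS]addrC [eps * (a ^+ 2 * _)]mulrC.
rewrite -(subrKA (ex E (fun w => tsum W w 0 (Y w)))).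
by apply: le_trans (ler_normD _ _) _; exact: lerD.
Qed.

End one_function.

Lemma sqrt_le1D (t : R) : 0 <= t -> Num.sqrt t <= 1 + t.
Proof.
move=> t0; have s0 := sqrtr_ge0 t; have := sqr_sqrtr t0.
have := sqr_ge0 (Num.sqrt t - 1); rewrite sqrrB expr1n mulr1 => h e; lra.
Qed.

Lemma tsum_cst (W : tensor R Omega) t x : (forall i, exists c, tcoef W i = fun=> c) ->
  forall w w', tsum W w t x = tsum W w' t x.
Proof.
move=> hW w w'; apply: eq_bigr => i _; by have [c ->] := hW i.
Qed.

(** With the constants as [S], a datum that does not depend on [w] yields a deterministic [W], whose
    expectation at a deterministic point is its value. *)
Lemma constants_linear : linear_space [set X : Omega -> R | exists c, X = fun=> c].
Proof.
split=> [|X Y [c ->] [c' ->]|a X [c ->]]; first by exists 0.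
  by exists (c + c').
by exists (a * c).
Qed.

Lemma constants_stable : ClLip_stable [set X : Omega -> R | exists c, X = fun=> c].
Proof.
move=> n phi X _ hX; have /choice[c hc] := hX.
by exists (phi (\row_i c i)); apply/funext => w; congr phi; apply/rowP => i; rewrite !mxE hc.
Qed.

(** [E[phi (x + sqrt t M_1)]] is treated on the fixed interval [[0, 1]] with the scale [a = sqrt t],
    for which [a^2 (1 - 0) = t]. The parameter [t] thus becomes the time of the equation without any
    scaling property of [M]. *)
Theorem Gnormal_M1 : Gnormal E (M 1) lo up.
Proof.
have mM : all_moments E (M 1) by exact: all_momentsM.
split; first by case: mM.
move=> phi hphi.
have [C [m [C0 g_lip g_0]]] := @ClLip_uniform_growth R Omega R phi (fun _ y => y) (fun=> 0)
  hphi (fun=> lexx 0) ltac:(by move=> w y; rewrite add0r) (fun _ _ _ => lexx _).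
pose g (w : Omega) y := phi y.
pose Nr (w : Omega) : R := 0.
have N0 w : 0 <= Nr w by exact: lexx.
have {}g_lip w y y' : `|g w y - g w y'| <=
  C * (1 + Nr w ^+ m + `|y| ^+ m + `|y'| ^+ m) * `|y - y'| := g_lip w y y'.
have {}g_0 w : `|g w 0| <= C * (1 + Nr w ^+ m) := g_0 w.
have mN : all_moments E Nr := all_moments_cst E 0.
have incr0 w : M 1 w - M 0 w = M 1 w by rewrite M0 subr0.
have mY a x := all_moments_affine a x (lexx 0) (ler01 : 0 <= 1 :> R).
have rphi a x : rv E (fun w => phi (x + a * (M 1 w - M 0 w))).
  by apply: (stable_comp (@rv_ClLip _ _ _ E) hphi); case: (mY a x).
have Lphi a x : Lone E (fun w => phi (x + a * (M 1 w - M 0 w))).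
  by apply: (Lone_growth (g0 := g) N0 C0 g_lip g_0 mN (mY a x)); exact: rphi.
pose u t x := ex E (fun w => phi (x + Num.sqrt t * (M 1 w - M 0 w))).
exists u; split.
  move=> t x _; rewrite -Ehat_fin //; congr Ehat.
  by apply/funext => w; rewrite incr0.
apply: (approximable_viscosity lo0 up0); exists m => T eps T0 eps0.
set p := (2 * m.+1)%N; have pE : p = (2 * m).+2 by rewrite /p mulnS.
pose mu := ex E (fun w => `|M 1 w - M 0 w| ^+ p).
have mu0 : 0 <= mu by apply: ex_ge0 => w; exact: exprn_ge0.
pose q : R := 3 ^+ p.
have q0 : 0 <= q by exact: exprn_ge0.
have TT : 0 <= (1 + T) ^+ p by rewrite exprn_ge0 // addr_ge0.
(* Bounds [t + E[1 + |x + sqrt t M_1|^p]] by [K bpow m x], using [sqrt t <= 1 + T] and the factor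
   [q = 3^p] of [expn_normD_le]. *)
pose K := T + (1 + q + q * (1 + T) ^+ p * mu).
have K1 : 1 <= K.
  have : 0 <= q * (1 + T) ^+ p * mu by rewrite !mulr_ge0.
  by rewrite /K; lra.
have [e e0 eK] : exists2 e, 0 < e & e * K = eps.
  have K0 : 0 < K by lra.
  by exists (eps / K); [rewrite divr_gt0|rewrite divfK // gt_eqF].
have [W [Wres Winit Wmem]] := approx_growth (g0 := g) lo_gt0 up_gt0 N0 C0 g_lip g_0 T0 e0.
have Wcst := Wmem _ constants_linear constants_stable (ex_intro _ 0 erefl)
  (fun y => ex_intro _ (phi y) erefl).
have [CW CW0 hCW] := tsum_bounded W.
(* [W] does not depend on [w], so any argument would do in place of [point]. *)
exists (tsum W point), CW; split.
- exists (tsum_t W point), (tsum_y W point), (tsum_yy W point); split; first exact: tsum_C12.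
  move=> t x t0 tT; apply: le_trans (Wres point t x (ltW t0) tT) _.
  by rewrite -eK ler_peMr // ltW.
- by move=> t x; exact: hCW.
- move=> x; rewrite distrC; apply: le_trans (Winit point x) _.
  rewrite -/p bpow_norm -pE expr0n /= addr0 ler_wpM2r ?addr_ge0 ?exprn_ge0 //.
  by rewrite -eK ler_peMr // ltW.
- move=> t x t0 tT; have sq : Num.sqrt t ^+ 2 * (1 - 0) = t by rewrite subr0 mulr1 sqr_sqrtr.
  have := growth_step (g0 := g) N0 C0 g_lip g_0 mN (W := W) (t := 0) (s := 1) (a := Num.sqrt t)
    (x := x) (eps := e) (lexx 0) ler01 (ltW e0) (rphi _ _).
  rewrite sq -/p => h.
  have {h} := h _ _ _.
  have -> : (fun w => tsum W w t x) = (fun=> tsum W point t x).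
    by apply/funext => w; exact: tsum_cst.
  rewrite ex_cst => h; apply: le_trans (h _ _ _) _.
  + move=> i; have [c ->] := Wcst i.
    exact: (stable_cst (H_stable H_filtration (lexx 0))).
  + by move=> w r y r0 rt; apply: Wres => //; exact: le_trans rt tT.
  + exact: Winit.
  rewrite -eK -mulrA ler_pM2l //.
  have b1 := bpow_ge1 m x; have bE := bpow_norm m x; rewrite -pE in bE.
  set b := bpow m x in b1 bE *.
  pose Z (w : Omega) := b * (1 + q) + b * (q * (1 + T) ^+ p) * `|M 1 w - M 0 w| ^+ p.
  have b0 : 0 <= b by lra.
  have LM : Lone E (fun w => `|M 1 w - M 0 w| ^+ p).
    by have [_] := all_moments_incr (lexx 0) (ler01 : 0 <= 1 :> R).
  have c0 : 0 <= b * (q * (1 + T) ^+ p) by rewrite !mulr_ge0.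
  have LZ : Lone E Z by apply: LoneD; [exact: Lone_cst|exact: LoneZ].
  have le1 : ex E (fun w => 1 + 0 ^+ p + `|x + Num.sqrt t * (M 1 w - M 0 w)| ^+ p) <= ex E Z.
    apply: ex_le => //.
      by apply: LoneD; [exact: Lone_cst|case: (mY (Num.sqrt t) x)].
    move=> w; rewrite expr0n /= addr0 /Z.
    set y := `|M 1 w - M 0 w|; have y0 : 0 <= y by exact: normr_ge0.
    have s1 : Num.sqrt t <= 1 + T by apply: le_trans (sqrt_le1D t0) _; rewrite lerD2l.
    have i1 : `|x + Num.sqrt t * (M 1 w - M 0 w)| ^+ p <= q * (1 + `|x| ^+ p + ((1 + T) * y) ^+ p).
      have Ty : 0 <= (1 + T) * y by rewrite mulr_ge0 // addr_ge0.
      apply: le_trans (expn_normD_le p (normr_ge0 x) Ty).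
      rewrite lerXn2r ?nnegrE ?addr_ge0 //; apply: le_trans (ler_normD _ _) _.
      by rewrite lerD2l normrM ger0_norm ?sqrtr_ge0 // ler_wpM2r.
    rewrite exprMn in i1.
    have yp : 0 <= (q * (1 + T) ^+ p) * y ^+ p by rewrite !mulr_ge0 // exprn_ge0.
    have := ler_wpM2r yp b1; have := ler_wpM2r q0 b1.
    rewrite bE in i1 *; move: i1; lra.
  have le2 : ex E Z <= b * (1 + q) + b * (q * (1 + T) ^+ p) * mu.
    by apply: le_trans (exD (Lone_cst E _) (LoneZ _ LM)) _; rewrite ex_cst exZ.
  have tb : t <= T * b by apply: le_trans tT _; rewrite ler_peMr.
  rewrite /K; move: le1 le2 tb; lra.
Qed.

Lemma stable_row_mx (S : set (Omega -> R)) d (phi : 'rV[R]_(d + 1) -> R)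
    (X : 'I_d -> Omega -> R) (Y : Omega -> R) :
  ClLip_stable S -> ClLip phi -> (forall i, S (X i)) -> S Y ->
  S (fun w => phi (row_mx (\row_i X i w) (const_mx (Y w)))).
Proof.
move=> Sst hphi SX SY.
pose Z (j : 'I_(d + 1)) w := match fintype.split j with inl i => X i w | inr _ => Y w end.
have SZ j : S (Z j) by rewrite /Z; case: fintype.split.
have := Sst _ phi Z hphi SZ; congr S; apply/funext => w; congr phi.
by apply/rowP => j; rewrite !mxE /Z; case: fintype.split => k; rewrite !mxE.
Qed.

(** For each frozen [w] the inner expectation is a value of the viscosity solution with datum [g w],
    hence close to [W w] by comparison. On the other side [growth_step] brings [E[A]] close to
    [E[B]], where [B] is [W] at time [s - t] and position 0. Both sides use the same random [W],
    with coefficients in [H t]. *)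
Theorem G_brownian_increment (dOmega' : measure_display) (Omega' : measurableType dOmega')
    (E' : sublinear_expectation R Omega') (xi : Omega' -> R) (d : nat) (ti : 'I_d -> R)
    (t s : R) (phi : 'rV[R]_(d + 1) -> R) :
  Gnormal E' xi lo up -> (forall i, 0 <= ti i <= t) -> 0 <= t -> t <= s -> ClLip phi ->
  Ehat E (fun w => phi (row_mx (\row_i M (ti i) w) (const_mx (M s w - M t w)))) =
  Ehat E (fun w => fine (Ehat E' (fun w' =>
    phi (row_mx (\row_i M (ti i) w) (const_mx (Num.sqrt (s - t) * xi w')))))).
Proof.
move=> [_ hxi] hti t0 ts hphi.
pose X w y : 'rV[R]_(d + 1) := row_mx (\row_i M (ti i) w) (const_mx y).
pose Nr w := \sum_i `|M (ti i) w|.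
have N0 w : 0 <= Nr w by rewrite sumr_ge0.
have X_le w y : `|X w y| <= Nr w + `|y|.
  apply: mx_norm_le => [|j]; first by rewrite addr_ge0.
  rewrite !mxE; case: fintype.split => k; rewrite !mxE; last by rewrite lerDr.
  by rewrite /Nr (bigD1 k) //= -addrA lerDl addr_ge0 // sumr_ge0.
have X_lip w y y' : `|X w y - X w y'| <= `|y - y'|.
  apply: mx_norm_le => // j; rewrite !mxE; case: fintype.split => k; rewrite !mxE //.
  by rewrite subrr normr0.
have [C [m [C0 g_lip g_0]]] := ClLip_uniform_growth hphi N0 X_le X_lip.
pose g w y := phi (X w y).
have Hlin := H_linear H_filtration t0; have Hst := H_stable H_filtration t0.
have ti0 i : 0 <= ti i by have /andP[] := hti i.
have HM i : H t (M (ti i)).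
  by have /andP[a b] := hti i; apply: (H_mono H_filtration a b); exact: (M_H hI).
have HN : H t Nr by apply: (stable_sum Hlin Hst) => i; exact: (stable_norm Hst).
have Hg y : H t (fun w => g w y).
  exact: (stable_row_mx (Y := fun=> y) Hst hphi HM (stable_cst Hst y)).
have mN : all_moments E Nr.
  by apply: all_moments_sum => i; apply: all_moments_norm; exact: all_momentsM.
have s0 := le_trans t0 ts.
have mY := all_moments_affine 1 0 t0 s0.
have rM i : rv E (M (ti i)) by case: (all_momentsM (ti0 i)).
have rg : rv E (fun w => g w (0 + 1 * (M s w - M t w))).
  by apply: (stable_row_mx (@rv_ClLip _ _ _ E) hphi rM); case: mY.
have LA := Lone_growth N0 C0 g_lip g_0 mN mY rg.
set A := fun w => g w (0 + 1 * (M s w - M t w)) in rg LA.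
have -> : (fun w => phi (row_mx (\row_i M (ti i) w) (const_mx (M s w - M t w)))) = A.
  by apply/funext => w; rewrite /A add0r mul1r.
pose tau := s - t; have tau0 : 0 <= tau by rewrite subr_ge0.
set psi := fun w => fine _.
pose p := (2 * m.+1)%N; have pE : p = (2 * m).+2 by rewrite /p mulnS.
pose L := expR (brate (Num.max lo up) m * tau) * bpow m 0.
have L0 : 0 <= L by rewrite mulr_ge0 ?expR_ge0 // (le_trans ler01) // bpow_ge1.
pose K1 := ex E (fun w => 1 + Nr w ^+ p + `|0 + 1 * (M s w - M t w)| ^+ p).
pose K2 := ex E (fun w => 1 + Nr w ^+ p + (2 * tau + L)).
have LNp : Lone E (fun w => 1 + Nr w ^+ p) by apply: LoneD; [exact: Lone_cst|exact: Lone_pow].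
have LK2 : Lone E (fun w => 1 + Nr w ^+ p + (2 * tau + L)) by apply: LoneD => //; exact: Lone_cst.
(* [psi] is not known to be in [rv], so [Ehat E psi] may be the extension by infimum. It is enclosed
   by monotonicity alone, in the extended reals; finiteness follows afterwards from the case
   [e = 1]. *)
have close (e : R) : 0 < e ->
  ((ex E A - e * (tau + K1 + K2))%:E <= Ehat E psi <= (ex E A + e * (tau + K1 + K2))%:E)%E.
  (* The comparison uses the equation one unit of time beyond [tau]. *)
  move=> e0; have T0 : 0 <= tau + 1 by rewrite addr_ge0.
  have [W [Wres Winit Wmem]] := approx_growth (g0 := g) lo_gt0 up_gt0 N0 C0 g_lip g_0 T0 e0.
  have Wm := Wmem _ Hlin Hst HN Hg.
  pose B w := tsum W w tau 0.
  have LB : Lone E B.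
    apply: bounded_Lone; last first.
      by have [c c0 hc] := tsum_bounded W; exists c => w; exact: hc.
    apply: (H_rv H_filtration t0).
    apply: (teval_mem _ _ Hlin Hst Wm) => [|i]; [exact: (stable_cst Hst)|exact: ClLip_tX].
  have near_psi w : `|psi w - B w| <= e * (1 + Nr w ^+ p + (2 * tau + L)).
    have hgw : ClLip (g w).
      exists (C * (1 + Nr w ^+ m)), m; split; first by rewrite mulr_gt0 // ltr_pwDl ?exprn_ge0.
      move=> y y'; apply: le_trans (g_lip w y y') _; rewrite ler_wpM2r // -mulrA ler_pM2l //.
      have n0 : 0 <= Nr w ^+ m by exact: exprn_ge0.
      have y0 : 0 <= `|y| ^+ m + `|y'| ^+ m by rewrite addr_ge0 // exprn_ge0.
      have := mulr_ge0 n0 y0; lra.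
    have [u [hu [hv _]]] := hxi _ hgw.
    have -> : psi w = u tau 0.
      rewrite /psi -[RHS]/(fine (u tau 0)%:E) -hu //; congr (fine (Ehat _ _)).
      by apply/funext => w'; rewrite add0r.
    have c0 : 0 <= e * (1 + Nr w ^+ p) by rewrite mulr_ge0 ?(ltW e0) // addr_ge0 // exprn_ge0.
    have [CW _ hCW] := tsum_bounded W.
    have res r y : 0 < r -> r < tau + 1 -> `|tsum_t W w r y - Gfun lo up (tsum_yy W w r y)| <= e.
      by move=> r0 rT; apply: Wres; exact: ltW.
    (* For fixed [w] the part in [Nr w] is constant in [y] and goes into the additive constant of
       the comparison; the barrier carries the power of [y]. *)
    have init y : `|g w y - tsum W w 0 y| <= e * (1 + Nr w ^+ p) + e * bpow m y.
      rewrite distrC; apply: le_trans (Winit w y) _; rewrite -/p -mulrDr ler_pM2l //.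
      by rewrite bpow_norm -pE lerD2l lerDr.
    apply: le_trans (viscosity_close lo0 up0 tau0 c0 e0 (ltW e0) hv (tsum_C12 W w)
      (hCW w) res init 0) _.
    by rewrite le_eqVlt; apply/orP; left; apply/eqP; rewrite /L; ring.
  have step := growth_step N0 C0 g_lip g_0 mN (x := 0) t0 ts (ltW e0) rg Wm _ Winit.
  rewrite expr1n mul1r -/tau -/p -/A -/K1 -/B in step.
  have {}step : `|ex E A - ex E B| <= e * (tau + K1).
    by apply: step => w r y r0 rT; apply: Wres => //; apply: le_trans rT _; rewrite lerDl.
  have LZ := LoneZ e LK2.
  have exZ' : ex E (fun w => e * (1 + Nr w ^+ p + (2 * tau + L))) = e * K2 by rewrite exZ // ltW.
  move: step; rewrite ler_norml => /andP[st1 st2]; apply/andP; split.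
    apply: (@le_trans _ _ (Ehat E (fun w => B w - e * (1 + Nr w ^+ p + (2 * tau + L))))).
      rewrite Ehat_fin; last exact: LoneB.
      by rewrite lee_fin; have := exB_le LB LZ; rewrite exZ'; lra.
    by apply: Ehat_le => w; have := near_psi w; rewrite ler_norml => /andP[]; lra.
  apply: (@le_trans _ _ (Ehat E (fun w => B w + e * (1 + Nr w ^+ p + (2 * tau + L))))).
    by apply: Ehat_le => w; have := near_psi w; rewrite ler_norml => /andP[]; lra.
  rewrite Ehat_fin; last exact: LoneD.
  by rewrite lee_fin; have := exD LB LZ; rewrite exZ'; lra.
have fin : Ehat E psi = (ex E psi)%:E.
  rewrite fineK //; have /andP[h1 h2] := close 1 ltr01; rewrite fin_numE.
  by apply/andP; split; [rewrite gt_eqF // (lt_le_trans _ h1) // ltNyr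
    |rewrite lt_eqF // (le_lt_trans h2) // ltry].
rewrite (Ehat_fin LA) fin; congr EFin.
have K10 : 0 <= K1.
  by apply: ex_ge0 => w; rewrite addr_ge0 ?addr_ge0 // exprn_ge0.
have K20 : 0 <= K2.
  apply: ex_ge0 => w; apply: addr_ge0; first by rewrite addr_ge0 // exprn_ge0.
  by rewrite addr_ge0 // mulr_ge0.
apply: (@eq_small _ _ _ (tau + K1 + K2)).
  by apply: addr_ge0 => //; exact: addr_ge0.
move=> e e0; have := close e e0; rewrite fin !lee_fin => /andP[h1 h2].
by rewrite ler_norml; apply/andP; split; lra.
Qed.

End growth_step.

Theorem theorem5p1 (R : realType) (dOmega : measure_display)
  (Omega : measurableType dOmega) (E : sublinear_expectation R Omega)
  (H : R -> set (Omega -> R)) (Et : R -> (Omega -> R) -> Omega -> R)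
  (M : R -> Omega -> R) (lo up : R)
  (H_filtration : filtration E H)
  (Et_cond : conditional_expectation E H Et)
  (M0 : forall w, M 0 w = 0)
  (M_moments : forall p t : R, 0 < p -> 0 <= t ->
     (choquet E (fun w => (`|M t w| `^ p)%R) < +oo)%E ->
     (Ehat E (fun w => (`|M t w| `^ p)%R) < +oo)%E)
  (hI : martingale E H Et M /\ martingale E H Et (fun t w => - M t w))
  (up_gt0 : 0 < up)
  (hII : martingale E H Et (fun t w => M t w ^+ 2 - up * t))
  (lo_gt0 : 0 < lo) (lo_le_up : lo <= up)
  (hIII : martingale E H Et (fun t w => - (M t w ^+ 2 - lo * t)))
  (hIV : forall T : R, 0 < T -> modulusW E M T delta @[delta --> 0^'+] --> 0%E) :
  Gnormal E (M 1) lo up /\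
  forall (dOmega' : measure_display) (Omega' : measurableType dOmega')
    (E' : sublinear_expectation R Omega') (xi : Omega' -> R),
    Gnormal E' xi lo up ->
    forall (d : nat) (ti : 'I_d -> R) (t s : R) (phi : 'rV[R]_(d + 1) -> R),
      (forall i, 0 <= ti i <= t) ->
      (forall i j : 'I_d, (i <= j)%N -> ti i <= ti j) ->
      0 <= t -> t <= s -> ClLip phi ->
      Ehat E (fun w => phi (row_mx (\row_i M (ti i) w)
                                   (const_mx (M s w - M t w)))) =
      Ehat E (fun w => fine (Ehat E' (fun w' =>
                phi (row_mx (\row_i M (ti i) w)
                            (const_mx (Num.sqrt (s - t) * xi w')))))).
Proof.
split; last first.
  move=> dO' O' E' xi hxi d ti t s phi hti _ t0 ts hphi.
  exact: (G_brownian_increment H_filtration Et_cond M0 M_moments hI hII hIII lo_gt0 up_gt0 hIV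
    hxi hti t0 ts hphi).
exact: (Gnormal_M1 H_filtration Et_cond M0 M_moments hI hII hIII lo_gt0 up_gt0 hIV).
Qed.
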